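(* Let $n\ge3$, let $\Omega$ be a bounded, strictly convex domain of $\mathbb{R}^n$ with $\partial\Omega\in C^3$, and let $\varphi$ be a function on $\partial\Omega$. Then for any $A\in\mathcal{A}$ and $b\in\mathbb{R}^n$, the following equivalence holds: there exists a constant $c$ such that the problem $$\begin{cases}\det(D^2u)=1\quad\text{in }\mathbb{R}^n\setminus\overline{\Omega},\\ u=\varphi\quad\text{on }\partial\Omega,\\ \lim_{|x|\to\infty}\Big(u(x)-\Big(\frac12 xAx^T+b\cdot x+c\Big)\Big)=0\end{cases}$$ has a viscosity solution in $C^0(\mathbb{R}^n\setminus\Omega)$ if and only if $\varphi$ is semi-convex with respect to $\partial\Omega$.
   Context: $\mathcal{A}$ is the set of real $n\times n$ symmetric positive definite matrices $A$ with $\det(A)=1$; points $x\in\mathbb{R}^n$ are row vectors. $x'=(x_1,\dots,x_{n-1})$; $B'_\delta(0')$ is the open ball in $\mathbb{R}^{n-1}$ of radius $\delta$ centered at $0'$. Strict convexity of a domain with $C^2$ boundary means that the principal curvatures of $\partial\Omega$ are positive. Locally convex: $u\in C^0(D)$ is locally convex in an open set $D\subset\mathbb{R}^n$ if every $x\in D$ is the center of an open ball $B\subset D$ on which $u$ is convex. Viscosity solution of $\det(D^2u)=1$ in an open set $D$: let $u\in C^0(D)$ be locally convex. $u$ is a viscosity subsolution if for any $v\in C^2(D)$ and any local maximum point $x_0\in D$ of $u-v$, $\det(D^2v(x_0))\ge 1$. $u$ is a viscosity supersolution if for any locally convex $v\in C^2(D)$ and any local minimum point $x_0\in D$ of $u-v$,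 $\det(D^2v(x_0))\le 1$. $u$ is a viscosity solution if it is both. Local coordinate system at $\xi\in\partial\Omega$: a coordinate system $(x',x_n)$ chosen such that $x=0$ at $\xi$, the positive $x_n$-axis directs to the interior of $\Omega$, and $\partial\Omega$ is locally represented by the graph $x_n=\rho(x')$ for $|x'|<\delta(\xi)$, for some constant $\delta(\xi)>0$ and a function $\rho:B'_{\delta(\xi)}(0')\to\mathbb{R}$ with $\rho(0')=0$. Semi-convexity with respect to $\partial\Omega$: $\varphi$ is semi-convex with respect to $\partial\Omega$ at $\xi\in\partial\Omega$ if, in the local coordinate system at $\xi$, the function $\psi(x'):=\varphi(x',\rho(x'))$ is semi-convex in $B'_{\delta(\xi)}(0')$, i.e. there is a constant $K(\xi)>0$ such that $\psi(x')+\frac{K(\xi)}{2}|x'|^2$ is convex in $B'_{\delta(\xi)}(0')$. $\varphi$ is semi-convex with respect to $\partial\Omega$ if this holds at every $\xi\in\partial\Omega$. *)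

(* Defs.v *)
From HB Require Import structures.
From mathcomp Require Import all_boot all_order all_algebra.
From mathcomp Require Import all_classical all_reals all_analysis.
Set Implicit Arguments.
Unset Strict Implicit.
Unset Printing Implicit Defensive.
Import Order.TTheory GRing.Theory Num.Theory.
Import numFieldNormedType.Exports.
Local Open Scope classical_set_scope.
Local Open Scope ring_scope.

Section euclidean.
Context {R : realType} {n : nat}.

Definition dot (x y : 'rV[R]_n) : R := (x *m y^T) 0 0.

(* The library norm `|x| on row vectors is the sup norm; it induces the same
   topology, but balls and lengths below are Euclidean. *)
Definition enorm (x : 'rV[R]_n) : R := Num.sqrt (dot x x).

Definition eball (c : 'rV[R]_n) (r : R) : set 'rV[R]_n :=
  [set x | enorm (x - c) < r].

(* The filter of "|x| -> oo". *)
Definition at_infinity : set_system 'rV[R]_n :=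
  filter_from setT (fun M : R => [set x | M < enorm x]).

End euclidean.

Definition boundary {T : topologicalType} (A : set T) : set T :=
  closure A `\` interior A.

Section calculus.
Context {R : realType} {n : nat}.
Implicit Types (D : set 'rV[R]_n) (f : 'rV[R]_n -> R).

Definition partial (i : 'I_n) f (x : 'rV[R]_n) : R := 'D_(delta_mx 0 i) f x.

(* f is C^k on the open set D. *)
Fixpoint Ck (k : nat) D f : Prop :=
  (forall x, D x -> {for x, continuous f}) /\
  if k is k'.+1 then
    forall i : 'I_n, (forall x, D x -> derivable f x (delta_mx 0 i)) /\
                     Ck k' D (partial i f)
  else True.

Definition gradient f (x : 'rV[R]_n) : 'rV[R]_n := \row_i partial i f x.

Definition hessian f (x : 'rV[R]_n) : 'M[R]_n :=
  \matrix_(i, j) partial j (partial i f) x.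

End calculus.

Section viscosity.
Context {R : realType} {n : nat}.
Implicit Types (D : set 'rV[R]_n) (u v : 'rV[R]_n -> R).

Definition locally_convex D u : Prop :=
  Ck 0 D u /\
  forall x, D x -> exists2 r : R, 0 < r &
    eball x r `<=` D /\ convex_function (eball x r) u.

(* In the next three definitions D is meant to be open, so that a local
   extremum at a point of D is tested on a full neighbourhood. *)
Definition viscosity_subsolution D u : Prop :=
  forall v, Ck 2 D v -> forall x0, D x0 ->
    (\forall x \near x0, u x - v x <= u x0 - v x0) ->
    1 <= \det (hessian v x0).

Definition viscosity_supersolution D u : Prop :=
  forall v, Ck 2 D v -> locally_convex D v -> forall x0, D x0 ->
    (\forall x \near x0, u x0 - v x0 <= u x - v x) ->
    \det (hessian v x0) <= 1.

Definition viscosity_solution D u : Prop :=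
  [/\ locally_convex D u, viscosity_subsolution D u &
      viscosity_supersolution D u].

(* The set of real symmetric positive definite matrices of determinant 1. *)
Definition calA : set 'M[R]_n :=
  [set A | [/\ A^T = A,
               forall x : 'rV[R]_n, x != 0 -> 0 < (x *m A *m x^T) 0 0 &
               \det A = 1]].

Definition quadratic (A : 'M[R]_n) (b : 'rV[R]_n) (c : R) (x : 'rV[R]_n) : R :=
  2^-1 * (x *m A *m x^T) 0 0 + dot b x + c.

Definition exterior_solution (Omega : set 'rV[R]_n) (phi : 'rV[R]_n -> R)
    (A : 'M[R]_n) (b : 'rV[R]_n) (c : R) (u : 'rV[R]_n -> R) : Prop :=
  [/\ {within ~` Omega, continuous u},
      viscosity_solution (~` closure Omega) u,
      forall x, boundary Omega x -> u x = phi x &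
      (u x - quadratic A b c x) @[x --> at_infinity] --> (0 : R)].

End viscosity.

Section domains.
Context {R : realType} {n : nat}.
Implicit Types (Omega : set 'rV[R]_n.+1) (xi : 'rV[R]_n.+1) (Q : 'M[R]_n.+1)
  (delta : R) (rho : 'rV[R]_n -> R).

Definition domain Omega : Prop :=
  [/\ open Omega, connected Omega & Omega !=set0].

(* The point (x', t) : the last coordinate is t. *)
Definition rjoin (x' : 'rV[R]_n) (t : R) : 'rV[R]_n.+1 :=
  \row_i (if unlift ord_max i is Some j then x' 0 j else t).

(* The point with coordinates (x', t) in the orthonormal frame centred at xi
   whose axes are the rows of Q. *)
Definition chart xi Q (x' : 'rV[R]_n) (t : R) : 'rV[R]_n.+1 :=
  xi + rjoin x' t *m Q.

(* (xi, Q, delta, rho) is a local coordinate system at xi.  The height h cuts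
   out the sheet of the boundary through xi: a line parallel to the last axis
   meets the boundary of a bounded domain in other points too.  The clause on
   Omega says that the positive last axis points to the interior. *)
Definition local_coordinates Omega xi Q delta rho : Prop :=
  [/\ Q *m Q^T = 1%:M, 0 < delta, rho 0 = 0 &
      exists2 h : R, 0 < h &
        forall x', eball 0 delta x' ->
          `|rho x'| < h /\
          forall t, `|t| < h ->
            (boundary Omega (chart xi Q x' t) <-> t = rho x') /\
            (Omega (chart xi Q x' t) <-> rho x' < t)].

Definition Ck_boundary (k : nat) Omega : Prop :=
  forall xi, boundary Omega xi -> exists Q delta rho,
    local_coordinates Omega xi Q delta rho /\ Ck k (eball 0 delta) rho.

(* Shape operator of the graph of rho for the normal pointing to the side
   t > rho x': second fundamental form times the inverse of the first one. *)
Definition shape_operator rho (x' : 'rV[R]_n) : 'M[R]_n :=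
  let p := gradient rho x' in
  (Num.sqrt (1 + dot p p))^-1 *: (hessian rho x' *m invmx (1%:M + p^T *m p)).

(* Principal curvatures with respect to the inner normal. *)
Definition principal_curvature Omega xi (kappa : R) : Prop :=
  exists Q delta rho,
    [/\ local_coordinates Omega xi Q delta rho, Ck 2 (eball 0 delta) rho &
        eigenvalue (shape_operator rho 0) kappa].

Definition strictly_convex Omega : Prop :=
  Ck_boundary 2 Omega /\
  forall xi, boundary Omega xi ->
    forall kappa, principal_curvature Omega xi kappa -> 0 < kappa.

Definition semi_convex_on (D : set 'rV[R]_n) (psi : 'rV[R]_n -> R) : Prop :=
  exists2 K : R, 0 < K &
    convex_function D (fun x' => psi x' + K / 2 * enorm x' ^+ 2).

(* The local coordinate system (in particular its radius delta) is chosen. One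
   cannot ask this in all of them: delta could be so large that the gradient
   of rho blows up at the edge of the ball, where even the restriction of a
   linear function fails to be semi-convex. *)
Definition semi_convex_at Omega (phi : 'rV[R]_n.+1 -> R) xi : Prop :=
  exists Q delta rho,
    local_coordinates Omega xi Q delta rho /\
    semi_convex_on (eball 0 delta) (fun x' => phi (chart xi Q x' (rho x'))).

Definition semi_convex_wrt Omega (phi : 'rV[R]_n.+1 -> R) : Prop :=
  forall xi, boundary Omega xi -> semi_convex_at Omega phi xi.

End domains.

(* Main.v *)
Require Import Defs.
From mathcomp Require Import all_boot all_order all_algebra.
From mathcomp Require Import all_classical all_reals all_analysis.
From mathcomp Require Import ring lra.
Set Implicit Arguments.
Unset Strict Implicit.
Unset Printing Implicit Defensive.
Import Order.TTheory GRing.Theory Num.Theory.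
Import numFieldNormedType.Exports.
Local Open Scope classical_set_scope.
Local Open Scope ring_scope.

(** If [u] solves the problem, then [phi] is semi-convex because [u] is locally
    convex outside a strictly convex domain. A chord in the tangent hyperplane
    at a boundary point [xi], centred at [xi], lies outside, so [u xi] is at most
    the mean of the values of [u] at its end points. These ends are at a distance
    from the boundary which is quadratic in the length of the chord, and
    convexity along the lines transversal to the boundary bounds the decrease of
    [u] over that distance. In a chart this is midpoint convexity up to a
    quadratic error ([semi_convex_of_solution]).

    Conversely, let [phi] be semi-convex. The solution is the upper envelope of
    the subsolutions that are at most [phi] on the boundary and at most
    [Q x = 1/2 x A x^T + b.x + c] outside the domain, for a large constant [c]. The
    ingredients are the following.

    - The competitors are continuous, midpoint convex at every point of the
      exterior, and such that every paraboloid touching it from above has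
      determinant at least 1 ([germ]). This is stable under maxima and upper
      envelopes ([germ_max], [envelope_germ]), and paraboloids of determinant at
      least 1 satisfy it because the determinant is monotone on positive forms
      ([det_le_of_qf_le]).

    - Strict convexity of the boundary gives, at every boundary point [eta], a
      vector [nu] with [|z - eta|^2 <= C nu.(z - eta)] on the closure of the
      domain ([global_support]). Subtracting a multiple of [nu] from a slope absorbs
      both the semi-convexity constant and the form [A]: a paraboloid with
      Hessian [A] passes through [phi eta] and is below [phi] on the boundary
      ([quadratic_barrier]).

    - Far away, [Q x - a / s^(1/4)] with [s = x A x^T] is a subsolution
      asymptotic to [Q], since [n >= 3] ([outer_profile_germ]). For a large [c]
      it is glued to the paraboloid of [eta] by a maximum ([glue]). The resulting
      family ([subsolution_family]) makes the envelope attain [phi] and squeezes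
      it against [Q] at infinity.

    - Convexity along the rays leaving the domain bounds every competitor from
      above near the boundary, as it is capped by [Q] ([perron_upper]); so the
      envelope is continuous up to the boundary.

    - The envelope is a supersolution: where it is below [Q] a paraboloid of
      determinant greater than 1 touching it from below could be lifted, against
      maximality; where it equals [Q] such a paraboloid touches [Q] from below,
      against the monotonicity of the determinant ([perron_supersolution]). *)

(** * Limits of real functions and order *)

Section limits.
Context {R : realType}.

Lemma cvg_ge_lim (T : Type) (F : set_system T) {PF : ProperFilter F}
    (f : T -> R) (l x : R) :
  f @ F --> l -> (\forall t \near F, x <= f t) -> x <= l.
Proof.
move=> fl xf; apply: (closed_cvg (fun y => x <= y) _ xf l fl).
exact: closed_ge.
Qed.

Lemma cvg_le_lims (T : Type) (F : set_system T) {PF : ProperFilter F}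
    (f g : T -> R) (l m : R) :
  f @ F --> l -> g @ F --> m -> (\forall t \near F, f t <= g t) -> l <= m.
Proof.
move=> fl gm fg; rewrite -subr_ge0; apply: (cvg_ge_lim (cvgB gm fl)).
by apply: filterS fg => t; rewrite -subr_ge0.
Qed.

End limits.

(** * The Euclidean product and the maximum norm *)

Section dot.
Context {R : realType} {n : nat}.
Implicit Types (x y z : 'rV[R]_n) (M : 'M[R]_n).

Lemma dotE x y : dot x y = \sum_i x 0 i * y 0 i.
Proof. by rewrite /dot mxE; apply: eq_bigr => i _; rewrite mxE. Qed.

Lemma dotC x y : dot x y = dot y x.
Proof. by rewrite !dotE; apply: eq_bigr => i _; rewrite mulrC. Qed.

Lemma dotDl x y z : dot (x + y) z = dot x z + dot y z.
Proof. by rewrite /dot mulmxDl mxE. Qed.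

Lemma dotDr x y z : dot z (x + y) = dot z x + dot z y.
Proof. by rewrite /dot linearD mulmxDr mxE. Qed.

Lemma dotZl a x y : dot (a *: x) y = a * dot x y.
Proof. by rewrite /dot -scalemxAl mxE. Qed.

Lemma dotZr a x y : dot y (a *: x) = a * dot y x.
Proof. by rewrite /dot linearZ -scalemxAr mxE. Qed.

Lemma dotNl x y : dot (- x) y = - dot x y.
Proof. by rewrite -scaleN1r dotZl mulN1r. Qed.

Lemma dotNr x y : dot y (- x) = - dot y x.
Proof. by rewrite -scaleN1r dotZr mulN1r. Qed.

Lemma dotBl x y z : dot (x - y) z = dot x z - dot y z.
Proof. by rewrite dotDl dotNl. Qed.

Lemma dotBr x y z : dot z (x - y) = dot z x - dot z y.
Proof. by rewrite dotDr dotNr. Qed.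

Lemma dot0l x : dot 0 x = 0.
Proof. by rewrite /dot mul0mx mxE. Qed.

Lemma dot0r x : dot x 0 = 0.
Proof. by rewrite dotC dot0l. Qed.

Lemma dot_mulmxl M x y : dot (x *m M) y = dot x (y *m M^T).
Proof. by rewrite /dot trmx_mul trmxK mulmxA. Qed.

Lemma dot_delta x i : dot x (delta_mx 0 i) = x 0 i.
Proof.
rewrite dotE (bigD1 i)//= mxE !eqxx mulr1 big1 ?addr0// => j ji.
by rewrite mxE (negbTE ji) andbF mulr0.
Qed.

Lemma le_coord_norm x i : `|x 0 i| <= `|x|.
Proof.
rewrite [leRHS]/Num.norm /= mx_normrE.
by apply: (@le_bigmax _ _ _ 0 (fun ij : 'I_1 * 'I_n => `|x ij.1 ij.2|) (0, i)).
Qed.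

Lemma norm_leP x (r : R) : 0 <= r -> (forall i, `|x 0 i| <= r) -> `|x| <= r.
Proof.
move=> r0 xr; rewrite [leLHS]/Num.norm /= mx_normrE.
by apply/bigmax_leP; split=> // -[i j] _; rewrite ord1.
Qed.

Lemma norm_dot_le x y : `|dot x y| <= n%:R * `|x| * `|y|.
Proof.
rewrite dotE (le_trans (ler_norm_sum _ _ _))//.
rewrite (@le_trans _ _ (\sum_(i < n) `|x| * `|y|))//.
  by apply: ler_sum => i _; rewrite normrM ler_pM// le_coord_norm.
by rewrite sumr_const card_ord -mulrA mulr_natl.
Qed.

Lemma dot_ge0 x : 0 <= dot x x.
Proof. by rewrite dotE sumr_ge0// => i _; rewrite -expr2 sqr_ge0. Qed.

Lemma norm_sqr_le_dot x : `|x| ^+ 2 <= dot x x.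
Proof.
rewrite -(@ler_sqrt _ (`|x| ^+ 2)) ?dot_ge0// sqrtr_sqr normr_id.
apply: norm_leP; first exact: sqrtr_ge0.
move=> i; rewrite -sqrtr_sqr ler_sqrt ?dot_ge0// dotE (bigD1 i)//= -expr2 lerDl.
by apply: sumr_ge0 => j _; rewrite -expr2 sqr_ge0.
Qed.

Lemma dot_le_norm_sqr x : dot x x <= n%:R * `|x| ^+ 2.
Proof.
by rewrite expr2 mulrA (le_trans (ler_norm _))// norm_dot_le.
Qed.

Lemma dot_gt0 x : x != 0 -> 0 < dot x x.
Proof.
move=> x0; rewrite (lt_le_trans _ (norm_sqr_le_dot x))// exprn_gt0//.
by rewrite normr_gt0.
Qed.

Lemma dot_lt_ball x y (r : R) : dot x x < r -> dot y y < r ->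
  forall t : R, 0 <= t -> t <= 1 ->
  dot (t *: x + (1 - t) *: y) (t *: x + (1 - t) *: y) < r.
Proof.
move=> xr yr t t0 t1.
have D0 : 0 <= t * (1 - t) * dot (x - y) (x - y).
  by rewrite !mulr_ge0 ?dot_ge0// subr_ge0.
apply: (@le_lt_trans _ _ (t * dot x x + (1 - t) * dot y y)).
  rewrite -subr_ge0; apply: le_trans D0 _.
  rewrite !(dotDl, dotDr, dotZl, dotZr, dotNl, dotNr) (dotC y x).
  by rewrite le_eqVlt; apply/orP; left; apply/eqP; ring.
have [->|tn0] := eqVneq t 0; first by rewrite mul0r add0r subr0 mul1r.
have tp : 0 < t by rewrite lt_neqAle eq_sym tn0.
have : t * dot x x < t * r by rewrite ltr_pM2l.
have : (1 - t) * dot y y <= (1 - t) * r by rewrite ler_wpM2l ?subr_ge0// ltW.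
by lra.
Qed.

End dot.

(** * Quadratic forms and their determinants *)

Section quadratic_forms.
Context {R : realType}.

(** Convertible to [(x *m M *m x^T) 0 0]. *)
Definition qf n (M : 'M[R]_n) (x : 'rV[R]_n) : R := dot (x *m M) x.

Definition posdef n (M : 'M[R]_n) : Prop :=
  M^T = M /\ forall x : 'rV[R]_n, x != 0 -> 0 < qf M x.

Lemma bf_sym n (M : 'M[R]_n) x y : M^T = M -> dot (x *m M) y = dot (y *m M) x.
Proof. by move=> sM; rewrite dot_mulmxl sM dotC. Qed.

Lemma qfD n (M : 'M[R]_n) x y : M^T = M ->
  qf M (x + y) = qf M x + 2 * dot (x *m M) y + qf M y.
Proof.
move=> sM; rewrite /qf mulmxDl !(dotDl, dotDr) (bf_sym y x sM); ring.
Qed.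

Lemma qfZ n (M : 'M[R]_n) a x : qf M (a *: x) = a ^+ 2 * qf M x.
Proof. by rewrite /qf -scalemxAl dotZl dotZr mulrA expr2. Qed.

Lemma qfN n (M : 'M[R]_n) x : qf M (- x) = qf M x.
Proof. by rewrite -scaleN1r qfZ sqrrN expr1n mul1r. Qed.

Lemma qf0 n (M : 'M[R]_n) : qf M 0 = 0.
Proof. by rewrite /qf dot0r. Qed.

Lemma qfDM n (M N : 'M[R]_n) x : qf (M + N) x = qf M x + qf N x.
Proof. by rewrite /qf mulmxDr dotDl. Qed.

Lemma qfZM n a (M : 'M[R]_n) x : qf (a *: M) x = a * qf M x.
Proof. by rewrite /qf -scalemxAr dotZl. Qed.

Lemma qfNM n (M : 'M[R]_n) x : qf (- M) x = - qf M x.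
Proof. by rewrite /qf mulmxN dotNl. Qed.

Lemma qf_scalar n a x : qf (a%:M : 'M[R]_n) x = a * dot x x.
Proof. by rewrite /qf mul_mx_scalar dotZl. Qed.

Lemma norm_mulmx_le n (M : 'M[R]_n) :
  exists2 C : R, 0 < C & forall x : 'rV_n, `|x *m M| <= C * `|x|.
Proof.
exists (1 + n%:R * \sum_i \sum_j `|M i j|).
  by rewrite ltr_wpDr// mulr_ge0// sumr_ge0// => i _; apply: sumr_ge0.
have S0 : 0 <= \sum_i \sum_j `|M i j|.
  by rewrite sumr_ge0// => i _; apply: sumr_ge0.
move=> x; apply: norm_leP.
  by rewrite mulr_ge0// addr_ge0// mulr_ge0.
move=> i; rewrite mxE (le_trans (ler_norm_sum _ _ _))//.
rewrite (@le_trans _ _ (\sum_(j < n) `|x| * \sum_i \sum_j `|M i j|))//.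
  apply: ler_sum => j _; rewrite normrM ler_pM// ?le_coord_norm//.
  rewrite (bigD1 j)//= (bigD1 i)//= -addrA lerDl addr_ge0//.
    exact: sumr_ge0.
  by rewrite sumr_ge0// => k _; apply: sumr_ge0.
rewrite sumr_const card_ord -[leLHS]mulr_natl mulrDl mul1r mulrA mulrAC.
by rewrite ler_wpDl.
Qed.

Lemma bf_le n (M : 'M[R]_n) :
  exists2 C : R, 0 < C & forall x y : 'rV_n, `|dot (x *m M) y| <= C * `|x| * `|y|.
Proof.
have [C C0 HC] := norm_mulmx_le M.
exists (n%:R * C + 1); first by rewrite ltr_wpDl// mulr_ge0// ltW.
move=> x y; rewrite (le_trans (norm_dot_le _ _))// ler_wpM2r//.
apply: (@le_trans _ _ (n%:R * (C * `|x|))).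
  by rewrite ler_wpM2l.
by rewrite mulrDl mul1r mulrA lerDl.
Qed.

Lemma cvg_dotM n (M : 'M[R]_n) (T : Type) (F : set_system T) {FF : Filter F}
    (f g : T -> 'rV[R]_n) (a b : 'rV[R]_n) :
  f @ F --> a -> g @ F --> b ->
  dot (f t *m M) (g t) @[t --> F] --> dot (a *m M) b.
Proof.
move=> fa gb.
have E x y : dot (x *m M) y = \sum_i (\sum_j x 0 j * M j i) * y 0 i.
  by rewrite dotE; apply: eq_bigr => i _; rewrite mxE.
rewrite E (_ : (fun t => _) =
    fun t => \sum_i (\sum_j f t 0 j * M j i) * g t 0 i); last first.
  by apply/funext => t; rewrite E.
apply: cvg_big => [|i _]; first exact: add_continuous.
apply: cvgM.
  apply: cvg_big => [|j _]; first exact: add_continuous.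
  apply: cvgM; last exact: cvg_cst.
  exact: (cvg_comp f (fun x : 'rV[R]_n => x 0 j) fa (@coord_continuous _ _ _ _ _ _)).
exact: (cvg_comp g (fun x : 'rV[R]_n => x 0 i) gb (@coord_continuous _ _ _ _ _ _)).
Qed.

Lemma cvg_dot n (T : Type) (F : set_system T) {FF : Filter F}
    (f g : T -> 'rV[R]_n) (a b : 'rV[R]_n) :
  f @ F --> a -> g @ F --> b -> dot (f t) (g t) @[t --> F] --> dot a b.
Proof.
move=> fa gb; have := @cvg_dotM n 1%:M T F FF f g a b fa gb; rewrite mulmx1.
by under eq_fun do rewrite mulmx1.
Qed.

Lemma qf_continuous n (M : 'M[R]_n) : continuous (qf M).
Proof. move=> x; exact: (@cvg_dotM n M _ (nbhs x) _ id id x x cvg_id cvg_id). Qed.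

Lemma dot_continuous n (p : 'rV[R]_n) : continuous (dot p).
Proof.
move=> x.
exact: (@cvg_dot n _ (nbhs x) _ (fun=> p) id p x (cvg_cst _) cvg_id).
Qed.

Lemma posdef_ge n (M : 'M[R]_n) : posdef M ->
  exists2 m : R, 0 < m & forall x, m * `|x| ^+ 2 <= qf M x.
Proof.
move=> [_ pM].
pose S := [set x : 'rV[R]_n | `|x| = 1].
have [S0|/set0P S0] := eqVneq S set0.
  exists 1 => // x; rewrite mul1r; have [->|x0] := eqVneq x 0.
    by rewrite normr0 expr0n/= qf0.
  suff : S (`|x|^-1 *: x) by rewrite S0.
  by rewrite /S/= normrZ gtr0_norm ?invr_gt0 ?normr_gt0// mulVf// normr_eq0.
have cS : compact S.
  apply: bounded_closed_compact.
    by exists 1; split=> // t t1 x /= ->; exact: ltW.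
  rewrite (_ : S = (fun x : 'rV[R]_n => `|x|) @^-1` [set 1])//.
  apply: closed_comp; last exact: closed_eq.
  by move=> x _; exact: norm_continuous.
have [c] := EVT_min_rV S0 cS (continuous_subspaceT (@qf_continuous n M)).
rewrite inE => /= c1 cmin.
exists (qf M c).
  by apply: pM; rewrite -normr_eq0 c1 oner_eq0.
move=> x; have [->|x0] := eqVneq x 0.
  by rewrite normr0 expr0n/= mulr0 qf0.
have := cmin (`|x|^-1 *: x); rewrite inE /S/= normrZ.
rewrite gtr0_norm ?invr_gt0 ?normr_gt0// mulVf ?normr_eq0// => /(_ erefl).
rewrite qfZ exprVn mulrC ler_pdivlMr// exprn_gt0// normr_gt0//.
Qed.

(** Cauchy-Schwarz for a form that may be degenerate. *)
Lemma bf_sqr_le n (M : 'M[R]_n) x y : M^T = M -> (forall z, 0 <= qf M z) ->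
  0 < qf M x -> dot (x *m M) y ^+ 2 <= qf M x * qf M y.
Proof.
move=> sM pM x0; have := pM (qf M x *: y - dot (x *m M) y *: x).
rewrite qfD// qfN !qfZ -scalemxAl dotNr dotZl dotZr (bf_sym y x sM).
set a := qf M x in x0 *; set d := dot (x *m M) y; set e := qf M y => H.
have : 0 <= a * (a * e - d ^+ 2) by nra.
by rewrite pmulr_rge0// subr_ge0.
Qed.

(** On the line through [y] directed by such an [x] the form is affine, and it
    is bounded below, hence constant. *)
Lemma semidef_null m (M : 'M[R]_m) x : M^T = M -> (forall h, 0 <= qf M h) ->
  qf M x = 0 -> x *m M = 0.
Proof.
move=> sM pM xM.
have z y : dot (x *m M) y = 0.
  have H t : 0 <= qf M y + 2 * t * dot (x *m M) y.
    have := pM (t *: x + y); rewrite qfD// qfZ xM mulr0 add0r -scalemxAl dotZl.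
    by rewrite mulrA addrC.
  set d := dot _ _ in H *.
  apply/eqP/negPn/negP => d0.
  have := H (- (qf M y + 1) / (2 * d)).
  rewrite (_ : 2 * _ * d = - (qf M y + 1)); last by field.
  by rewrite opprD addrA subrr add0r oppr_ge0 ler10.
apply/eqP; rewrite -normr_eq0 -sqrf_eq0 eq_le sqr_ge0 andbT.
by rewrite -(z (x *m M)) norm_sqr_le_dot.
Qed.

Lemma det_schur n (a : R) (r : 'rV[R]_n) (c : 'cV[R]_n) (B : 'M[R]_n) : a != 0 ->
  \det (block_mx a%:M r c B) = a * \det (B - a^-1 *: (c *m r)).
Proof.
move=> a0.
have -> : block_mx a%:M r c B =
    block_mx 1%:M 0 (a^-1 *: c) 1%:M *m
    block_mx a%:M r 0 (B - a^-1 *: (c *m r)).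
  rewrite mulmx_block !mul1mx !mul0mx !addr0; congr block_mx.
    by rewrite mul_mx_scalar scalerA divff// scale1r.
  by rewrite -scalemxAl addrCA subrr addr0.
by rewrite det_mulmx det_lblock det_ublock !det1 !mul1r det_scalar1.
Qed.

Lemma qf_block n (a : R) (r : 'rV[R]_n) (B : 'M[R]_n) (t : R) h :
  qf (block_mx a%:M r r^T B) (row_mx t%:M h) =
  a * t ^+ 2 + 2 * t * dot r h + qf B h.
Proof.
rewrite /qf mul_row_block {1}/dot tr_row_mx mul_row_col mxE.
rewrite tr_scalar_mx !mul_scalar_mx mul_mx_scalar -/(dot (t *: r + h *m B) h).
rewrite dotDl dotZl !mxE eqxx mulr1n.
rewrite (_ : \sum_j _ = dot r h); last first.
  by rewrite dotC /dot mxE.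
ring.
Qed.

Lemma block_mx11 n (M : 'M[R]_(1 + n)) : M^T = M ->
  let a := ulsubmx M 0 0 in
  M = block_mx a%:M (ursubmx M) (ursubmx M)^T (drsubmx M)
  /\ (drsubmx M)^T = drsubmx M.
Proof.
move=> sM a; split.
  by rewrite trmx_ursub sM /a -mx11_scalar submxK.
by rewrite trmx_drsub sM.
Qed.

(** Schur complements of 1x1 blocks: eliminating one coordinate of a positive
    form minimises over it, and minimisation preserves the order of forms;
    the determinant is the product of the successive pivots. *)
Lemma det_le_of_qf_le n (M N : 'M[R]_n) : posdef M -> N^T = N ->
  (forall x, qf M x <= qf N x) -> 0 < \det M /\ \det M <= \det N.
Proof.
elim: n M N => [|n IH] M N; first by rewrite !det_mx00.
rewrite -[n.+1]/(1 + n)%N in M N * => -[sM pM] sN MN.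
have [EM sMd] := block_mx11 sM; have [EN sNd] := block_mx11 sN.
move: EM EN; set a := ulsubmx M 0 0; set b := ulsubmx N 0 0.
set r := ursubmx M; set s := ursubmx N; set B := drsubmx M in sMd *.
set C := drsubmx N in sNd * => EM EN.
have E1 (t : R) (h : 'rV_n) : (t != 0) || (h != 0) -> row_mx (t%:M : 'M[R]_1) h != 0.
  apply: contraTneq; rewrite -row_mx0 => /eq_row_mx [t0 ->].
  rewrite eqxx orbF negbK; move/matrixP: t0 => /(_ 0 0).
  by rewrite !mxE eqxx mulr1n => ->.
have a0 : 0 < a.
  have := pM (row_mx 1%:M 0); rewrite E1 ?oner_eq0// => /(_ isT).
  by rewrite EM qf_block dot0r qf0; rewrite expr1n !mulr0 !addr0 mulr1.
have ab : a <= b.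
  have := MN (row_mx 1%:M 0).
  by rewrite EM EN !qf_block !dot0r !qf0 expr1n !mulr0 !addr0 !mulr1.
have b0 : 0 < b by exact: lt_le_trans ab.
have S q (u : 'rV[R]_n) (D : 'M[R]_n) h :
    qf (D - q^-1 *: (u^T *m u)) h = qf D h - q^-1 * dot u h ^+ 2.
  rewrite qfDM qfNM qfZM; congr (_ - _ * _).
  rewrite /qf mulmxA /dot -mulmxA mxE big_ord1 -/(dot u h).
  by rewrite -[h *m u^T]/(h *m u^T) -/(dot h u) dotC expr2.
have sS q (u : 'rV[R]_n) (D : 'M[R]_n) : D^T = D ->
    (D - q^-1 *: (u^T *m u))^T = D - q^-1 *: (u^T *m u).
  by move=> sD; rewrite linearB linearZ /= trmx_mul trmxK sD.
have [|||dM0 dMN] := IH (B - a^-1 *: (r^T *m r)) (C - b^-1 *: (s^T *m s)).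
- split; first exact: sS.
  move=> h h0; have := pM (row_mx (- (dot r h / a))%:M h).
  rewrite E1 ?h0 ?orbT// => /(_ isT); rewrite EM qf_block S.
  set d := dot r h; set e := qf B h.
  rewrite (_ : a * _ + _ + _ = e - a^-1 * d ^+ 2)//.
  by field; exact: lt0r_neq0.
- exact: sS.
- move=> h; rewrite !S.
  have := MN (row_mx (- (dot s h / b))%:M h); rewrite EM EN !qf_block.
  set d := dot r h; set e := qf B h; set d' := dot s h; set e' := qf C h.
  rewrite (_ : b * _ + _ + _ = e' - b^-1 * d' ^+ 2); last first.
    by field; exact: lt0r_neq0.
  apply: le_trans; set t := (- (d' / b)).
  rewrite -subr_ge0.
  rewrite (_ : _ - _ = a * (t + d / a) ^+ 2); last by field; exact: lt0r_neq0.
  by rewrite mulr_ge0 ?sqr_ge0// ltW.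
- rewrite EM EN !det_schur ?gt_eqF//; split; first exact: mulr_gt0.
  by rewrite ler_pM// ltW.
Qed.

(** The matrix determinant lemma: the two Schur complements of one bordered
    matrix have the same determinant up to the pivots. *)
Lemma det_scalar_rank1 n (al be : R) (r : 'rV[R]_n) (c : 'cV[R]_n) : al != 0 ->
  \det (al%:M - be *: (c *m r)) = al ^+ n * (1 - be / al * (r *m c) 0 0).
Proof.
move=> a0; have [d dE] : exists d, d = be *: c by exists (be *: c).
have <- : \det (block_mx (1%:M : 'M[R]_1) r d al%:M) = \det (al%:M - be *: (c *m r)).
  by rewrite det_schur ?oner_eq0// mul1r invr1 scale1r dE scalemxAl.
have E : block_mx (1%:M : 'M[R]_1) r d al%:M *m
         block_mx 1%:M 0 (- al^-1 *: d) 1%:M =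
         block_mx (1%:M - (al^-1 *: (r *m d))) r 0 al%:M.
  rewrite mulmx_block !mulmx1 !mulmx0 !add0r -!scalemxAr; congr block_mx.
    by rewrite scaleNr.
  by rewrite mul_scalar_mx scalerA mulNr mulVf// scaleN1r subrr.
have := congr1 determinant E.
rewrite det_mulmx det_lblock det_ublock !det1 !mulr1 => ->.
rewrite det_scalar mulrC; congr (_ * _).
rewrite det_mx11 dE -scalemxAr 2!mxE [X in _ + X]mxE [X in _ - X]mxE [X in _ - _ * X]mxE eqxx.
by congr (_ - _); ring.
Qed.

Lemma det_ge1_of_perturb n (M : 'M[R]_n) :
  (forall e, 0 < e -> 1 <= \det (M + e%:M)) -> 1 <= \det M.
Proof.
move=> H.
have K (b : bool) : (e *+ b) @[e --> (0 : R)^'+] --> (0 : R).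
  case: b; rewrite ?mulr1n ?mulr0n; last exact: cvg_cst.
  exact: cvg_at_right_filter cvg_id.
have c : \det (M + e%:M) @[e --> (0 : R)^'+] --> \det M.
  rewrite /determinant; apply: cvg_big => [|s _]; first exact: add_continuous.
  apply: cvgM; first exact: cvg_cst.
  apply: cvg_big => [|i _]; first exact: mul_continuous.
  rewrite -[X in _ --> X]addr0; under eq_fun do rewrite !mxE.
  by apply: cvgD; [exact: cvg_cst|exact: K].
apply: (cvg_ge_lim c); near=> e; apply: H; near: e; exact: nbhs_right_gt.
Unshelve. all: by end_near. Qed.

End quadratic_forms.

(** * Midpoint convexity *)

Section convexity.
Context {R : realType}.

(** Added to the difference with the chord, the strictly convex function
    [eps * (t ^ 2 - t)] rules out an interior maximum. *)
Lemma chord_of_local_midpoint (f : R -> R) :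
  {within `[0, 1], continuous f} ->
  (forall t : R, 0 < t < 1 ->
     \forall e \near 0^'+, f t <= 2^-1 * (f (t - e) + f (t + e))) ->
  forall t : R, 0 <= t <= 1 -> f t <= (1 - t) * f 0 + t * f 1.
Proof.
move=> cf mf t t01; apply/ler_addgt0Pr => eps eps0.
pose g (s : R) : R := f s + (eps * (s ^+ 2 - s) - ((1 - s) * f 0 + s * f 1)).
have cg : {within `[0, 1], continuous g}.
  have ch : continuous
      (fun s : R => eps * (s ^+ 2 - s) - ((1 - s) * f 0 + s * f 1) : R).
    move=> x; apply: cvgB.
      apply: cvgM; first exact: cvg_cst.
      by apply: cvgB; [exact: exprn_continuous|exact: cvg_id].
    apply: cvgD; apply: cvgM; try exact: cvg_cst; last exact: cvg_id.
    by apply: cvgB; [exact: cvg_cst|exact: cvg_id].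
  by move=> x; apply: cvgD; [exact: cf|exact: (continuous_subspaceT ch)].
have [c c01 gc] := EVT_max (@ler01 R) cg.
have g0 : g c <= 0.
  have [->|c0] := eqVneq c 0; first by rewrite /g expr0n/=; lra.
  have [->|c1] := eqVneq c 1; first by rewrite /g expr1n; lra.
  move: c01; rewrite in_itv/= => /andP[c0' c1'].
  have c01 : 0 < c < 1 by rewrite !lt_neqAle eq_sym c0 c1 c0' c1'.
  exfalso.
  have : \forall e \near (0 : R)^'+, False.
    near=> e.
    have e0 : 0 < e by near: e; exact: nbhs_right_gt.
    have ec : e < c by near: e; apply: nbhs_right_lt; case/andP: c01.
    have ec1 : e < 1 - c.
      by near: e; apply: nbhs_right_lt; rewrite subr_gt0; case/andP: c01.
    have M := near (mf c c01) e.
    have := gc (c - e); rewrite in_itv/= => /(_ ltac:(lra)).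
    have := gc (c + e); rewrite in_itv/= => /(_ ltac:(lra)).
    have : f c <= 2^-1 * (f (c - e) + f (c + e)) by near: e; exact: mf.
    have : 0 < eps * e ^+ 2 by rewrite mulr_gt0// exprn_gt0.
    by rewrite /g; nra.
  by move/filter_ex => [].
have : g t <= 0 by apply: le_trans g0; apply: gc; rewrite in_itv.
move: t01 => /andP[t0 t1].
have : 0 <= eps * (t * (1 - t)) by rewrite !mulr_ge0 ?subr_ge0// ltW.
have : 0 <= eps * (1 - t * (1 - t)).
  rewrite mulr_ge0 ?(ltW eps0)// (_ : _ - _ = (1 - t) + t * t); last by ring.
  by rewrite addr_ge0 ?subr_ge0 ?mulr_ge0.
by rewrite /g; lra.
Unshelve. all: by end_near. Qed.

Section segments.
Context {V : normedModType R}.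
Implicit Types (w f : V -> R) (E : set V).

(** Local midpoint convexity; for continuous functions on an open set it is
    equivalent to local convexity, and as a condition at one point it can be
    checked separately on the pieces of a glued function. *)
Definition midconvex_at w x : Prop :=
  \forall h \near (0 : V), w x <= 2^-1 * (w (x - h) + w (x + h)).

Definition cvx E w : Prop := forall x y, E x -> E y ->
  forall t : R, 0 <= t -> t <= 1 ->
  w (t *: x + (1 - t) *: y) <= t * w x + (1 - t) * w y.

Lemma lineE (x y : V) (t : R) : (1 - t) *: x + t *: y = x + t *: (y - x).
Proof. by rewrite scalerBl scale1r scalerBr addrAC addrA. Qed.

(** At the end points only continuity inside [E] is used: in the applications
    they are boundary points of the region where [w] is locally convex. *)
Lemma segment_chord E w x y :
  {within E, continuous w} ->
  (forall t : R, 0 <= t <= 1 -> E ((1 - t) *: x + t *: y)) ->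
  (forall t : R, 0 < t < 1 -> midconvex_at w ((1 - t) *: x + t *: y)) ->
  forall t : R, 0 <= t <= 1 ->
    w ((1 - t) *: x + t *: y) <= (1 - t) * w x + t * w y.
Proof.
move=> cw sE mE t t01.
pose ga (s : R) := (1 - s) *: x + s *: y.
have cga : continuous ga.
  move=> s; apply: cvgD; apply: cvgZl; last exact: cvg_id.
  by apply: cvgB; [exact: cvg_cst|exact: cvg_id].
have := @chord_of_local_midpoint (w \o ga) _ _ t t01.
rewrite /= /ga subr0 scale1r scale0r addr0 subrr scale0r scale1r add0r; apply.
- apply/subspace_continuousP => s /=; rewrite in_itv/= => s01.
  move/subspace_continuousP : cw => /(_ (ga s) (sE _ s01)) cw.
  apply: cvg_trans cw => A; rewrite /= !nbhs_simpl /= => HA.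
  have H : nbhs s [set u | E (ga u) -> A (w (ga u))] := cga s _ HA.
  apply: (filterS _ H) => u Hu u01.
  by apply: Hu; apply: sE; move: u01; rewrite /= in_itv.
- move=> s s01; have := mE s s01; rewrite /midconvex_at => mw.
  have ce : e *: (y - x) @[e --> (0 : R)^'+] --> (0 : V).
    rewrite -(scale0r (y - x)); apply: cvgZl.
    exact: cvg_at_right_filter cvg_id.
  have := ce _ mw; rewrite /= nbhs_simpl /=.
  apply: filterS => e /=.
  by rewrite !lineE -!addrA -scalerBl -scalerDl.
Qed.

Lemma midconvex_at_max f w x : midconvex_at f x -> midconvex_at w x ->
  midconvex_at (fun z => Num.max (f z) (w z)) x.
Proof.
move=> mf mw; near=> h.
have Hf : f x <= 2^-1 * (f (x - h) + f (x + h)) by near: h.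
have Hw : w x <= 2^-1 * (w (x - h) + w (x + h)) by near: h.
rewrite ge_max; apply/andP; split.
  apply: (le_trans Hf); rewrite ler_pM2l ?invr_gt0//.
  by rewrite lerD// le_max lexx.
apply: (le_trans Hw); rewrite ler_pM2l ?invr_gt0//.
by rewrite lerD// le_max lexx orbT.
Unshelve. all: by end_near. Qed.

Lemma addl_continuous x : continuous (fun h : V => x + h).
Proof. by move=> h; apply: cvgD; [exact: cvg_cst|exact: cvg_id]. Qed.

Lemma subr_continuous x : continuous (fun z : V => z - x).
Proof. by move=> h; apply: cvgB; [exact: cvg_id|exact: cvg_cst]. Qed.

Lemma near_add_opp x (P : V -> Prop) : (\forall z \near x, P z) ->
  \forall h \near (0 : V), P (x + h) /\ P (x - h).
Proof.
move=> Px; near=> h; split; near: h.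
  have : x + h @[h --> (0 : V)] --> x.
    by rewrite -[X in _ --> X]addr0; apply: cvgD; [exact: cvg_cst|exact: cvg_id].
  by move=> /(_ _ Px).
have : x - h @[h --> (0 : V)] --> x.
  rewrite -[X in _ --> X]subr0; apply: cvgB; [exact: cvg_cst|exact: cvg_id].
by move=> /(_ _ Px).
Unshelve. all: by end_near. Qed.

Lemma midconvex_at_eq f w x : (\forall z \near x, f z = w z) ->
  midconvex_at f x -> midconvex_at w x.
Proof.
move=> fw mf; near=> h.
have [E1 E2] : f (x + h) = w (x + h) /\ f (x - h) = w (x - h).
  by near: h; exact: near_add_opp fw.
rewrite -(nbhs_singleton fw) -E1 -E2; near: h; exact: mf.
Unshelve. all: by end_near. Qed.

(** In the ball of radius [r / 2], both [f (x0 + h)] and [f (x0 - h)] are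
    compared with values on the sphere, along the chord through [x0]. *)
Lemma cvx_lip_center (f : V -> R) (x0 : V) (r M : R) : 0 < r ->
  cvx [set x | `|x - x0| < r] f -> (forall x, `|x - x0| < r -> f x <= M) ->
  forall x, `|x - x0| < r / 2 -> `|f x - f x0| <= `|x - x0| * (2 * (M - f x0) / r).
Proof.
move=> r0 cf fM x xr.
have [->|xx0] := eqVneq x x0; first by rewrite !subrr !normr0 mul0r.
have n0 : 0 < `|x - x0| by rewrite normr_gt0 subr_eq0.
pose t := `|x - x0| * (2 / r).
have t0 : 0 < t by rewrite mulr_gt0// divr_gt0.
have t1 : t < 1 by rewrite /t -ltr_pdivlMr ?divr_gt0// div1r invf_div.
have -> : `|x - x0| * (2 * (M - f x0) / r) = t * (M - f x0) by rewrite /t; ring.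
have nz : `|t^-1 *: (x - x0)| = r / 2.
  rewrite normrZ gtr0_norm ?invr_gt0// /t; field.
  by rewrite (gt_eqF n0) (gt_eqF r0).
have r2 : r / 2 < r by rewrite ltr_pdivrMr// ltr_pMr// ltrDl.
have fx0 : f x0 <= M by apply: fM; rewrite subrr normr0.
have B0 : [set z | `|z - x0| < r] x0 by rewrite /= subrr normr0.
have Bx : [set z | `|z - x0| < r] x by rewrite /=; lra.
rewrite ler_norml; apply/andP; split.
  pose z := x0 - t^-1 *: (x - x0).
  have Bz : `|z - x0| < r by rewrite /z addrC addKr normrN nz.
  pose s := (1 + t)^-1.
  have s0 : 0 < s by rewrite invr_gt0 ltr_wpDl// ltW.
  have s1 : s <= 1 by rewrite invf_le1 ?lerDl ?ltW// ltr_wpDl// ltW.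
  have := cf x z Bx Bz s (ltW s0) s1.
  have -> : s *: x + (1 - s) *: z = x0.
    rewrite addrC lineE /z.
    rewrite (_ : x - (x0 - t^-1 *: (x - x0)) = (1 + t^-1) *: (x - x0)); last first.
      by rewrite opprB addrA addrAC scalerDl scale1r addrC.
    rewrite scalerA (_ : s * _ = t^-1) ?subrK//.
    by rewrite /s; field; rewrite !gt_eqF// ltr_wpDl// ltW.
  have : (1 - s) * f z <= (1 - s) * M by rewrite ler_wpM2l ?subr_ge0// fM.
  move=> H1 H2.
  have : (1 + t) * f x0 <= (1 + t) * (s * f x + (1 - s) * M).
    by rewrite ler_pM2l; [lra|rewrite ltr_wpDl// ltW].
  rewrite (_ : (1 + t) * (s * _ + _) = f x + t * M); last first.
    by rewrite /s; field; rewrite gt_eqF// ltr_wpDl// ltW.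
  lra.
pose z := x0 + t^-1 *: (x - x0).
have Bz : `|z - x0| < r by rewrite /z addrC addKr nz.
have := cf z x0 Bz B0 t (ltW t0) (ltW t1).
have -> : t *: z + (1 - t) *: x0 = x.
  rewrite addrC lineE /z [x0 + t^-1 *: _]addrC addrK scalerA divff ?gt_eqF// scale1r.
  by rewrite addrC subrK.
have : t * f z <= t * M by rewrite ler_pM2l// fM.
lra.
Qed.

Lemma cvx_continuous_center (f : V -> R) (x0 : V) (r M : R) : 0 < r ->
  cvx [set x | `|x - x0| < r] f -> (forall x, `|x - x0| < r -> f x <= M) ->
  {for x0, continuous f}.
Proof.
move=> r0 cf fM; apply/cvgrPdist_le => e e0.
pose K := `|2 * (M - f x0) / r| + 1.
have K0 : 0 < K by rewrite ltr_wpDl.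
near=> x; rewrite distrC.
have xr : `|x - x0| < r / 2.
  rewrite distrC; near: x; apply: (@cvgr_dist_lt _ _ _ (nbhs x0) _ id x0) => //.
  by rewrite divr_gt0.
apply: (le_trans (cvx_lip_center r0 cf fM xr)).
apply: (@le_trans _ _ (`|x - x0| * K)).
  by rewrite ler_wpM2l// /K (le_trans (ler_norm _))// lerDl.
rewrite -ler_pdivlMr// distrC; near: x.
by apply: (@cvgr_dist_le _ _ _ (nbhs x0) _ id x0) => //; rewrite divr_gt0.
Unshelve. all: by end_near. Qed.

End segments.

End convexity.

(** * Convex functions of a row vector *)

Section convex_rV.
Context {R : realType}.

Lemma convex_functionP n (A : set 'rV[R]_n) (f : 'rV[R]_n -> R) :
  convex_function A f <-> cvx A f.
Proof.
split=> [cf x y Ax Ay t t0 t1|cf t x y /set_mem Ax /set_mem Ay].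
  have := cf (Itv01 t0 t1) x y (mem_set Ax) (mem_set Ay).
  by rewrite convRE.
rewrite convRE; apply: cf => //.
Qed.

Lemma eballP n (x z : 'rV[R]_n) (r : R) : 0 < r ->
  eball x r z <-> dot (z - x) (z - x) < r ^+ 2.
Proof.
move=> r0; rewrite /eball/= /enorm; split.
  by move=> H; rewrite -(sqr_sqrtr (dot_ge0 (z - x))) ltr_pXn2r// nnegrE ?sqrtr_ge0// ltW.
move=> H; rewrite -(@ltr_pXn2r _ 2)// ?nnegrE ?sqrtr_ge0 ?(ltW r0)//.
by rewrite sqr_sqrtr// dot_ge0.
Qed.

Lemma eball_norm n (x z : 'rV[R]_n) (r : R) : eball x r z -> `|z - x| < r.
Proof.
rewrite /eball/= /enorm; apply: le_lt_trans.
by rewrite -(normr_id (z - x)) -sqrtr_sqr ler_wsqrtr// norm_sqr_le_dot.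
Qed.

Lemma norm_eball n (r : R) : 0 < r ->
  exists2 s : R, 0 < s & forall x z : 'rV[R]_n, `|z - x| < s -> eball x r z.
Proof.
move=> r0; exists (r / n.+1%:R); first by rewrite divr_gt0.
move=> x z; rewrite ltr_pdivlMr// => H; apply/(eballP _ _ r0).
apply: (le_lt_trans (dot_le_norm_sqr _)).
apply: (@le_lt_trans _ _ ((`|z - x| * n.+1%:R) ^+ 2)); last first.
  by rewrite ltr_pXn2r// ?nnegrE ?mulr_ge0// ltW.
rewrite exprMn mulrC ler_wpM2l ?sqr_ge0// -natrX ler_nat.
by rewrite (leq_trans (leqnSn n))// leq_pmulr.
Qed.

Lemma eball_convex n (x a b : 'rV[R]_n) (r : R) : eball x r a -> eball x r b ->
  forall t : R, 0 <= t -> t <= 1 -> eball x r (t *: a + (1 - t) *: b).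
Proof.
move=> Ea Eb t t0 t1.
have r0 : 0 < r by apply: le_lt_trans Ea; exact: sqrtr_ge0.
move/(eballP _ _ r0): Ea => Ea; move/(eballP _ _ r0): Eb => Eb.
apply/(eballP _ _ r0).
rewrite (_ : _ - x = t *: (a - x) + (1 - t) *: (b - x)).
  exact: dot_lt_ball.
rewrite !scalerBr addrACA; congr (_ + _).
by rewrite -opprD -scalerDl addrCA subrr addr0 scale1r.
Qed.

(** Peeling off one coordinate at a time by midpoints, every point of a small
    box is reached from points of the coordinate axes, on which convexity
    compares the function with its values at two points. *)
Lemma cvx_bounded_above n (f : 'rV[R]_n -> R) (r : R) : 0 < r ->
  cvx [set x : 'rV[R]_n | `|x| < r] f ->
  exists s M : R, 0 < s /\ forall x : 'rV[R]_n, `|x| < s -> f x <= M.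
Proof.
move=> r0 cf.
have r2 : 0 < r / 2 by rewrite divr_gt0.
suff H : forall k, exists s M : R, [/\ 0 < s, s < r & forall x : 'rV[R]_n, `|x| < s ->
    (forall i : 'I_n, (k <= i)%N -> x 0 i = 0) -> f x <= M].
  have [s [M [s0 _ sM]]] := H n; exists s, M; split=> // x xs.
  by apply: sM => // i; rewrite leqNgt ltn_ord.
elim=> [|k [s [M [s0 sr sM]]]].
  exists (r / 2), (f 0); split=> //; first by rewrite ltr_pdivrMr// ltr_pMr// ltrDl.
  by move=> x _ x0; rewrite (_ : x = 0)//; apply/rowP => i; rewrite mxE x0.
have [kn|nk] := ltnP k n; last first.
  exists s, M; split=> // x xs x0; apply: sM => // i ki; apply: x0.
  by rewrite leqNgt; move: (ltn_ord i) => /leq_trans/(_ nk); rewrite ltnNge ki.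
pose e : 'rV[R]_n := delta_mx 0 (Ordinal kn).
have ne t : `|t *: e| <= `|t|.
  apply: norm_leP => // i; rewrite !mxE eqxx/=; case: (_ == _).
    by rewrite mulr1.
  by rewrite mulr0 normr0.
pose q := r / 2; pose M2 := Num.max (f (q *: e)) (f ((- q) *: e)).
have q0 : 0 < q by [].
have qr : q < r by rewrite ltr_pdivrMr// ltr_pMr// ltrDl.
have fe t : `|t| < q -> f (t *: e) <= M2.
  rewrite ltr_norml => /andP[tq1 tq2].
  pose l := (t / q + 1) / 2.
  have tq : `|t / q| < 1.
    by rewrite ltr_norml; apply/andP; rewrite ltr_pdivlMr// ltr_pdivrMr// mulN1r mul1r.
  move: tq; rewrite ltr_norml => /andP[h1 h2].
  have l0 : 0 <= l by rewrite /l; lra.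
  have l1 : l <= 1 by rewrite /l; lra.
  have B1 : [set x : 'rV[R]_n | `|x| < r] (q *: e).
    by rewrite /= (le_lt_trans (ne _))// gtr0_norm.
  have B2 : [set x : 'rV[R]_n | `|x| < r] ((- q) *: e).
    by rewrite /= (le_lt_trans (ne _))// normrN gtr0_norm.
  have := cf _ _ B1 B2 l l0 l1; rewrite !scalerA -scalerDl.
  rewrite (_ : l * q + (1 - l) * - q = t); last first.
    by rewrite /l; field; rewrite gt_eqF.
  move=> /le_trans; apply.
  have : l * f (q *: e) <= l * M2 by rewrite ler_wpM2l// le_max lexx.
  have : (1 - l) * f ((- q) *: e) <= (1 - l) * M2.
    by rewrite ler_wpM2l ?subr_ge0// le_max lexx orbT.
  by lra.
exists (Num.min (s / 2) (q / 2)), (Num.max M M2); split.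
- by rewrite lt_min !divr_gt0.
- by rewrite gt_min; apply/orP; left; lra.
move=> x; rewrite lt_min => /andP[xs xq] x0.
pose a := x 0 (Ordinal kn).
have aq : `|2 * a| < q.
  rewrite normrM gtr0_norm// mulrC -ltr_pdivlMr//.
  exact: le_lt_trans (le_coord_norm _ _) xq.
have Ee i : e 0 i = ((i : nat) == k)%:R by rewrite mxE eqxx.
have n2 : `|2 *: (x - a *: e)| < s.
  rewrite normrZ gtr0_norm// mulrC -ltr_pdivlMr//; apply: le_lt_trans xs.
  apply: norm_leP => // i; rewrite !mxE eqxx/=.
  have [->|ik] := eqVneq i (Ordinal kn).
    by rewrite mulr1 subrr normr0.
  by rewrite mulr0 subr0 le_coord_norm.
have B1 : [set x : 'rV[R]_n | `|x| < r] (2 *: (x - a *: e)).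
  exact: lt_trans sr.
have B2 : [set x : 'rV[R]_n | `|x| < r] ((2 * a) *: e).
  by rewrite /= (le_lt_trans (ne _))// (lt_trans aq).
have h0 : (0 : R) <= 2^-1 by rewrite invr_ge0.
have h1 : (2^-1 : R) <= 1 by lra.
have := cf _ _ B1 B2 2^-1 h0 h1.
rewrite scalerA mulVf// scale1r scalerA (_ : (1 - 2^-1) * (2 * a) = a); last by lra.
rewrite subrK => /le_trans; apply.
have F1 : f (2 *: (x - a *: e)) <= Num.max M M2.
  rewrite le_max sM//= => i ki; rewrite !mxE eqxx/=.
  have [->|ik] := eqVneq i (Ordinal kn).
    by rewrite mulr1 subrr mulr0.
  rewrite mulr0 subr0 x0 ?mulr0//.
  by rewrite ltn_neqAle ki andbT; apply: contraNneq ik => ik; apply/eqP/val_inj.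
have F2 : f ((2 * a) *: e) <= Num.max M M2 by rewrite le_max fe ?orbT.
lra.
Qed.

(** Hahn-Banach, one coordinate at a time. *)
Lemma cvx_subgradient0 n (f : 'rV[R]_n -> R) (r : R) : 0 < r ->
  cvx [set x : 'rV[R]_n | `|x| < r] f -> f 0 = 0 ->
  exists p : 'rV[R]_n, forall x : 'rV[R]_n, `|x| < r -> dot p x <= f x.
Proof.
move=> r0 cf f0.
suff H : forall k, exists p : 'rV[R]_n, forall x : 'rV[R]_n, `|x| < r ->
    (forall i : 'I_n, (k <= i)%N -> x 0 i = 0) -> dot p x <= f x.
  have [p Hp] := H n; exists p => x xr.
  by apply: Hp => // i; rewrite leqNgt ltn_ord.
elim=> [|k [p Hp]].
  exists 0 => x _ x0; rewrite (_ : x = 0) ?dot0r ?f0//.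
  by apply/rowP => i; rewrite mxE x0.
have [kn|nk] := ltnP k n; last first.
  exists p => x xs x0; apply: Hp => // i ki; apply: x0.
  by rewrite leqNgt; move: (ltn_ord i) => /leq_trans/(_ nk); rewrite ltnNge ki.
pose o := Ordinal kn.
pose e : 'rV[R]_n := delta_mx 0 o.
pose L (x : 'rV[R]_n) := forall i : 'I_n, (k <= i)%N -> x 0 i = 0.
pose lo := [set c | exists x t, [/\ L x, 0 < t, `|x - t *: e| < r &
                      c = (dot p x - f (x - t *: e)) / t]].
have key x y s t : L x -> L y -> 0 < t -> 0 < s -> `|x - t *: e| < r ->
    `|y + s *: e| < r -> (dot p x - f (x - t *: e)) / t <= (f (y + s *: e) - dot p y) / s.
  move=> Lx Ly t0 s0 Bx By.
  have st0 : 0 < s + t by rewrite addr_gt0.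
  pose l := s / (s + t).
  have l0 : 0 <= l by rewrite divr_ge0// ltW.
  have l1 : l <= 1 by rewrite ler_pdivrMr// mul1r lerDl ltW.
  have l1' : 1 - l = t / (s + t) by rewrite /l; field; rewrite gt_eqF.
  have H1 := cf _ _ Bx By l l0 l1.
  pose z := l *: x + (1 - l) *: y.
  have E : l *: (x - t *: e) + (1 - l) *: (y + s *: e) = z.
    rewrite /z l1' /l; move: (e) => e'; apply/rowP => i; rewrite !mxE; field.
    by rewrite gt_eqF.
  have Lz : L z by move=> i ki; rewrite !mxE Lx// Ly// !mulr0 addr0.
  have Bz : `|z| < r.
    rewrite -E.
    apply: (@le_lt_trans _ _ (l * `|x - t *: e| + (1 - l) * `|y + s *: e|)).
      apply: le_trans (ler_normD _ _) _; rewrite (normrZ l) (normrZ (1 - l)) (ger0_norm l0).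
      by rewrite (@ger0_norm _ (1 - l)) ?subr_ge0.
    have lp : 0 < l by rewrite divr_gt0.
    have : l * `|x - t *: e| < l * r by rewrite ltr_pM2l.
    have : (1 - l) * `|y + s *: e| <= (1 - l) * r.
      by rewrite ler_wpM2l ?subr_ge0// ltW.
    by lra.
  move: H1; rewrite E => H1; have := le_trans (Hp z Bz Lz) H1.
  rewrite dotDr !dotZr l1' /l => H2.
  have : (s + t) * (s / (s + t) * dot p x + t / (s + t) * dot p y) <=
      (s + t) * (s / (s + t) * f (x - t *: e) + t / (s + t) * f (y + s *: e)).
    by rewrite ler_pM2l.
  rewrite (_ : (s + t) * (_ + _) = s * dot p x + t * dot p y); last first.
    by field; rewrite gt_eqF.
  rewrite (_ : (s + t) * (_ + _) = s * f (x - t *: e) + t * f (y + s *: e)); last first.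
    by field; rewrite gt_eqF.
  move=> H3; rewrite ler_pdivrMr// mulrAC ler_pdivlMr//.
  by lra.
have ne : `|e| <= 1.
  by apply: norm_leP => // i; rewrite mxE eqxx/=; case: (_ == _); rewrite ?normr1 ?normr0.
have r2 : 0 < r / 2 by rewrite divr_gt0.
have Be : `|(r / 2) *: e| < r.
  rewrite normrZ gtr0_norm//.
  apply: (@le_lt_trans _ _ (r / 2)); first by rewrite ger_pMr.
  by rewrite ltr_pdivrMr// ltr_pMr// ltrDl.
have L0 : L 0 by move=> i _; rewrite mxE.
have slo : has_sup lo.
  split.
    exists ((dot p 0 - f (0 - (r / 2) *: e)) / (r / 2)), 0, (r / 2); split=> //.
    by rewrite sub0r normrN.
  exists ((f (0 + (r / 2) *: e) - dot p 0) / (r / 2)) => _ [x [t [Lx t0 Bx ->]]].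
  by apply: key => //; rewrite add0r.
pose c := sup lo.
exists (p + (c - p 0 o) *: e) => x xr x0.
pose x' := x - x 0 o *: e.
have Lx' : L x'.
  move=> i ki; rewrite !mxE eqxx/=; have [->|ik] := eqVneq i o.
    by rewrite mulr1 subrr.
  rewrite mulr0 subr0 x0//.
  by rewrite ltn_neqAle ki andbT; apply: contraNneq ik => ik; apply/eqP/val_inj.
have xE : x = x' + x 0 o *: e by rewrite subrK.
have de y : dot e y = y 0 o by rewrite dotC dot_delta.
have -> : dot (p + (c - p 0 o) *: e) x = dot p x' + c * x 0 o.
  rewrite dotDl dotZl de {1}xE dotDr dotZr dot_delta; ring.
have [a0|a0|a0] := ltgtP (x 0 o) 0.
- have : (dot p x' - f (x' - (- x 0 o) *: e)) / (- x 0 o) <= c.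
    apply: sup_upper_bound => //; exists x', (- x 0 o); split=> //.
      by rewrite oppr_gt0.
    by rewrite scaleNr opprK -xE.
  rewrite scaleNr opprK -xE ler_pdivrMr ?oppr_gt0// mulrN; move: (c * _) (dot p x') (f x) => u v w; lra.
- have : c <= (f (x' + x 0 o *: e) - dot p x') / x 0 o.
    apply: ge_sup; first by case: slo.
    move=> _ [y [t [Ly t0 By ->]]]; apply: key => //; by rewrite -xE.
  rewrite -xE ler_pdivlMr//; lra.
- rewrite a0 mulr0 addr0; have -> : x = x' by rewrite /x' a0 scale0r subr0.
  by apply: Hp => //; rewrite /x' a0 scale0r subr0.
Qed.

(** The bound on the slope comes from the points at distance [r / 2] from the
    centre along the axes. *)
Lemma cvx_subgradient n (f : 'rV[R]_n -> R) (x0 : 'rV[R]_n) (r M : R) : 0 < r ->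
  cvx [set x | `|x - x0| < r] f -> (forall x, `|x - x0| < r -> f x <= M) ->
  exists2 p : 'rV[R]_n, `|p| <= 2 * (M - f x0) / r &
    forall x, `|x - x0| < r -> f x0 + dot p (x - x0) <= f x.
Proof.
move=> r0 cf fM.
have [||p Hp] := @cvx_subgradient0 n (fun h => f (x0 + h) - f x0) r r0.
- move=> x y /= Bx By t t0 t1.
  have := cf (x0 + x) (x0 + y); rewrite /= ![x0 + _ - x0]addrC !addKr.
  move=> /(_ Bx By t t0 t1).
  rewrite (_ : t *: (x0 + x) + (1 - t) *: (x0 + y) = x0 + (t *: x + (1 - t) *: y)); first by lra.
  rewrite !scalerDr addrACA -scalerDl (_ : t + (1 - t) = 1) ?scale1r//.
  by rewrite addrCA subrr addr0.
- by rewrite addr0 subrr.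
have H x : `|x - x0| < r -> f x0 + dot p (x - x0) <= f x.
  by move=> xr; have := Hp _ xr; rewrite [x0 + _]addrC subrK; lra.
exists p => //.
have fx0 : f x0 <= M by apply: fM; rewrite subrr normr0.
apply: norm_leP => [|i].
  by rewrite divr_ge0 ?(ltW r0)// mulr_ge0// subr_ge0.
have r2 : 0 < r / 2 by rewrite divr_gt0.
have K (s : R) : `|s| = r / 2 -> s * p 0 i <= M - f x0.
  move=> sr.
  have B : `|s *: (delta_mx 0 i : 'rV[R]_n)| < r.
    rewrite normrZ sr.
    apply: (@le_lt_trans _ _ (r / 2)).
      rewrite ger_pMr//; apply: norm_leP => // j.
      by rewrite mxE eqxx/=; case: (_ == _); rewrite ?normr1 ?normr0.
    by rewrite ltr_pdivrMr// ltr_pMr// ltrDl.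
  have := Hp _ B; rewrite dotZr dot_delta => /le_trans; apply.
  by rewrite lerD2r fM// addrC addKr.
have K1 := K (r / 2) (gtr0_norm r2).
have K2 := K (- (r / 2)); rewrite normrN gtr0_norm// in K2.
have {}K2 := K2 erefl.
rewrite ler_norml; apply/andP; split.
  by rewrite -mulNr ler_pdivrMr//; lra.
by rewrite ler_pdivlMr//; lra.
Qed.

Lemma near0_rV n (e : R) : 0 < e -> \forall h \near (0 : 'rV[R]_n), `|h| < e.
Proof. exact: nbhs0_lt. Qed.

Lemma nbhs_rV_ball n (x : 'rV[R]_n) (s : R) : 0 < s ->
  \forall z \near x, `|z - x| < s.
Proof.
move=> s0; near=> z; rewrite distrC; near: z.
by apply: (@cvgr_dist_lt _ _ _ (nbhs x) _ id x) => //; exact: cvg_id.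
Unshelve. all: by end_near. Qed.

Lemma midconvex_of_locally_convex n (D : set 'rV[R]_n) u x :
  Defs.locally_convex D u -> D x -> midconvex_at u x.
Proof.
move=> [_ H] /H [r r0 [_ /convex_functionP cu]].
have [s s0 Hs] := @norm_eball n r r0.
suff : \forall h \near (0 : 'rV[R]_n), u x <= 2^-1 * (u (x - h) + u (x + h)).
  by [].
near=> h.
have hs : `|h| < s.
  near: h; exact: near0_rV.
have B1 : eball x r (x - h) by apply: Hs; rewrite addrC addKr normrN.
have B2 : eball x r (x + h) by apply: Hs; rewrite addrC addKr.
have h0 : (0 : R) <= 2^-1 by rewrite invr_ge0.
have h1 : (2^-1 : R) <= 1 by lra.
have := cu _ _ B1 B2 2^-1 h0 h1.
rewrite (_ : 1 - 2^-1 = 2^-1); last by lra.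
rewrite (_ : _ *: (x - h) + _ = x); last by apply/rowP => i; rewrite !mxE; field.
lra.
Unshelve. all: by end_near. Qed.

Lemma cvx_ball_of_midconvex n (D : set 'rV[R]_n) u (B : set 'rV[R]_n) :
  (forall x, D x -> {for x, continuous u}) ->
  (forall x, D x -> midconvex_at u x) ->
  B `<=` D ->
  (forall a b, B a -> B b ->
    forall t : R, 0 <= t -> t <= 1 -> B (t *: a + (1 - t) *: b)) ->
  cvx B u.
Proof.
move=> cu mu BD cB a b Ba Bb t t0 t1.
have ft : 0 <= 1 - t <= 1 by apply/andP; split; lra.
have := @segment_chord R _ D u a b _ _ _ (1 - t) ft.
rewrite !subKr; apply.
- apply/subspace_continuousP => x Dx; apply: cvg_trans (cu x Dx).
  by apply: cvg_app; exact: cvg_within.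
- move=> s /andP[s0 s1]; apply: BD.
  by have := cB a b Ba Bb (1 - s); rewrite subKr; apply; lra.
- move=> s /andP[s0 s1]; apply: mu; apply: BD.
  by have := cB a b Ba Bb (1 - s); rewrite subKr; apply; lra.
Qed.

Lemma locally_convex_of_midconvex n (D : set 'rV[R]_n) u :
  open D ->
  (forall x, D x -> {for x, continuous u}) ->
  (forall x, D x -> midconvex_at u x) -> Defs.locally_convex D u.
Proof.
move=> oD cu mu; split; first by split.
move=> x Dx.
have /nbhs_ballP [r /= r0 Hr] : nbhs x D by apply: open_nbhs_nbhs.
have BD : eball x r `<=` D.
  by move=> z /eball_norm zr; apply: Hr; rewrite -ball_normE /= distrC.
exists r => //; split=> //; apply/convex_functionP.
apply: cvx_ball_of_midconvex cu mu BD _ => a b Ea Eb; exact: eball_convex.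
Qed.

End convex_rV.

(** * Second order calculus *)

Section calculus.
Context {R : realType} {n : nat}.
Implicit Types (f v : 'rV[R]_n -> R) (x y z e : 'rV[R]_n).

Lemma is_derive_line f x e (t : R) : derivable f (x + t *: e) e ->
  is_derive t 1 (fun s : R => f (x + s *: e)) ('D_e f (x + t *: e)).
Proof.
move=> df.
have E : (fun h : R => h^-1 *: (((fun s : R => f (x + s *: e)) \o shift t) (h *: 1)
            - f (x + t *: e))) =
    (fun h => h^-1 *: ((f \o shift (x + t *: e)) (h *: e) - f (x + t *: e))).
  apply/funext => h /=; congr (_ *: (f _ - _)).
  by rewrite [_ *: 1]mulr1 addrCA scalerDl.
by split; rewrite /derivable /derive E.
Qed.

Lemma is_derive_of_poly2 f z e (L K : R) :
  (forall h : R, f (h *: e + z) = f z + h * L + h ^+ 2 * K) -> is_derive z e f L.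
Proof.
move=> H.
have c0 : (L + h * K) @[h --> (0 : R)^'] --> L + 0 * K.
  apply: cvgD; first exact: cvg_cst.
  apply: cvgM; last exact: cvg_cst.
  by apply: cvg_within_filter; exact: cvg_id.
have c : h^-1 *: ((f \o shift z) (h *: e) - f z) @[h --> (0 : R)^'] --> L.
  rewrite mul0r addr0 in c0; apply: cvg_trans c0.
  apply: near_eq_cvg; near=> h => /=.
  have h0 : h != 0 by near: h; exact: nbhs_dnbhs_neq.
  rewrite H -[_ *: _]/(h^-1 * _); field.
  exact: h0.
split; first by apply/cvg_ex; exists L.
exact: cvg_lim c.
Unshelve. all: by end_near. Qed.

Lemma mvt_coord f x (i : 'I_n) (a : R) :
  (forall s : R, `|s| <= `|a| ->
     derivable f (x + s *: delta_mx 0 i) (delta_mx 0 i)) ->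
  exists2 s : R, `|s| <= `|a| &
    f (x + a *: delta_mx 0 i) - f x = a * partial i f (x + s *: delta_mx 0 i).
Proof.
set e := delta_mx 0 i => df.
pose g (s : R) : R := f (x + s *: e).
have dg (s : R) : `|s| <= `|a| -> is_derive s 1 g ('D_e f (x + s *: e)).
  by move=> sa; apply: is_derive_line; exact: df.
have cg (b c : R) : (forall s, s \in `[b, c]%R -> `|s| <= `|a|) ->
    {within `[b, c], continuous g}.
  move=> H; apply: derivable_within_continuous => s sbc.
  exact: (@ex_derive _ _ _ _ _ _ _ (dg s (H s sbc))).
have gx : g 0 = f x by rewrite /g scale0r addr0.
have [a0|a0|a0] := ltgtP a 0.
- have H (s : R) : s \in `[a, 0]%R -> `|s| <= `|a|.
    by rewrite in_itv/= => /andP[h1 h2]; rewrite !ler0_norm//; lra.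
  have [|c ca E] := @MVT R g (fun s => 'D_e f (x + s *: e)) _ _ a0 _ (cg _ _ H).
    by move=> s sa; apply: dg; apply: H; apply: subset_itv_oo_cc.
  exists c; first by apply: H; apply: subset_itv_oo_cc.
  by rewrite -/(g a) -gx -opprB E /partial -/e; ring.
- have H (s : R) : s \in `[0, a]%R -> `|s| <= `|a|.
    by rewrite in_itv/= => /andP[h1 h2]; rewrite !ger0_norm//; lra.
  have [|c ca E] := @MVT R g (fun s => 'D_e f (x + s *: e)) _ _ a0 _ (cg _ _ H).
    by move=> s sa; apply: dg; apply: H; apply: subset_itv_oo_cc.
  exists c; first by apply: H; apply: subset_itv_oo_cc.
  by rewrite -/(g a) -gx E /partial -/e; ring.
- by exists 0; rewrite ?normr0// a0 mul0r scale0r addr0 subrr.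
Qed.

(** The segment is replaced by an axis-parallel path, whose vertices and edges
    lie in the box spanned by the two points; so bounds on the
    partial derivatives there suffice. *)
Lemma lip_of_partials f x y (C : R) :
  (forall z, (forall j, `|z 0 j - x 0 j| <= `|y 0 j - x 0 j|) ->
     forall i, derivable f z (delta_mx 0 i) /\ `|partial i f z| <= C) ->
  `|f y - f x| <= n%:R * C * `|y - x|.
Proof.
move=> H.
pose p k : 'rV[R]_n := \row_j (if (j < k)%N then y 0 j else x 0 j).
have d j : `|y 0 j - x 0 j| <= `|y - x|.
  by have := le_coord_norm (y - x) j; rewrite !mxE.
have pn : p n = y by apply/rowP => j; rewrite mxE ltn_ord.
have p0 : p 0%N = x by apply/rowP => j; rewrite mxE.
suff K : forall k, (k <= n)%N -> `|f (p k) - f x| <= k%:R * C * `|y - x|.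
  by have := K n (leqnn n); rewrite pn.
elim=> [_|k IH kn].
  by rewrite p0 subrr normr0 !mul0r.
pose i := Ordinal kn.
have E : p k.+1 = p k + (y 0 i - x 0 i) *: delta_mx 0 i.
  apply/rowP => j; rewrite !mxE eqxx/= ltnS leq_eqVlt.
  have [->|ji] := eqVneq j i.
    by rewrite eqxx/= ltnn mulr1 addrC subrK.
  rewrite mulr0 addr0 (_ : (nat_of_ord j == k) = false)//.
  by apply: contra_neqF ji => /eqP jk; exact/val_inj.
have box (s : R) : `|s| <= `|y 0 i - x 0 i| ->
    forall j, `|(p k + s *: delta_mx 0 i) 0 j - x 0 j| <= `|y 0 j - x 0 j|.
  move=> si j; rewrite !mxE eqxx/=.
  have [->|ji] := eqVneq j i.
    by rewrite /= ltnn mulr1 addrC addKr.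
  by rewrite mulr0 addr0; case: ifP => // _; rewrite subrr normr0.
have [|s si Es] := @mvt_coord f (p k) i (y 0 i - x 0 i).
  by move=> s si; have [] := H _ (box s si) i.
have [_ Hs] := H _ (box s si) i.
rewrite E.
have -> : f (p k + (y 0 i - x 0 i) *: delta_mx 0 i) - f x =
  (f (p k + (y 0 i - x 0 i) *: delta_mx 0 i) - f (p k)) + (f (p k) - f x) by ring.
apply: (le_trans (ler_normD _ _)).
have -> : k.+1%:R * C * `|y - x| = C * `|y - x| + k%:R * C * `|y - x|.
  by rewrite -addn1 natrD; ring.
apply: lerD; last exact: IH (ltnW kn).
by rewrite Es normrM mulrC; apply: ler_pM.
Qed.

Lemma Ck_continuous k (D : set 'rV[R]_n) f : Ck k D f ->
  forall x, D x -> {for x, continuous f}.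
Proof. by case: k => [|k] []. Qed.

Lemma delta_norm_le (i : 'I_n) : `|delta_mx 0 i : 'rV[R]_n| <= 1.
Proof.
apply: norm_leP => // j; rewrite mxE eqxx/=.
by case: (_ == _); rewrite ?normr1 ?normr0.
Qed.

Lemma near_ball_rV x (P : 'rV[R]_n -> Prop) : (\forall z \near x, P z) ->
  exists2 r : R, 0 < r & forall z, `|z - x| < r -> P z.
Proof.
move=> /nbhs_ballP [r /= r0 Hr]; exists r => // z zr.
by apply: Hr; rewrite -ball_normE /= distrC.
Qed.

Lemma dist_half (u u1 u2 e : R) :
  `|u1 - u| < e / 2 -> `|u2 - u| < e / 2 -> `|u1 - u2| <= e.
Proof.
rewrite !ltr_norml ler_norml => /andP[h1 h2] /andP[h3 h4].
by apply/andP; split; lra.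
Qed.

(** Both mixed partials are the limit of the same second difference. *)
Lemma partialC (D : set 'rV[R]_n) f x0 (i j : 'I_n) : open D -> Ck 2 D f -> D x0 ->
  partial j (partial i f) x0 = partial i (partial j f) x0.
Proof.
move=> oD [_ C2] Dx0.
have [r0 r00 rD] := near_ball_rV (open_nbhs_nbhs (conj oD Dx0)).
have key (k l : 'I_n) (a : R) : 0 < a -> 2 * a < r0 ->
    exists2 z, `|z - x0| <= 2 * a &
      f (x0 + a *: delta_mx 0 k + a *: delta_mx 0 l) - f (x0 + a *: delta_mx 0 k)
      - (f (x0 + a *: delta_mx 0 l) - f x0) = a * (a * partial l (partial k f) z).
  move=> a0 ar; set ek := delta_mx 0 k; set el := delta_mx 0 l.
  have near_x0 (s t : R) : `|s| <= a -> `|t| <= a -> `|x0 + s *: ek + t *: el - x0| <= 2 * a.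
    move=> sa ta; rewrite -[x0 + _ + _]addrA [x0 + _]addrC addrK (le_trans (ler_normD _ _))// !normrZ.
    have H : forall m, `|delta_mx 0 m : 'rV[R]_n| <= 1 := delta_norm_le.
    have : `|s| * `|ek| <= a * 1 by apply: ler_pM => //; exact: H.
    have : `|t| * `|el| <= a * 1 by apply: ler_pM => //; exact: H.
    lra.
  have inD (s t : R) : `|s| <= a -> `|t| <= a -> D (x0 + s *: ek + t *: el).
    by move=> sa ta; apply: rD; apply: le_lt_trans (near_x0 _ _ sa ta) ar.
  have na : `|a| = a by rewrite gtr0_norm.
  pose g z := f (z + a *: el) - f z.
  have sh z : derivable f (z + a *: el) ek ->
      is_derive z ek (fun w => f (w + a *: el)) (partial k f (z + a *: el)).
    move=> df.
    have E : (fun h : R => h^-1 *: (((fun w => f (w + a *: el)) \o shift z) (h *: ek)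
            - f (z + a *: el))) =
        (fun h => h^-1 *: ((f \o shift (z + a *: el)) (h *: ek) - f (z + a *: el))).
      by apply/funext => h /=; rewrite addrA.
    by split; rewrite /derivable /partial /derive E.
  have dg (s : R) : `|s| <= a -> is_derive (x0 + s *: ek) ek g
      (partial k f (x0 + s *: ek + a *: el) - partial k f (x0 + s *: ek)).
    move=> sa; apply: is_deriveB.
      by apply: sh; have [+ _] := C2 k; apply; apply: inD => //; rewrite na.
    apply: derivableP; have [+ _] := C2 k; apply.
    by have := inD s 0; rewrite scale0r addr0 normr0; apply=> //; exact: ltW.
  have [|s sa Es] := @mvt_coord g x0 k a.
    by move=> s; rewrite na => /dg [].
  rewrite na in sa.
  rewrite -/ek in Es.
  have [_ Eg] := dg s sa; rewrite /partial -/ek Eg in Es.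
  have [|t ta Et] := @mvt_coord (partial k f) (x0 + s *: ek) l a.
    move=> t; rewrite na => ta.
    by have [_ [_ /(_ l) [+ _]]] := C2 k; apply; exact: inD.
  rewrite na in ta; exists (x0 + s *: ek + t *: el); first exact: near_x0.
  by rewrite -Et -Es /g.
apply/eqP; rewrite -subr_eq0 -normr_eq0 eq_le normr_ge0 andbT.
apply/ler_addgt0Pr => eps eps0; rewrite add0r.
have e2 : 0 < eps / 2 by rewrite divr_gt0.
have cont k l : {for x0, continuous (partial l (partial k f))}.
  by have [_ [_ /(_ l) [_ [+ _]]]] := C2 k; apply.
have H k l : exists2 r : R, 0 < r & forall z, `|z - x0| < r ->
    `|partial l (partial k f) x0 - partial l (partial k f) z| < eps / 2.
  apply: near_ball_rV.
  by have /cvgrPdist_lt/(_ _ e2) := cont k l.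
have [r1 r10 H1] := H i j; have [r2 r20 H2] := H j i.
pose a := Num.min r0 (Num.min r1 r2) / 4.
have m0 : 0 < Num.min r0 (Num.min r1 r2) by rewrite !lt_min r00 r10 r20.
have a0 : 0 < a by rewrite divr_gt0.
have a2 : 2 * a < Num.min r0 (Num.min r1 r2) by rewrite /a; lra.
move: (a2); rewrite !lt_min => /and3P[ar0 ar1 ar2].
have [z1 z1a E1] := key i j a a0 ar0.
have [z2 z2a E2] := key j i a a0 ar0.
have E : a * (a * partial j (partial i f) z1) = a * (a * partial i (partial j f) z2).
  have swap (u1 u2 u3 u4 : R) : u1 - u2 - (u3 - u4) = u1 - u3 - (u2 - u4) by ring.
  apply: etrans (esym E1) _; apply: etrans _ E2.
  by rewrite swap [x0 + a *: delta_mx 0 i + _]addrAC.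
have {}E : partial j (partial i f) z1 = partial i (partial j f) z2.
  by apply: (mulfI (lt0r_neq0 a0)); apply: (mulfI (lt0r_neq0 a0)).
have := H1 z1 (le_lt_trans z1a ar1); have := H2 z2 (le_lt_trans z2a ar2).
by rewrite E => h2 h1; apply: dist_half h1 h2.
Qed.

Lemma hessian_sym (D : set 'rV[R]_n) f x0 : open D -> Ck 2 D f -> D x0 ->
  (hessian f x0)^T = hessian f x0.
Proof.
by move=> oD C2 Dx0; apply/matrixP => i j; rewrite !mxE; exact: (partialC _ _ oD).
Qed.

(** The second order expansion, uniform in its base point: the remainder is a
    function whose second partials are small near [x0]. *)
Lemma taylor2 (D : set 'rV[R]_n) f x0 (eps : R) : open D -> Ck 2 D f -> D x0 ->
  0 < eps -> exists2 r : R, 0 < r & forall x y, `|x - x0| < r -> `|y - x0| < r ->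
    `|f y - f x - dot (gradient f x) (y - x) - 2^-1 * qf (hessian f x0) (y - x)|
      <= eps * `|y - x| ^+ 2.
Proof.
move=> oD C2 Dx0 eps0.
have sH := hessian_sym oD C2 Dx0.
have [_ C2'] := C2.
set H := hessian f x0 in sH *.
pose d := eps / (n%:R ^+ 2 + 1).
have n1 : (0 : R) < n%:R ^+ 2 + 1 by rewrite ltr_wpDl// sqr_ge0.
have d0 : 0 < d by rewrite divr_gt0.
have [r0 r00 rD] := near_ball_rV (open_nbhs_nbhs (conj oD Dx0)).
have [r1 r10 Hr1] : exists2 r : R, 0 < r & forall z, `|z - x0| < r ->
    forall k l, `|partial l (partial k f) z - H k l| <= d.
  apply: near_ball_rV.
  suff : \forall z \near x0, forall kl : 'I_n * 'I_n,
      `|partial kl.2 (partial kl.1 f) z - H kl.1 kl.2| <= d.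
    by apply: filterS => z Hz k l; exact: (Hz (k, l)).
  apply: (@filter_forall _ ('I_n * 'I_n)%type (fun kl z =>
    `|partial kl.2 (partial kl.1 f) z - H kl.1 kl.2| <= d) (nbhs x0) _) => -[k l] /=.
  have : {for x0, continuous (partial l (partial k f))}.
    by have [_ [_ /(_ l) [_ [+ _]]]] := C2' k; apply.
  move=> /cvgrPdist_le/(_ _ d0); apply: filterS => z; rewrite distrC.
  by rewrite /H mxE.
pose m := Num.min r0 r1.
have m0 : 0 < m by rewrite lt_min r00.
exists (m / 3); first by rewrite divr_gt0.
move=> x y xr yr.
have yx : `|y - x| < 2 * (m / 3).
  rewrite (_ : y - x = (y - x0) - (x - x0)); last first.
    by rewrite opprB addrA subrK.
  by rewrite (le_lt_trans (ler_normB _ _))//; lra.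
have box z : (forall j, `|z 0 j - x 0 j| <= `|y 0 j - x 0 j|) ->
    `|z - x| <= `|y - x| /\ `|z - x0| < m.
  move=> Hz; have zx : `|z - x| <= `|y - x|.
    apply: norm_leP => // i; rewrite !mxE (le_trans (Hz i))//.
    by have := le_coord_norm (y - x) i; rewrite !mxE.
  split=> //; rewrite (_ : z - x0 = (z - x) + (x - x0)); last first.
    by rewrite addrA subrK.
  by rewrite (le_lt_trans (ler_normD _ _))//; lra.
have mD z : `|z - x0| < m -> D z.
  by rewrite lt_min => /andP[zr _]; exact: rD.
have mH z : `|z - x0| < m -> forall k l, `|partial l (partial k f) z - H k l| <= d.
  by rewrite lt_min => /andP[_ zr]; exact: Hr1.
have Hdelta i z : dot (delta_mx 0 i *m H) z = (z *m H) 0 i.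
  by rewrite bf_sym// dot_delta.
have first_order z i : (forall j, `|z 0 j - x 0 j| <= `|y 0 j - x 0 j|) ->
    `|partial i f z - partial i f x - ((z - x) *m H) 0 i| <= n%:R * d * `|y - x|.
  move=> Hz; pose g w := partial i f w - dot (delta_mx 0 i *m H) w.
  have dlin w l : is_derive w (delta_mx 0 l) (fun w => dot (delta_mx 0 i *m H) w) (H i l).
    apply: (@is_derive_of_poly2 _ _ _ _ 0) => h.
    by rewrite dotDr dotZr dot_delta -rowE mxE; ring.
  have dg w l : `|w - x0| < m ->
      is_derive w (delta_mx 0 l) g (partial l (partial i f) w - H i l).
    move=> wm; apply: is_deriveB; apply: derivableP.
    by have [_ [_ /(_ l) [+ _]]] := C2' i; apply; exact: mD.
  have := @lip_of_partials g x z d.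
  rewrite (_ : g z - g x = partial i f z - partial i f x - ((z - x) *m H) 0 i).
    move=> L; apply: le_trans (L _) _.
      move=> w Hw l; have [_ wm] := box w (fun j => le_trans (Hw j) (Hz j)).
      have [? E] := dg w l wm; split=> //.
      by rewrite /partial E; exact: mH.
    have [zx _] := box z Hz.
    by rewrite ler_wpM2l// mulr_ge0// ltW.
  by rewrite /g !Hdelta mulmxBl [X in _ = _ - X]mxE [in X in _ = _ - (_ + X)]mxE; ring.
pose G z := f z - (dot (gradient f x) (z - x) + 2^-1 * qf H (z - x)).
have dpol z l : is_derive z (delta_mx 0 l)
    (fun z => dot (gradient f x) (z - x) + 2^-1 * qf H (z - x))
    (partial l f x + ((z - x) *m H) 0 l).
  apply: (@is_derive_of_poly2 _ _ _ _ (2^-1 * qf H (delta_mx 0 l))) => h.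
  rewrite -[h *: _ + z - x]addrA (dotDr (h *: _)) (qfD (h *: _) (z - x) sH) qfZ dotZr dot_delta -scalemxAl dotZl Hdelta mxE.
  by field.
have dG z l : `|z - x0| < m -> is_derive z (delta_mx 0 l) G
    (partial l f z - (partial l f x + ((z - x) *m H) 0 l)).
  move=> zm; apply: is_deriveB; apply: derivableP.
  by have [+ _] := C2' l; apply; exact: mD.
have := @lip_of_partials G x y (n%:R * d * `|y - x|).
have -> : G y - G x =
    f y - f x - dot (gradient f x) (y - x) - 2^-1 * qf H (y - x).
  by rewrite /G subrr dot0r qf0; ring.
move=> L; apply: le_trans (L _) _.
  move=> z Hz l; have [_ zm] := box z Hz; have [? E] := dG z l zm; split=> //.
  by rewrite /partial E opprD addrA; exact: first_order.
rewrite (_ : _ * `|y - x| = (n%:R ^+ 2 * d) * `|y - x| ^+ 2); last by ring.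
rewrite ler_wpM2r ?sqr_ge0// /d mulrCA -[leRHS]mulr1 ler_wpM2l ?(ltW eps0)//.
by rewrite ler_pdivrMr// mul1r lerDl.
Qed.

End calculus.

(** * Viscosity conditions in terms of paraboloids *)

Section paraboloids.
Context {R : realType} {n : nat}.
Implicit Types (u v w : 'rV[R]_n -> R) (x h p q : 'rV[R]_n) (M N : 'M[R]_n)
  (D : set 'rV[R]_n).

Definition touch_above u x p M : Prop :=
  \forall h \near (0 : 'rV[R]_n), u (x + h) <= u x + dot p h + 2^-1 * qf M h.

Definition touch_below u x p M : Prop :=
  \forall h \near (0 : 'rV[R]_n), u x + dot p h + 2^-1 * qf M h <= u (x + h).

Definition subsolution_at u x : Prop :=
  forall p M, M^T = M -> touch_above u x p M -> 1 <= \det M.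

Definition supersolution_at u x : Prop :=
  forall p M, posdef M -> touch_below u x p M -> \det M <= 1.

(** The pointwise conditions characterising continuous, locally convex
    subsolutions; all three are local, and stable under maxima. *)
Definition germ u x : Prop :=
  [/\ {for x, continuous u}, midconvex_at u x & subsolution_at u x].

Lemma near0_add x (P : 'rV[R]_n -> Prop) :
  (\forall z \near x, P z) -> \forall h \near (0 : 'rV[R]_n), P (x + h).
Proof. by move=> /near_add_opp; apply: filterS => h []. Qed.

Lemma touch_above_le u v x p M : u x = v x -> (\forall z \near x, v z <= u z) ->
  touch_above u x p M -> touch_above v x p M.
Proof.
move=> uv /near0_add H T; near=> h; rewrite -uv.
apply: (@le_trans _ _ (u (x + h))); first by near: h.
by near: h.
Unshelve. all: by end_near. Qed.

Lemma germ_eq u v x : (\forall z \near x, u z = v z) -> germ u x -> germ v x.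
Proof.
move=> uv [cu mu su].
have uvx := nbhs_singleton uv.
split.
- rewrite /prop_for /continuous_at -uvx; apply: cvg_trans cu.
  exact: (@near_eq_cvg _ _ (nbhs x) _ u v uv).
- exact: midconvex_at_eq uv mu.
- move=> p M sM T; apply: (su p M sM); apply: touch_above_le T => //.
  by apply: filterS uv => z ->.
Qed.

Lemma germ_max u v x : germ u x -> germ v x ->
  germ (fun z => Num.max (u z) (v z)) x.
Proof.
move=> [cu mu su] [cv mv sv]; split.
- exact: (@continuous_max _ _ u v x cu cv).
- exact: midconvex_at_max.
- move=> p M sM T; have [uv|vu] := leP (u x) (v x).
    apply: (sv p M sM); apply: touch_above_le T; first by rewrite max_r.
    by near=> z; rewrite le_max lexx orbT.
  apply: (su p M sM); apply: touch_above_le T; first by rewrite max_l// ltW.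
  by near=> z; rewrite le_max lexx.
Unshelve. all: by end_near. Qed.

(** Only the even part of the difference of the two sides matters, and it is
    homogeneous. *)
Lemma qf_le_of_near p q M N :
  (\forall h \near (0 : 'rV[R]_n),
     dot p h + 2^-1 * qf M h <= dot q h + 2^-1 * qf N h) ->
  forall h, qf M h <= qf N h.
Proof.
move=> /near_ball_rV [r r0 H] h.
have [->|h0] := eqVneq h 0; first by rewrite !qf0.
have nh : 0 < `|h| by rewrite normr_gt0.
pose t := r / 2 / `|h|.
have t0 : 0 < t by rewrite !divr_gt0.
have tr : `|t *: h| < r.
  rewrite normrZ gtr0_norm// /t divfK ?gt_eqF//.
  by rewrite ltr_pdivrMr// ltr_pMr// ltrDl.
have := H (t *: h); rewrite subr0 => /(_ tr).
have := H (- (t *: h)); rewrite subr0 normrN => /(_ tr).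
rewrite !qfN !qfZ !dotNr => H1 H2.
have : t ^+ 2 * qf M h <= t ^+ 2 * qf N h by lra.
by rewrite ler_pM2l// exprn_gt0.
Qed.

(** A paraboloid touching from above dominates the one touching from below, as
    a quadratic form; the determinant is monotone on positive forms. *)
Lemma germ_of_touch_below u x p M : {for x, continuous u} ->
  posdef M -> 1 <= \det M -> touch_below u x p M -> germ u x.
Proof.
move=> cu pM dM T; split=> //.
- suff : \forall h \near (0 : 'rV[R]_n), u x <= 2^-1 * (u (x - h) + u (x + h)).
    by [].
  apply: filterS (near_add_opp T) => h; rewrite add0r sub0r => -[T1 T2].
  rewrite qfN dotNr in T2.
  have : 0 <= qf M h.
    have [->|h0] := eqVneq h 0; first by rewrite qf0.
    by apply: ltW; exact: pM.2.
  lra.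
- move=> q N sN A; apply: (le_trans dM).
  have [|_ ->//] := det_le_of_qf_le pM sN.
  apply: (@qf_le_of_near p q); near=> h.
  have H1 : u x + dot p h + 2^-1 * qf M h <= u (x + h) by near: h.
  have H2 : u (x + h) <= u x + dot q h + 2^-1 * qf N h by near: h.
  lra.
Unshelve. all: by end_near. Qed.

(** A test function lies below its Taylor paraboloid raised by a small multiple
    of the identity. *)
Lemma viscosity_subsolutionP D u : open D ->
  (forall x, D x -> subsolution_at u x) -> viscosity_subsolution D u.
Proof.
move=> oD su v C2 x0 Dx0 mx; apply: det_ge1_of_perturb => e e0.
have sH := hessian_sym oD C2 Dx0.
have e2 : 0 < e / 2 by rewrite divr_gt0.
have [r r0 T] := taylor2 oD C2 Dx0 e2.
apply: (su x0 Dx0 (gradient v x0)).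
  by rewrite linearD /= sH tr_scalar_mx.
have mx' := near0_add mx.
near=> h.
have hr : `|h| < r by near: h; exact: near0_rV.
have := T x0 (x0 + h); rewrite subrr normr0 [x0 + h - x0]addrC addKr => /(_ r0 hr).
rewrite ler_norml => /andP[_ T2].
have M2 : u (x0 + h) - v (x0 + h) <= u x0 - v x0 by near: h.
rewrite qfDM qf_scalar.
have : e / 2 * `|h| ^+ 2 <= e / 2 * dot h h.
  by rewrite ler_wpM2l ?(ltW e2)// norm_sqr_le_dot.
move: T2 M2.
move: (v (x0 + h)) (v x0) (u (x0 + h)) (u x0) (dot _ h) (qf _ h) (`|h|) (dot h h).
by move=> a1 a2 a3 a4 a5 a6 a7 a8; lra.
Unshelve. all: by end_near. Qed.

(** A determinant that exceeds 1 still does after a small contraction of the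
    form; the contraction makes room for error terms of second order. *)
Lemma bernoulli_gap (d : R) k : 1 < d ->
  exists g : R, [/\ 0 < g, g < 1 & 1 < (1 - g) ^+ k * d].
Proof.
move=> d1.
have B (g : R) : 0 <= g -> g <= 1 -> 1 - k%:R * g <= (1 - g) ^+ k.
  move=> g0 g1; elim: k => [|k IH]; first by rewrite mul0r subr0 expr0.
  rewrite exprS; apply: (@le_trans _ _ ((1 - g) * (1 - k%:R * g))).
    have : 0 <= k%:R * (g * g) by rewrite !mulr_ge0.
    by rewrite -addn1 natrD; move: (k%:R : R) => K; nra.
  by rewrite ler_wpM2l// subr_ge0.
have d0 : 0 < d by apply: lt_trans d1.
pose g := (d - 1) / (2 * (k.+1%:R * d)).
have den0 : 0 < 2 * (k.+1%:R * d) by rewrite !mulr_gt0.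
have g0 : 0 < g by rewrite divr_gt0// subr_gt0.
have E : 2 * (k.+1%:R * g * d) = d - 1.
  by rewrite /g; field; rewrite !gt_eqF.
have kg : k%:R * g * d <= k.+1%:R * g * d.
  by rewrite !ler_wpM2r ?(ltW d0) ?(ltW g0)// ler_nat.
have g1 : g < 1.
  rewrite /g ltr_pdivrMr// mul1r.
  have : d <= k.+1%:R * d by rewrite ler_peMl ?(ltW d0)// ler1n.
  lra.
exists g; split=> //.
apply: (@lt_le_trans _ _ ((1 - k%:R * g) * d)); first by lra.
by rewrite ler_wpM2r ?(ltW d0)// B// ltW.
Qed.

Lemma posdefZ M (a : R) : 0 < a -> posdef M -> posdef (a *: M).
Proof.
move=> a0 [sM pM]; split; first by rewrite linearZ /= sM.
by move=> x x0; rewrite qfZM mulr_gt0// pM.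
Qed.

Lemma posdef_of_semidef M : M^T = M -> (forall h, 0 <= qf M h) -> \det M != 0 ->
  posdef M.
Proof.
move=> sM pM dM; split=> // x x0; rewrite lt_neqAle pM andbT eq_sym.
apply/eqP => xM.
have x1 : x *m M = 0 by exact: semidef_null.
have uM : M \in unitmx by rewrite unitmxE unitfE.
by move: x0; rewrite -(mulmxK uM x) x1 mul0mx eqxx.
Qed.

Lemma midpoint_taylor_arith (a0 a1 a2 a3 a4 a5 : R) :
  a3 - a2 - - a4 - 2^-1 * a5 <= a0 -> a1 - a2 - a4 - 2^-1 * a5 <= a0 ->
  a2 <= 2^-1 * (a3 + a1) -> 0 <= a5 + 2 * a0.
Proof. lra. Qed.

Lemma comparison_arith (u0 u1 v0 v1 p q e1 e2 : R) :
  - e1 <= v1 - v0 - p - q -> u0 - v0 <= u1 - v1 -> e1 <= e2 ->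
  u0 + p + (q - e2) <= u1.
Proof. lra. Qed.

(** The Hessian of a locally convex test function is semidefinite. If its
    determinant exceeded 1 it would be definite, and a slight contraction of it
    would touch from below. *)
Lemma viscosity_supersolutionP D u : open D ->
  (forall x, D x -> supersolution_at u x) -> viscosity_supersolution D u.
Proof.
move=> oD su v C2 lv x0 Dx0 mn.
have sH := hessian_sym oD C2 Dx0.
set H := hessian v x0 in sH *.
have pH h : 0 <= qf H h.
  suff K : forall e : R, 0 < e -> 0 <= qf H h + e.
    by apply/ler_addgt0Pr => e; exact: K.
  move=> e e0; set nh := `|h| ^+ 2.
  have nh0 : 0 <= nh by rewrite sqr_ge0.
  have nh1 : 0 < nh + 1 by rewrite ltr_wpDl.
  have d0 : 0 < e / 2 / (nh + 1) by rewrite !divr_gt0.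
  have [r r0 T] := taylor2 oD C2 Dx0 d0.
  set d := e / 2 / (nh + 1) in d0 T.
  have dE : 2 * d * nh <= e.
    have E : 2 * d * (nh + 1) = e by rewrite /d; field; rewrite gt_eqF.
    have d2 : 0 <= 2 * d by rewrite mulr_ge0// ltW.
    by rewrite -[leRHS]E; apply: ler_wpM2l => //; rewrite lerDl.
  have [s s0 Ms] := near_ball_rV (midconvex_of_locally_convex lv Dx0).
  pose m := Num.min r s.
  have m0 : 0 < m by rewrite lt_min r0.
  have h1 : 0 < `|h| + 1 by rewrite ltr_wpDl.
  pose t := m / (`|h| + 1).
  have t0 : 0 < t by rewrite divr_gt0.
  pose k := t *: h.
  have km : `|k| < m.
    by rewrite normrZ gtr0_norm// /t mulrAC ltr_pdivrMr// ltr_pM2l// ltrDl.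
  move: (km); rewrite lt_min => /andP[kr ks].
  have M2 : v x0 <= 2^-1 * (v (x0 - k) + v (x0 + k)) by apply: Ms; rewrite subr0.
  have := T x0 (x0 + k); rewrite subrr normr0 [x0 + k - x0]addrC addKr => /(_ r0 kr).
  have := T x0 (x0 - k); rewrite subrr normr0 [x0 - k - x0]addrC addKr normrN.
  move=> /(_ r0 kr); rewrite !ler_norml dotNr qfN -/H => /andP[_ T1] /andP[_ T2].
  have P : 0 <= qf H k + 2 * (d * `|k| ^+ 2).
    exact: (midpoint_taylor_arith T1 T2 M2).
  rewrite qfZ normrZ gtr0_norm// in P.
  have E : t ^+ 2 * qf H h + 2 * (d * (t * `|h|) ^+ 2) =
      t ^+ 2 * (qf H h + 2 * d * nh) by rewrite /nh; move: (t) (d) => t' d'; ring.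
  have P2 : 0 <= t ^+ 2 * (qf H h + 2 * d * nh) by rewrite -E.
  rewrite pmulr_rge0 ?exprn_gt0// in P2.
  by apply: (le_trans P2); rewrite lerD2l.
rewrite leNgt; apply/negP => dH.
have pdH : posdef H.
  by apply: posdef_of_semidef => //; rewrite gt_eqF// (lt_trans _ dH).
have [g [g0 g1 gd]] := bernoulli_gap n dH.
have [m m0 Hm] := posdef_ge pdH.
have gm : 0 < 2^-1 * g * m by rewrite !mulr_gt0// invr_gt0.
have [r r0 T] := taylor2 oD C2 Dx0 gm.
have := su x0 Dx0 (gradient v x0) ((1 - g) *: H).
have g1' : 0 < 1 - g by rewrite subr_gt0.
move=> /(_ (posdefZ g1' pdH)); rewrite detZ => K.
suff : (1 - g) ^+ n * \det H <= 1 by rewrite leNgt gd.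
apply: K; have mn' := near0_add mn.
near=> h.
have hr : `|h| < r by near: h; exact: near0_rV.
have := T x0 (x0 + h); rewrite subrr normr0 [x0 + h - x0]addrC addKr => /(_ r0 hr).
rewrite ler_norml => /andP[T1 _].
have M2 : u x0 - v x0 <= u (x0 + h) - v (x0 + h) by near: h.
have E : 2^-1 * g * m * `|h| ^+ 2 <= 2^-1 * g * qf H h.
  by rewrite -mulrA ler_wpM2l ?mulr_ge0 ?invr_ge0 ?(ltW g0).
rewrite qfZM; rewrite -/H in T1.
have E2 : 2^-1 * ((1 - g) * qf H h) = 2^-1 * qf H h - 2^-1 * g * qf H h by ring.
by rewrite E2; exact: (comparison_arith T1 M2 E).
Unshelve. all: by end_near. Qed.

Lemma envelope_arith (u0 u1 w0 w1 a b c e : R) :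
  w0 <= w1 - (a + (b + c)) -> u1 <= u0 + a + b -> w1 <= u1 -> u0 - e < w0 ->
  e <= c -> False.
Proof. lra. Qed.

Lemma recenter_arith (w1 w3 p1 p2 q1 q2 d : R) :
  w3 - (p1 + p2 + 2^-1 * (q1 + 2 * d + q2)) <= w1 - (p1 + 2^-1 * q1) ->
  w3 <= w1 + (p2 + d) + 2^-1 * q2.
Proof. lra. Qed.

(** * Upper envelopes *)

Section sup.
Variables (S : set ('rV[R]_n -> R)) (D : set 'rV[R]_n) (U : 'rV[R]_n -> R).
Hypothesis oD : open D.
Hypothesis S0 : S !=set0.
Hypothesis Sgerm : forall w, S w -> forall x, D x -> germ w x.
Hypothesis SU : forall w, S w -> forall x, D x -> w x <= U x.
Hypothesis cU : forall x, D x -> {for x, continuous U}.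

Definition upper_envelope x : R := sup [set w x | w in S].
Let u := upper_envelope.

Lemma has_sup_envelope x : D x -> has_sup [set w x | w in S].
Proof.
move=> Dx; split; first by case: S0 => w Sw; exists (w x), w.
by exists (U x) => _ [w Sw <-]; exact: SU.
Qed.

Lemma le_envelope w x : D x -> S w -> w x <= u x.
Proof.
move=> Dx Sw; apply: sup_upper_bound; first exact: has_sup_envelope.
by exists w.
Qed.

Lemma envelope_le x (M : R) : (forall w, S w -> w x <= M) -> u x <= M.
Proof.
move=> H; apply: ge_sup.
  by case: S0 => w Sw; exists (w x), w.
by move=> _ [w Sw <-]; exact: H.
Qed.

Lemma envelope_adherent x (e : R) : D x -> 0 < e -> exists2 w, S w & u x - e < w x.
Proof.
move=> Dx e0; have [_ [w Sw <-] H] := sup_adherent e0 (has_sup_envelope Dx).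
by exists w.
Qed.

Lemma envelope_cvx B : B `<=` D ->
  (forall a b, B a -> B b ->
    forall t : R, 0 <= t -> t <= 1 -> B (t *: a + (1 - t) *: b)) ->
  cvx B u.
Proof.
move=> BD cB a b Ba Bb t t0 t1; apply: envelope_le => w Sw.
have cw : cvx B w.
  apply: (@cvx_ball_of_midconvex _ _ D) => // x Dx; by have [] := Sgerm Sw Dx.
apply: (le_trans (cw a b Ba Bb t t0 t1)).
by apply: lerD; rewrite ler_wpM2l ?subr_ge0// le_envelope//; exact: BD.
Qed.

Lemma ball_convex_rV (x a b : 'rV[R]_n) (r : R) : `|a - x| < r -> `|b - x| < r ->
  forall t : R, 0 <= t -> t <= 1 -> `|t *: a + (1 - t) *: b - x| < r.
Proof.
move=> Ba Bb t t0 t1.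
have -> : t *: a + (1 - t) *: b - x = t *: (a - x) + (1 - t) *: (b - x).
  by apply/rowP => i; rewrite !mxE; ring.
apply: le_lt_trans (ler_normD _ _) _; rewrite (normrZ t) (normrZ (1 - t)).
rewrite (ger0_norm t0) (@ger0_norm _ (1 - t)) ?subr_ge0//.
have [->|tn] := eqVneq t 0; first by rewrite mul0r add0r subr0 mul1r.
have tp : 0 < t by rewrite lt_neqAle eq_sym tn.
have : t * `|a - x| < t * r by rewrite ltr_pM2l.
have : (1 - t) * `|b - x| <= (1 - t) * r by rewrite ler_wpM2l ?subr_ge0// ltW.
by lra.
Qed.

Lemma within_continuousW (A : set 'rV[R]_n) (f : 'rV[R]_n -> R) :
  (forall x, A x -> {for x, continuous f}) -> {within A, continuous f}.
Proof.
move=> cf; apply/subspace_continuousP => x Ax; apply: cvg_trans (cf x Ax).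
by apply: cvg_app; exact: cvg_within.
Qed.

Lemma closed_ball0_compact (r : R) : compact [set h : 'rV[R]_n | `|h| <= r].
Proof.
apply: bounded_closed_compact.
  by exists r; split; [exact: num_real|move=> t rt h /= /le_trans; apply; exact: ltW].
rewrite (_ : mkset _ = (fun x : 'rV[R]_n => `|x|) @^-1` [set y | y <= r])//.
apply: closed_comp; last exact: closed_le.
by move=> x _; exact: norm_continuous.
Qed.

Lemma near_open_ball (x : 'rV[R]_n) : D x ->
  exists2 r : R, 0 < r & forall z, `|z - x| < r -> D z.
Proof. by move=> Dx; apply: near_ball_rV; exact: open_nbhs_nbhs. Qed.

(** Locally bounded above and convex implies continuous. *)
Lemma envelope_continuous x : D x -> {for x, continuous u}.
Proof.
move=> Dx.
have [r r0 rD] := near_open_ball Dx.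
have [s s0 sU] : exists2 s : R, 0 < s & forall z, `|z - x| < s -> U z <= U x + 1.
  apply: near_ball_rV; have /cvgrPdist_le/(_ 1 ltr01) := cU Dx.
  apply: filterS => z; rewrite ler_norml => /andP[+ _].
  by move: (U x) (U z) => a b; lra.
pose m := Num.min r s.
have m0 : 0 < m by rewrite lt_min r0.
apply: (@cvx_continuous_center _ _ u x m (U x + 1)) => //.
  apply: envelope_cvx => [z|a b Ba Bb t t0 t1].
    by rewrite /= lt_min => /andP[zr _]; exact: rD.
  exact: ball_convex_rV.
move=> z; rewrite lt_min => /andP[zr zs].
by apply: envelope_le => w Sw; apply: le_trans (sU z zs); apply: SU => //; exact: rD.
Qed.

(** A paraboloid touching the envelope from above is made steeper by [e]; it
    then touches, at a nearby point, any member of the family that almost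
    attains the envelope at [x]. *)
Lemma envelope_subsolution x : D x -> subsolution_at u x.
Proof.
move=> Dx p M sM T; apply: det_ge1_of_perturb => e e0.
have [r0 r00 rD] := near_open_ball Dx.
have [r1 r10 rT] := near_ball_rV T.
pose r := Num.min r0 r1 / 2.
have m0 : 0 < Num.min r0 r1 by rewrite lt_min r00.
have rp : 0 < r by rewrite divr_gt0.
have rm : r < Num.min r0 r1 by rewrite /r; lra.
move: (rm); rewrite lt_min => /andP[rr0 rr1].
pose N := M + e%:M.
have sN : N^T = N by rewrite linearD /= sM tr_scalar_mx.
have er : 0 < 2^-1 * e * r ^+ 2 by rewrite !mulr_gt0 ?invr_gt0// exprn_gt0.
have [w Sw wx] := envelope_adherent Dx er.
have xhD h : `|h| <= r -> D (x + h).
  by move=> hr; apply: rD; rewrite addrC addKr; exact: le_lt_trans rr0.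
pose g h := w (x + h) - (dot p h + 2^-1 * qf N h).
have cg : {within [set h : 'rV[R]_n | `|h| <= r], continuous g}.
  apply: within_continuousW => h hr; have [cw _ _] := Sgerm Sw (xhD h hr).
  have cwx : {for h, continuous (fun k => w (x + k))}.
    exact: (@continuous_comp _ _ _ (fun k => x + k) w h (@addl_continuous _ _ x h) cw).
  have cq : {for h, continuous (fun k => dot p k + 2^-1 * qf N k)}.
    apply: (@cvgD _ _ _ (nbhs h) _ (dot p)); first exact: dot_continuous.
    by apply: (@cvgM _ _ (nbhs h) _ (fun=> 2^-1)); [exact: cvg_cst|exact: qf_continuous].
  exact: (@cvgB _ _ _ (nbhs h) _ _ _ _ _ cwx cq).
have K0 : [set h : 'rV[R]_n | `|h| <= r] !=set0 by exists 0; rewrite /= normr0 ltW.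
have [h1] := EVT_max_rV K0 (closed_ball0_compact (r := r)) cg.
rewrite inE /= => h1r mx.
have g0 : g 0 = w x by rewrite /g addr0 dot0r qf0 mulr0 addr0 subr0.
have gmx h : `|h| <= r -> g h <= g h1 by move=> hr; apply: mx; rewrite inE.
have h1r' : `|h1| < r.
  rewrite lt_neqAle h1r andbT; apply/eqP => h1E.
  have := gmx 0; rewrite normr0 g0 => /(_ (ltW rp)) w1.
  have := rT h1; rewrite subr0 => /(_ (le_lt_trans h1r rr1)) T1.
  have L := le_envelope (xhD h1 h1r) Sw.
  have := norm_sqr_le_dot h1; rewrite h1E => D1.
  have : 2^-1 * e * r ^+ 2 <= 2^-1 * e * dot h1 h1.
    by rewrite ler_wpM2l// mulr_ge0 ?invr_ge0// ltW.
  rewrite /g /N qfDM qf_scalar in w1.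
  have E2 : 2^-1 * (qf M h1 + e * dot h1 h1) = 2^-1 * qf M h1 + 2^-1 * e * dot h1 h1.
    by ring.
  by rewrite E2 in w1 => D2; exact: (envelope_arith w1 T1 L wx D2).
have [_ _ sw] := Sgerm Sw (xhD h1 h1r).
apply: (sw (p + h1 *m N) N sN).
have d0 : 0 < r - `|h1| by rewrite subr_gt0.
near=> k.
have kr : `|k| < r - `|h1| by near: k; exact: near0_rV.
have hk : `|h1 + k| <= r by apply: (le_trans (ler_normD _ _)); lra.
have := gmx _ hk; rewrite /g addrA dotDr qfD// dotDl.
by move=> H; exact: (recenter_arith H).
Unshelve. all: by end_near. Qed.

Lemma envelope_germ x : D x -> germ u x.
Proof.
move=> Dx; split.
- exact: envelope_continuous.
- have [r r0 rD] := near_open_ball Dx.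
  have cu : cvx [set z : 'rV[R]_n | `|z - x| < r] u.
    by apply: envelope_cvx => // a b Ba Bb t t0 t1; exact: ball_convex_rV.
  suff : \forall h \near (0 : 'rV[R]_n), u x <= 2^-1 * (u (x - h) + u (x + h)).
    by [].
  near=> h.
  have hs : `|h| < r by near: h; exact: near0_rV.
  have B1 : [set z : 'rV[R]_n | `|z - x| < r] (x - h).
    by rewrite /= addrC addKr normrN.
  have B2 : [set z : 'rV[R]_n | `|z - x| < r] (x + h).
    by rewrite /= addrC addKr.
  have h0 : (0 : R) <= 2^-1 by rewrite invr_ge0.
  have h1 : (2^-1 : R) <= 1 by lra.
  have := cu _ _ B1 B2 2^-1 h0 h1.
  rewrite (_ : 1 - 2^-1 = 2^-1); last by lra.
  rewrite (_ : _ *: (x - h) + _ = x).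
    by move: (u x) (u (x - h)) (u (x + h)) => a0 a1 a2; lra.
  by apply/rowP => i; rewrite !mxE; field.
- exact: envelope_subsolution.
Unshelve. all: by end_near. Qed.

End sup.

End paraboloids.

(** * Graph coordinates *)

Section charts.
Context {R : realType} {n : nat}.
Implicit Types (x y : 'rV[R]_n) (s t : R) (Q : 'M[R]_n.+1).

Lemma rjoinD x y s t : rjoin x s + rjoin y t = rjoin (x + y) (s + t).
Proof. by apply/rowP => i; rewrite !mxE; case: unlift => [j|//]; rewrite mxE. Qed.

Lemma rjoinB x y s t : rjoin x s - rjoin y t = rjoin (x - y) (s - t).
Proof. by apply/rowP => i; rewrite !mxE; case: unlift => [j|//]; rewrite !mxE. Qed.

Lemma rjoinZ a x t : a *: rjoin x t = rjoin (a *: x) (a * t).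
Proof. by apply/rowP => i; rewrite !mxE; case: unlift => [j|//]; rewrite mxE. Qed.

Lemma dot_rjoin x y s t : dot (rjoin x s) (rjoin y t) = dot x y + s * t.
Proof.
rewrite !dotE (bigD1_ord ord_max)//= !mxE unlift_none addrC; congr (_ + _).
by apply: eq_bigr => i _; rewrite !mxE liftK.
Qed.

Definition rbase (z : 'rV[R]_n.+1) : 'rV[R]_n := \row_j z 0 (lift ord_max j).
Definition rtop (z : 'rV[R]_n.+1) : R := z 0 ord_max.

Lemma rjoinK (z : 'rV[R]_n.+1) : rjoin (rbase z) (rtop z) = z.
Proof.
by apply/rowP => i; rewrite mxE; case: unliftP => [j ->|->//]; rewrite mxE.
Qed.

Lemma rbaseK x t : rbase (rjoin x t) = x.
Proof. by apply/rowP => i; rewrite !mxE liftK. Qed.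

Lemma rtopK x t : rtop (rjoin x t) = t.
Proof. by rewrite /rtop mxE unlift_none. Qed.

Lemma norm_rbase (z : 'rV[R]_n.+1) : `|rbase z| <= `|z|.
Proof. by apply: norm_leP => // i; rewrite mxE le_coord_norm. Qed.

Lemma norm_rtop (z : 'rV[R]_n.+1) : `|rtop z| <= `|z|.
Proof. exact: le_coord_norm. Qed.

Lemma norm_rjoin x t : `|rjoin x t| <= `|x| + `|t|.
Proof.
apply: norm_leP => [|i]; first by rewrite addr_ge0.
rewrite mxE; case: unlift => [j|]; last by rewrite lerDr.
by rewrite (le_trans (le_coord_norm _ _))// lerDl.
Qed.

Lemma chartB xi Q x y s t :
  chart xi Q y t - chart xi Q x s = rjoin (y - x) (t - s) *m Q.
Proof. by rewrite /chart opprD addrACA subrr add0r -mulmxBl rjoinB. Qed.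

Lemma chart_line xi Q x y s t (a : R) :
  a *: chart xi Q x s + (1 - a) *: chart xi Q y t =
  chart xi Q (a *: x + (1 - a) *: y) (a * s + (1 - a) * t).
Proof.
rewrite /chart -rjoinD -!rjoinZ mulmxDl -!scalemxAl !scalerDr addrACA; congr (_ + _).
by rewrite -scalerDl addrCA subrr addr0 scale1r.
Qed.

Section orthogonal.
Variables (xi : 'rV[R]_n.+1) (Q : 'M[R]_n.+1).
Hypothesis QQ : Q *m Q^T = 1%:M.

Lemma dot_orthogonal (a b : 'rV[R]_n.+1) : dot (a *m Q) (b *m Q) = dot a b.
Proof. by rewrite dot_mulmxl -mulmxA QQ mulmx1. Qed.

Definition cbase (z : 'rV[R]_n.+1) := rbase ((z - xi) *m Q^T).
Definition ctop (z : 'rV[R]_n.+1) := rtop ((z - xi) *m Q^T).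

Lemma chartK (z : 'rV[R]_n.+1) : chart xi Q (cbase z) (ctop z) = z.
Proof.
by rewrite /chart rjoinK -mulmxA (mulmx1C QQ) mulmx1 addrC subrK.
Qed.

Lemma chart_near (e : R) : 0 < e -> exists2 s : R, 0 < s &
  forall z : 'rV[R]_n.+1, `|z - xi| < s -> `|cbase z| < e /\ `|ctop z| < e.
Proof.
move=> e0; have [C C0 HC] := norm_mulmx_le Q^T.
exists (e / C); first by rewrite divr_gt0.
move=> z; rewrite ltr_pdivlMr// mulrC => zs.
have H : `|(z - xi) *m Q^T| < e by apply: le_lt_trans zs.
by split; apply: le_lt_trans H; [exact: norm_rbase|exact: norm_rtop].
Qed.

End orthogonal.

Lemma rjoin_continuous (T : Type) (F : set_system T) {FF : Filter F}
    (f : T -> 'rV[R]_n) (g : T -> R) x t :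
  f @ F --> x -> g @ F --> t -> rjoin (f u) (g u) @[u --> F] --> rjoin x t.
Proof.
move=> fx gt; apply/cvgrPdist_le => e e0.
have e2 : 0 < e / 2 by rewrite divr_gt0.
move/cvgrPdist_le : fx => /(_ _ e2) fx; move/cvgrPdist_le : gt => /(_ _ e2) gt.
near=> u; rewrite rjoinB (le_trans (norm_rjoin _ _))//.
rewrite (splitr e); apply: lerD; near: u; [exact: fx|exact: gt].
Unshelve. all: by end_near. Qed.

Lemma mulmx_continuous m (M : 'M[R]_m) (T : Type) (F : set_system T) {FF : Filter F}
    (f : T -> 'rV[R]_m) (a : 'rV[R]_m) :
  f @ F --> a -> f u *m M @[u --> F] --> a *m M.
Proof.
move=> fx; have [C C0 HC] := norm_mulmx_le M.
apply/cvgrPdist_le => e e0.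
have eC : 0 < e / C by rewrite divr_gt0.
move/cvgrPdist_le : fx => /(_ _ eC); apply: filterS => u Hu.
rewrite -mulmxBl (le_trans (HC _))// mulrC -ler_pdivlMr//.
Qed.

Lemma chart_continuous xi Q (T : Type) (F : set_system T) {FF : Filter F}
    (f : T -> 'rV[R]_n) (g : T -> R) x t :
  f @ F --> x -> g @ F --> t -> chart xi Q (f u) (g u) @[u --> F] --> chart xi Q x t.
Proof.
move=> fx gt; apply: (@cvg_comp _ _ _ (fun u => rjoin (f u) (g u) *m Q) _ _ (nbhs (rjoin x t *m Q))).
  exact: mulmx_continuous (rjoin_continuous fx gt).
exact: addl_continuous.
Qed.

Lemma open_eball m (x : 'rV[R]_m) (r : R) : open (eball x r).
Proof.
suff K : forall z : 'rV[R]_m, eball x r z -> \forall w \near z, eball x r w.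
  by rewrite openE => z /K.
move=> z Ez.
have r0 : 0 < r by apply: le_lt_trans Ez; exact: sqrtr_ge0.
move/(eballP _ _ r0) : Ez => Ez.
have c : {for z, continuous (fun w : 'rV[R]_m => dot (w - x) (w - x))}.
  have cz : {for z, continuous (fun w : 'rV[R]_m => w - x : 'rV[R]_m)}.
    exact: subr_continuous.
  exact: (@cvg_dot _ _ _ (nbhs z) _ _ _ _ _ cz cz).
have H : \forall w \near z, dot (w - x) (w - x) < r ^+ 2 := cvgr_lt _ c _ Ez.
by near=> w; apply/(eballP _ _ r0); near: w; exact: H.
Unshelve. all: by end_near.
Qed.

End charts.

(** * Principal curvatures *)

Section curvature.
Context {R : realType} {n : nat}.

(** A minimiser of the Rayleigh quotient of the second by the first
    fundamental form is an eigenvector of the shape operator, so the smallest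
    principal curvature bounds the second fundamental form from below. *)
Lemma posdef_hessian (Omega : set 'rV[R]_n.+1) xi Q delta rho : (0 < n)%N ->
  strictly_convex Omega -> boundary Omega xi ->
  local_coordinates Omega xi Q delta rho -> Ck 2 (eball 0 delta) rho ->
  posdef (hessian rho 0).
Proof.
move=> n0 [_ curv] bxi lc C2.
have delta0 : 0 < delta by case: lc.
have E0 : eball 0 delta (0 : 'rV[R]_n).
  by apply/eballP => //; rewrite subrr dot0l exprn_gt0.
have sH := hessian_sym (@open_eball _ _ 0 delta) C2 E0.
set H := hessian rho 0 in sH *.
set p := gradient rho 0; pose G : 'M[R]_n := 1%:M + p^T *m p.
have sG : G^T = G by rewrite /G linearD /= trmx1 trmx_mul trmxK.
have qG x : qf G x = dot x x + dot x p ^+ 2.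
  rewrite /G qfDM qf_scalar mul1r; congr (_ + _).
  rewrite /qf mulmxA /dot -mulmxA mxE big_ord1 -/(dot x p) expr2; congr (_ * _).
  by rewrite -/(dot p x) dotC.
have pG : posdef G.
  split=> // x x0; rewrite qG.
  by rewrite ltr_wpDr ?sqr_ge0// dot_gt0.
pose S := [set x : 'rV[R]_n | `|x| = 1].
have Sn0 x : S x -> x != 0 by move=> Sx; rewrite -normr_eq0 Sx oner_eq0.
have S0 : S !=set0.
  exists (`|const_mx 1 : 'rV[R]_n|^-1 *: const_mx 1); rewrite /S/= normrZ.
  have c0 : 0 < `|const_mx 1 : 'rV[R]_n|.
    rewrite normr_gt0; apply/eqP => /rowP /(_ (Ordinal n0)).
    by rewrite !mxE => /eqP; rewrite oner_eq0.
  by rewrite gtr0_norm ?invr_gt0// mulVf// gt_eqF.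
have cS : compact S.
  apply: bounded_closed_compact.
    by exists 1; split=> // t t1 x /= ->; exact: ltW.
  rewrite (_ : S = (fun x : 'rV[R]_n => `|x|) @^-1` [set 1])//.
  apply: closed_comp; last exact: closed_eq.
  by move=> x _; exact: norm_continuous.
pose q x := qf H x * (qf G x)^-1.
have cq : {within S, continuous q}.
  apply: within_continuousW => x Sx.
  apply: (@cvgM _ _ (nbhs x) _ (qf H)); first exact: qf_continuous.
  apply: (@cvgV _ _ (nbhs x) _ (qf G)); last exact: qf_continuous.
  by rewrite gt_eqF//; apply: pG.2; exact: Sn0.
have [c] := EVT_min_rV S0 cS cq; rewrite inE => Sc cmin.
have c0 := Sn0 c Sc.
set la := q c in cmin.
have Hge x : la * qf G x <= qf H x.
  have [->|x0] := eqVneq x 0; first by rewrite !qf0 mulr0.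
  have nx : 0 < `|x| by rewrite normr_gt0.
  have := cmin (`|x|^-1 *: x); rewrite inE /S/= normrZ.
  rewrite gtr0_norm ?invr_gt0// mulVf ?gt_eqF// => /(_ erefl).
  rewrite /q !qfZ.
  have Gx := pG.2 x x0.
  have -> : `|x|^-1 ^+ 2 * qf H x * (`|x|^-1 ^+ 2 * qf G x)^-1 = qf H x / qf G x.
    by field; rewrite !gt_eqF.
  by rewrite ler_pdivlMr.
have Gc := pG.2 c c0.
have cF : c *m (H - la *: G) = 0.
  apply: semidef_null.
  - by rewrite linearB linearZ /= sH sG.
  - by move=> h; rewrite qfDM qfNM qfZM subr_ge0.
  - by rewrite qfDM qfNM qfZM /la /q divfK ?gt_eqF// subrr.
have uG : G \in unitmx.
  rewrite unitmxE unitfE gt_eqF//.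
  by have [] := det_le_of_qf_le pG sG (fun=> lexx _).
have la0 : 0 < la.
  pose sc := (Num.sqrt (1 + dot p p))^-1.
  have sc0 : 0 < sc by rewrite invr_gt0 sqrtr_gt0 ltr_wpDr// dot_ge0.
  suff : 0 < sc * la by rewrite pmulr_rgt0.
  apply: (curv xi bxi); exists Q, delta, rho; split=> //.
  apply/eigenvalueP; exists c => //.
  rewrite /shape_operator -/p -/H -/G -scalemxAr mulmxA.
  move/eqP: cF; rewrite mulmxBr subr_eq0 => /eqP ->.
  by rewrite -scalemxAr -scalemxAl mulmxK// scalerA.
split=> // x x0; apply: lt_le_trans (Hge x).
by rewrite mulr_gt0// pG.2.
Qed.

End curvature.

(** * Local strict convexity of the boundary *)

Lemma support_arith (R : realType) (h d rr gd dd w D : R) :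
  (d + rr) * (d + rr) <= 2 * d ^+ 2 + 2 * rr ^+ 2 -> d ^+ 2 <= 2 * h * d ->
  dd + 2 * rr ^+ 2 <= w * D -> w * D <= w * (rr - gd) -> 0 <= rr - gd ->
  0 <= 4 * h * (rr - gd) -> 0 <= w * d -> 0 <= d ->
  dd + (d + rr) * (d + rr) <= (4 * h + w + 1) * (- gd + (d + rr)).
Proof.
move=> F1 F2 F3 F5 F6 F7 F8 d0.
have -> : (4 * h + w + 1) * (- gd + (d + rr)) =
    4 * h * d + w * (rr - gd) + (4 * h * (rr - gd) + w * d + d + (rr - gd)) by ring.
lra.
Qed.

Section geometry.
Context {R : realType} {n : nat}.
Variable (Omega : set 'rV[R]_n.+1).
Hypothesis n0 : (0 < n)%N.
Hypothesis dom : domain Omega.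
Hypothesis bdd : bounded_set Omega.
Hypothesis sconv : strictly_convex Omega.
Implicit Types (xi eta z : 'rV[R]_n.+1).

Let oO : open Omega. Proof. by case: dom. Qed.

Lemma interiorO : interior Omega = Omega.
Proof. exact: ((interior_id Omega).1 oO). Qed.

Lemma boundaryE z : boundary Omega z <-> closure Omega z /\ ~ Omega z.
Proof. by rewrite /boundary interiorO. Qed.

Lemma closureE z : closure Omega z <-> Omega z \/ boundary Omega z.
Proof.
rewrite boundaryE; split=> [cz|[Oz|[]//]]; last exact: subset_closure.
by have [|] := pselect (Omega z); [left|right].
Qed.

(** [g] is the gradient of the graph; of its regularity only the two-sided
    quadratic bound is kept, on which the later estimates rest. *)
Definition convex_chart xi Q (h r k L : R) (rho : 'rV[R]_n -> R)
    (g : 'rV[R]_n -> 'rV[R]_n) : Prop :=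
  [/\ Q *m Q^T = 1%:M, 0 < h /\ rho 0 = 0,
    forall x : 'rV[R]_n, `|x| < r -> `|rho x| < h /\ forall t, `|t| < h ->
      (boundary Omega (chart xi Q x t) <-> t = rho x) /\
      (Omega (chart xi Q x t) <-> rho x < t),
    forall x : 'rV[R]_n, `|x| < r -> {for x, continuous rho} /\ `|g x| <= L &
    forall x y : 'rV[R]_n, `|x| < r -> `|y| < r ->
      k * `|y - x| ^+ 2 <= rho y - rho x - dot (g x) (y - x) <= L * `|y - x| ^+ 2].

(** At the centre the Hessian of the graph is positive definite by the curvature
    hypothesis; the uniform Taylor expansion carries the two-sided bound to
    nearby base points. *)
Lemma convex_chart_exists xi : boundary Omega xi ->
  exists Q delta h r k L rho g, [/\ local_coordinates Omega xi Q delta rho,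
    convex_chart xi Q h r k L rho g & [/\ 0 < r, 0 < k & 0 < L]].
Proof.
move=> bxi; have [Q [delta [rho [lc C2]]]] := sconv.1 xi bxi.
have pH := posdef_hessian n0 sconv bxi lc C2.
have [QQ d0 rho0 [h h0 Hh]] := lc.
have E0 : eball 0 delta (0 : 'rV[R]_n).
  by apply/eballP => //; rewrite subrr dot0l exprn_gt0.
set H := hessian rho 0 in pH.
have [m m0 Hm] := posdef_ge pH.
have [B B0 HB] := bf_le H.
have m4 : 0 < m / 4 by rewrite divr_gt0.
have oE := @open_eball _ _ (0 : 'rV[R]_n) delta.
have [r1 r10 T] := taylor2 oE C2 E0 m4.
have [s s0 Hs] := @norm_eball _ n delta d0.
have grad_bdd : \forall x \near (0 : 'rV[R]_n), forall i : 'I_n,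
    `|partial i rho x| <= `|partial i rho 0| + 1.
  apply: (@filter_forall _ 'I_n (fun i x => `|partial i rho x| <= `|partial i rho 0| + 1)
    (nbhs (0 : 'rV[R]_n)) _) => i.
  have : {for 0, continuous (partial i rho)}.
    by have [_ /(_ i) [_ [+ _]]] := C2; apply.
  move=> /cvgrPdist_le/(_ 1 ltr01); apply: filterS => x Hx.
  rewrite -[X in `|X| <= _](subrK (partial i rho 0)) addrC.
  by rewrite (le_trans (ler_normD _ _))// lerD2l distrC.
have [r2 r20 G] := near_ball_rV grad_bdd.
pose gb : R := \sum_i (`|partial i rho 0| + 1).
have gb0 : 0 <= gb by apply: sumr_ge0 => i _; rewrite addr_ge0.
pose r := Num.min r1 (Num.min s r2).
have r0 : 0 < r by rewrite !lt_min r10 s0.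
pose L := gb + B + m.
have rE (x : 'rV[R]_n) : `|x| < r -> [/\ `|x| < r1, eball 0 delta x & `|x| < r2].
  rewrite /r !lt_min => /andP[H1 /andP[H2 H3]].
  split; [exact: H1| |exact: H3].
  by have := Hs 0 x; rewrite subr0; apply.
exists Q, delta, h, r, (m / 4), L, rho, (gradient rho); split=> //; last first.
  by split=> //; rewrite /L ltr_wpDl// addr_ge0// ltW.
split=> //.
- by move=> x /rE [_ Ex _]; exact: Hh.
- move=> x /rE [_ Ex xr2]; split; first exact: (Ck_continuous C2 Ex).
  apply: (@le_trans _ _ gb); last by rewrite /L -addrA lerDl addr_ge0// ltW.
  apply: norm_leP => // i; rewrite mxE.
  have := G x; rewrite subr0 => /(_ xr2 i) /le_trans; apply.
  rewrite /gb (bigD1 i)//= lerDl; apply: sumr_ge0 => j _; exact: addr_ge0.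
- move=> x y /rE [xr1 _ _] /rE [yr1 _ _].
  have := T x y; rewrite !subr0 => /(_ xr1 yr1); rewrite ler_norml -/H.
  have Hl := Hm (y - x).
  have Hu : qf H (y - x) <= B * `|y - x| ^+ 2.
    by rewrite expr2 mulrA; apply: (le_trans (ler_norm _)); exact: HB.
  have D0 : 0 <= (gb + 2^-1 * B) * `|y - x| ^+ 2.
    by rewrite mulr_ge0 ?sqr_ge0// addr_ge0// mulr_ge0 ?invr_ge0// ltW.
  move: D0 Hl Hu; rewrite /L !mulrDl.
  move: (`|y - x| ^+ 2) => D D0 Hl Hu /andP[T1 T2].
  have m40 : m * D = 4 * (m / 4 * D) by field.
  have mD : 0 <= m / 4 * D by nra.
  move: D0 Hl Hu T1 T2 m40 mD; clear; move=> *.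
  by apply/andP; split; lra.
Qed.

(** The vector [nu] is the inner normal of the tangent hyperplane at [eta]: the
    chart gives the quadratic gain on the graph, and inside the domain the
    height above the graph is added to it. *)
Lemma local_support xi : boundary Omega xi ->
  exists s k C : R, [/\ 0 < s, 0 < k & forall eta, boundary Omega eta ->
    `|eta - xi| < s -> exists2 nu : 'rV[R]_n.+1, `|nu| <= C &
      forall z, closure Omega z -> `|z - xi| < s ->
        k * `|z - eta| ^+ 2 <= dot nu (z - eta)].
Proof.
move=> /convex_chart_exists [Q [delta [h [r [k [L [rho [g [_ cc [r0 k0 L0]]]]]]]]]].
have [QQ [h0 _] Hb Hg Hr] := cc.
have m0 : 0 < Num.min r h by rewrite lt_min r0.
have [s s0 Hs] := chart_near xi Q m0.
have [C C0 HC] := norm_mulmx_le Q.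
pose C2 := (n%:R * L + L * (2 * r)) ^+ 2.
pose C3 := 4 * h + (n%:R + 2 * C2) / k + 1.
have C20 : 0 <= C2 by exact: sqr_ge0.
have C30 : 0 < C3.
  rewrite /C3 ltr_wpDl// addr_ge0//; first by rewrite mulr_ge0// ltW.
  by apply: divr_ge0; [rewrite addr_ge0// mulr_ge0|exact: ltW].
exists s, C3^-1, (C * (L + 1)); split=> //; first by rewrite invr_gt0.
have coord z : closure Omega z -> `|z - xi| < s -> exists x t,
    [/\ z = chart xi Q x t, `|x| < r, `|t| < h, `|rho x| < h & rho x <= t].
  move=> cz zs; have [] := Hs z zs; rewrite !lt_min => /andP[xr _] /andP[_ th].
  exists (cbase xi Q z), (ctop xi Q z); rewrite chartK//; split=> //.
    by have [] := Hb _ xr.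
  have [_ /(_ _ th)] := Hb _ xr; rewrite chartK// => -[bE OE].
  by move/closureE : cz => [/OE/ltW//|/bE ->].
move=> eta be etas.
have [|x [t [etaE xr th _ _]]] := coord eta _ etas.
  by apply/closureE; right.
have tE : t = rho x.
  by have [_ /(_ _ th)] := Hb _ xr; rewrite -etaE => -[[+ _] _]; apply.
exists (rjoin (- g x) 1 *m Q).
  apply: (le_trans (HC _)); rewrite ler_wpM2l ?(ltW C0)//.
  apply: (le_trans (norm_rjoin _ _)); rewrite normrN normr1 lerD2r.
  by have [] := Hg x xr.
move=> z cz zs; have [y [t' [-> yr t'h rh rt']]] := coord z cz zs.
rewrite etaE chartB dot_orthogonal// dot_rjoin mul1r dotNl.
have := Hr x y xr yr => /andP[Hr1 Hr2].
have Hg' : `|dot (g x) (y - x)| <= n%:R * L * `|y - x|.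
  apply: (le_trans (norm_dot_le _ _)); apply: ler_wpM2r => //.
  by apply: ler_wpM2l => //; have [] := Hg x xr.
have yx : `|y - x| <= 2 * r.
  by apply: (le_trans (ler_normB _ _)); lra.
have yx0 := normr_ge0 (y - x).
have Hd : `|rho y - rho x| <= (n%:R * L + L * (2 * r)) * `|y - x|.
  rewrite mulrDl.
  have P1 : L * `|y - x| ^+ 2 <= L * (2 * r) * `|y - x|.
    have -> : L * `|y - x| ^+ 2 = L * `|y - x| * `|y - x| by ring.
    apply: ler_wpM2r => //.
    by apply: ler_wpM2l => //; exact: ltW.
  have P2 : 0 <= k * `|y - x| ^+ 2 by rewrite mulr_ge0 ?sqr_ge0// ltW.
  have P3 : 0 <= L * (2 * r) * `|y - x| by rewrite !mulr_ge0 ?(ltW L0) ?(ltW r0).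
  move: Hg'; rewrite !ler_norml => /andP[g1 g2].
  move: g1 g2 P1 P2 P3 Hr1 Hr2; clear; move=> *.
  by apply/andP; split; lra.
set d := t' - rho y.
have d0 : 0 <= d by rewrite subr_ge0.
have d2 : d <= 2 * h.
  by move: t'h rh; rewrite /d !ltr_norml => /andP[? ?] /andP[? ?]; lra.
rewrite ler_pdivrMl//.
apply: (@le_trans _ _ (dot (rjoin (y - x) (t' - t) *m Q) (rjoin (y - x) (t' - t) *m Q))).
  exact: norm_sqr_le_dot.
rewrite dot_orthogonal// dot_rjoin tE.
have D1 := dot_le_norm_sqr (y - x).
have D2 : (rho y - rho x) ^+ 2 <= C2 * `|y - x| ^+ 2.
  rewrite -exprMn -(real_normK (num_real (rho y - rho x))) ler_pXn2r ?nnegrE//.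
  by rewrite mulr_ge0// addr_ge0// mulr_ge0 ?(ltW L0) ?mulr_ge0 ?(ltW r0).
have E : t' - rho x = d + (rho y - rho x) by rewrite /d addrA subrK.
rewrite E.
move: Hr1 D1 D2; move: (`|y - x| ^+ 2) (sqr_ge0 `|y - x|) => D DD Hr1 D1 D2.
clear Hd Hg' yx yx0 Hr2.
move: (dot _ (y - x)) (dot (y - x) _) (rho y - rho x) D1 D2 Hr1 => gd dd rr D1 D2 Hr1.
have F1 : (d + rr) * (d + rr) <= 2 * d ^+ 2 + 2 * rr ^+ 2.
  have : 0 <= (d - rr) ^+ 2 by exact: sqr_ge0.
  by rewrite !expr2; nra.
have F2 : d ^+ 2 <= 2 * h * d by rewrite expr2 ler_wpM2r.
have F3 : dd + 2 * rr ^+ 2 <= (n%:R + 2 * C2) * D by rewrite mulrDl; lra.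
have F4 : (n%:R + 2 * C2) * D = (n%:R + 2 * C2) / k * (k * D).
  by field; rewrite gt_eqF.
pose w := (n%:R + 2 * C2) / k.
have w0 : 0 <= w.
  by apply: divr_ge0; [rewrite addr_ge0// mulr_ge0|exact: ltW].
have F5 : w * (k * D) <= w * (rr - gd) by rewrite ler_wpM2l.
have F6 : 0 <= rr - gd by apply: le_trans Hr1; rewrite mulr_ge0// ltW.
have F7 : 0 <= 4 * h * (rr - gd) by rewrite !mulr_ge0// ltW.
have F8 : 0 <= w * d by rewrite mulr_ge0.
rewrite F4 -/w in F3.
exact: (support_arith F1 F2 F3 F5 F6 F7 F8 d0).
Qed.

End geometry.

(** * Global convexity of the domain *)

Section global_geometry.
Context {R : realType} {n : nat}.
Variable (Omega : set 'rV[R]_n.+1).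
Hypothesis n0 : (0 < n)%N.
Hypothesis dom : domain Omega.
Hypothesis bdd : bounded_set Omega.
Hypothesis sconv : strictly_convex Omega.
Implicit Types (xi eta z x y : 'rV[R]_n.+1).

Let oO : open Omega. Proof. by case: dom. Qed.

Lemma closure_image (f : 'rV[R]_n.+1 -> 'rV[R]_n.+1) (A B : set 'rV[R]_n.+1) z :
  {for z, continuous f} -> (forall x, A x -> closure B (f x)) -> closure A z ->
  closure B (f z).
Proof.
move=> cf AB Az; rewrite (closure_id (closure B)).1; last exact: closed_closure.
move=> U /cf /Az [x [Ax Ux]]; exists (f x); split=> //; exact: AB.
Qed.

Lemma line_continuous (a b : 'rV[R]_n.+1) :
  continuous (fun t : R => a + t *: b : 'rV[R]_n.+1).
Proof.
move=> t; apply: (@continuous_comp _ _ _ (fun t : R => t *: b) (fun z => a + z)).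
  exact: scalel_continuous.
exact: addl_continuous.
Qed.

(** An interior point of a segment of the closure cannot lie on the boundary:
    the two halves of the segment would be on the same strict side of the local
    support. Hence the points of [Omega] that [x] sees in [Omega] form a subset
    of [Omega] that is both open and closed in it. *)
Lemma segment_domain x y : Omega x -> Omega y ->
  forall t : R, 0 <= t <= 1 -> Omega (x + t *: (y - x)).
Proof.
move=> Ox Oy.
pose B := [set y | Omega y /\ forall t : R, 0 <= t <= 1 -> Omega (x + t *: (y - x))].
suff BE : B = Omega by have [] : B y by rewrite BE.
have [_ conn _] := dom; apply: conn.
- by exists x; split=> // t _; rewrite subrr scaler0 addr0.
- exists B; last first.
    apply/seteqP; split=> z; last by case.
    by move=> Bz; split; [case: Bz|].
  suff K : forall z, B z -> \forall w \near z, B w by rewrite openE => z /K.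
  move=> z [Oz Hz].
  have : \forall w \near z, `[0, 1]%classic `<=` (fun t : R => Omega (x + t *: (w - x))).
    have K := (compact_near_coveringP _).1 (@segment_compact R 0 1).
    apply: (K _ (nbhs z) (fun w (t : R) => Omega (x + t *: (w - x)))).
    move=> t /=; rewrite in_itv/= => /Hz Ot.
    have c1 : (fun p : R * 'rV[R]_n.+1 => p.1) @ filter_prod (nbhs t) (nbhs z) --> t.
      exact: cvg_fst.
    have c2 : (fun p : R * 'rV[R]_n.+1 => p.2 - x) @ filter_prod (nbhs t) (nbhs z)
        --> z - x.
      by apply: cvgB; [exact: cvg_snd|exact: cvg_cst].
    have c3 : (fun p : R * 'rV[R]_n.+1 => p.1 *: (p.2 - x)) @
        filter_prod (nbhs t) (nbhs z) --> t *: (z - x) by exact: cvgZ.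
    have c : (fun p : R * 'rV[R]_n.+1 => x + p.1 *: (p.2 - x)) @
        filter_prod (nbhs t) (nbhs z) --> x + t *: (z - x).
      by apply: cvgD; [exact: cvg_cst|exact: c3].
    exact: (c _ (open_nbhs_nbhs (conj oO Ot))).
  have Oz' : \forall w \near z, Omega w by exact: open_nbhs_nbhs.
  move=> Kz; near=> w; split; first by near: w; exact: Oz'.
  have Hw : `[0, 1]%classic `<=` (fun t : R => Omega (x + t *: (w - x))).
    by near: w; exact: Kz.
  by move=> t t01; apply: Hw; move: t01; rewrite /= ?in_itv.
- exists (closure B); first exact: closed_closure.
  apply/seteqP; split=> z; first by move=> Bz; split; [case: Bz|exact: subset_closure].
  move=> [Oz Bz]; split=> // t0 t001.
  have cl (t : R) : 0 <= t <= 1 -> closure Omega (x + t *: (z - x)).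
    move=> t01; apply: (@closure_image (fun z => x + t *: (z - x)) B).
    - apply: (@continuous_comp _ _ _ (fun z => t *: (z - x)) (fun z => x + z)).
        apply: (@continuous_comp _ _ _ (fun z => z - x) (fun z => t *: z)).
          exact: subr_continuous.
        exact: scaler_continuous.
      exact: addl_continuous.
    - by move=> w [_ Bw]; apply: subset_closure; exact: Bw.
    - exact: Bz.
  have [//|nO] := pselect (Omega (x + t0 *: (z - x))).
  exfalso; set eta := x + t0 *: (z - x) in nO.
  have be : boundary Omega eta by apply/(boundaryE dom); split=> //; exact: cl.
  have [s [k [C [s0 k0 H]]]] := local_support n0 dom sconv be.
  have [nu _ Hnu] := H eta be ltac:(by rewrite subrr normr0).
  have zx : 0 < `|z - x|.
    rewrite normr_gt0; apply: contra_notN nO => /eqP zx.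
    by rewrite /eta zx scaler0 addr0.
  have t00 : t0 != 0 by apply: contra_notN nO => /eqP E; rewrite /eta E scale0r addr0.
  have t01 : t0 != 1.
    by apply: contra_notN nO => /eqP E; rewrite /eta E scale1r addrC subrK.
  have /andP[h0 h1] := t001.
  have p0 : 0 < t0 by rewrite lt_neqAle eq_sym t00.
  have p1 : t0 < 1 by rewrite lt_neqAle t01.
  pose q := Num.min (s / 2 / `|z - x|) (Num.min t0 (1 - t0)).
  have q0 : 0 < q by rewrite !lt_min !divr_gt0//= p0 subr_gt0.
  have q1 : q <= t0 by rewrite !ge_min lexx orbT.
  have q2 : q <= 1 - t0 by rewrite !ge_min lexx !orbT.
  have q3 : q * `|z - x| < s.
    apply: (@le_lt_trans _ _ (s / 2)); last by rewrite ltr_pdivrMr// ltr_pMr// ltrDl.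
    by rewrite -ler_pdivlMr// ge_min lexx.
  have E (a : R) : x + (t0 + a) *: (z - x) - eta = a *: (z - x).
    by rewrite /eta; apply/rowP => i; rewrite !mxE; ring.
  have N (a : R) : `|a| = q -> 0 <= t0 + a <= 1 ->
      k * (q * `|z - x|) ^+ 2 <= a * dot nu (z - x).
    move=> aq ta; have := Hnu _ (cl _ ta); rewrite E normrZ aq dotZr; exact.
  have N1 := N q (gtr0_norm q0) ltac:(by apply/andP; split; lra).
  have N2 := N (- q) ltac:(by rewrite normrN gtr0_norm) ltac:(by apply/andP; split; lra).
  have : 0 < k * (q * `|z - x|) ^+ 2 by rewrite mulr_gt0// exprn_gt0// mulr_gt0.
  by rewrite mulNr in N2; lra.
Unshelve. all: by end_near. Qed.

Lemma segment_closure x y : closure Omega x -> closure Omega y ->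
  forall t : R, 0 <= t <= 1 -> closure Omega (x + t *: (y - x)).
Proof.
move=> cx cy t t01.
have c1 (a : 'rV[R]_n.+1) : continuous (fun z : 'rV[R]_n.+1 => a + t *: (z - a) : 'rV[R]_n.+1).
  move=> z; apply: (@continuous_comp _ _ _ (fun z => t *: (z - a)) (fun z => a + z)).
    apply: (@continuous_comp _ _ _ (fun z => z - a) (fun z => t *: z)).
      exact: subr_continuous.
    exact: scaler_continuous.
  exact: addl_continuous.
have H1 z : Omega z -> closure Omega (z + t *: (y - z)).
  move=> Oz; apply: (@closure_image (fun y => z + t *: (y - z)) Omega) => //.
    exact: c1.
  by move=> w Ow; apply: subset_closure; exact: segment_domain.
have E (z w : 'rV[R]_n.+1) : z + t *: (w - z) = w + (1 - t) *: (z - w).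
  by apply/rowP => i; rewrite !mxE; ring.
apply: (@closure_image (fun x => x + t *: (y - x)) Omega) => //.
have -> : (fun x => x + t *: (y - x)) = (fun x => y + (1 - t) *: (x - y)).
  by apply/funext => z; exact: E.
apply: (@continuous_comp _ _ _ (fun z => (1 - t) *: (z - y)) (fun z => y + z)).
  apply: (@continuous_comp _ _ _ (fun z => z - y) (fun z => (1 - t) *: z)).
    exact: subr_continuous.
  exact: scaler_continuous.
exact: addl_continuous.
Qed.

Lemma closure_bound : exists2 B : R, 0 < B &
  forall z, closure Omega z -> `|z| <= B.
Proof.
have /ex_strict_bound_gt0 [B B0 HB] := bdd.
exists B => // z cz.
have cl : closed [set w : 'rV[R]_n.+1 | `|w| <= B].
  rewrite (_ : mkset _ = (fun x : 'rV[R]_n.+1 => `|x|) @^-1` [set y | y <= B])//.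
  apply: closed_comp; last exact: closed_le.
  by move=> x _; exact: norm_continuous.
have sub : Omega `<=` [set w : 'rV[R]_n.+1 | `|w| <= B].
  by move=> w Ow; apply: ltW; exact: HB.
have := closure_subset sub cz.
by rewrite -((closure_id _).1 cl).
Qed.

Lemma compact_closure : compact (closure Omega).
Proof.
have [B B0 HB] := closure_bound.
apply: bounded_closed_compact; last exact: closed_closure.
by exists B; split; [exact: num_real|move=> t Bt z /HB /le_trans; apply; exact: ltW].
Qed.

Lemma compact_boundary : compact (boundary Omega).
Proof.
apply: (subclosed_compact _ compact_closure); last by move=> z [].
rewrite /boundary (interiorO dom) setDE; apply: closedI; first exact: closed_closure.
exact: open_closedC.
Qed.

(** The enclosing-ball property, uniform over the boundary. A far point is first
    brought into the local chart by shrinking the segment that joins it to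
    [eta]; compactness of the boundary makes the constants uniform. *)
Lemma global_support : exists2 C : R, 0 < C & forall eta, boundary Omega eta ->
  exists2 nu : 'rV[R]_n.+1, `|nu| <= C &
    forall z, closure Omega z -> `|z - eta| ^+ 2 <= C * dot nu (z - eta).
Proof.
have [B B0 HB] := closure_bound.
pose P (C : R) eta := 0 < C /\ (boundary Omega eta -> exists2 nu : 'rV[R]_n.+1, `|nu| <= C &
    forall z, closure Omega z -> `|z - eta| ^+ 2 <= C * dot nu (z - eta)).
suff : \forall C \near +oo, boundary Omega `<=` P C.
  have [[eta be]|nb] := pselect (exists eta, boundary Omega eta).
    move=> /filter_ex [C HC]; exists C; first by have [] := HC _ be.
    by move=> z bz; have [_] := HC z bz; apply.
  by move=> _; exists 1 => // eta be; exfalso; apply: nb; exists eta.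
have := compact_boundary; rewrite compact_near_coveringP; apply.
move=> xi bxi.
have [s [k [C [s0 k0 H]]]] := local_support n0 dom sconv bxi.
pose D := 2 * B + s.
have D0 : 0 < D by rewrite addr_gt0// mulr_gt0.
pose t := s / 2 / D.
have t0 : 0 < t by rewrite !divr_gt0.
have t1 : t <= 1 by rewrite /t ler_pdivrMr// mul1r /D; lra.
have kt : 0 < k * t by rewrite mulr_gt0.
exists ([set eta : 'rV[R]_n.+1 | `|eta - xi| < s / 2],
        [set c : R | Num.max C (k * t)^-1 < c]) => /=.
  split; first by apply: nbhs_rV_ball; rewrite divr_gt0.
  exact: nbhs_pinfty_gt (num_real _).
move=> [eta c] /= [etas]; rewrite gt_max => /andP[Cc ktc].
have c0 : 0 < c by apply: lt_trans ktc; rewrite invr_gt0.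
split=> // be; have [|nu nuC Hnu] := H eta be.
  by apply: lt_trans etas _; rewrite ltr_pdivrMr// ltr_pMr// ltrDl.
exists nu; first by rewrite (le_trans nuC)// ltW.
move=> z cz.
have ce : closure Omega eta by case: be.
have zeta : `|z - eta| <= D.
  rewrite (le_trans (ler_normB _ _))// (le_trans (lerD (HB _ cz) (HB _ ce)))//.
  by rewrite /D; lra.
have := Hnu _ (segment_closure ce cz (t := t) ltac:(by rewrite (ltW t0))).
rewrite [eta + _ - eta]addrC addKr dotZr normrZ (gtr0_norm t0) exprMn => K.
have ms : `|eta + t *: (z - eta) - xi| < s.
  rewrite -addrA [t *: _ - xi]addrC addrA (le_lt_trans (ler_normD _ _))// normrZ gtr0_norm//.
  have : t * `|z - eta| <= s / 2.
    apply: (@le_trans _ _ (t * D)); first by rewrite ler_wpM2l// ltW.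
    by rewrite /t divfK// gt_eqF.
  by lra.
have {}K := K ms.
have K2 : k * t * `|z - eta| ^+ 2 <= dot nu (z - eta).
  rewrite -(ler_pM2l t0); apply: le_trans K.
  by rewrite le_eqVlt; apply/orP; left; apply/eqP; ring.
have dnu : 0 <= dot nu (z - eta).
  by apply: le_trans K2; rewrite mulr_ge0 ?sqr_ge0// ltW.
rewrite -ler_pdivlMl// in K2; apply: (le_trans K2).
by apply: ler_wpM2r => //; exact: ltW.
Qed.

(** The closure is convex, so a point of it on the ray from [xi] through [x]
    would make the segment from [xi] to it come closer to [x]. *)
Lemma nearest_point x : ~ closure Omega x -> exists xi, [/\ boundary Omega xi,
  forall t : R, 0 < t -> ~ closure Omega (xi + t *: (x - xi)) &
  forall z, closure Omega z -> dot (x - xi) (x - xi) <= dot (x - z) (x - z)].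
Proof.
move=> ncx.
have c0 : closure Omega !=set0.
  by have [_ _ [z Oz]] := dom; exists z; exact: subset_closure.
have cf : {within closure Omega, continuous (fun z => dot (z - x) (z - x))}.
  apply: within_continuousW => z _.
  have cz : {for z, continuous (fun w : 'rV[R]_n.+1 => w - x : 'rV[R]_n.+1)}.
    exact: subr_continuous.
  exact: (@cvg_dot _ _ _ (nbhs z) _ _ _ _ _ cz cz).
have [xi] := EVT_min_rV c0 compact_closure cf; rewrite inE => cxi xmin.
have sw z : dot (z - x) (z - x) = dot (x - z) (x - z).
  by rewrite -opprB dotNl dotNr opprK.
have xm z : closure Omega z -> dot (x - xi) (x - xi) <= dot (x - z) (x - z).
  by move=> cz; rewrite -!sw; apply: xmin; rewrite inE.
have d0 : x - xi != 0.
  by rewrite subr_eq0; apply: contra_notN ncx => /eqP ->.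
have dd := dot_gt0 d0.
have out (t : R) : 0 < t -> ~ closure Omega (xi + t *: (x - xi)).
  move=> t0 ct.
  pose q := Num.min 1 t^-1.
  have q0 : 0 < q by rewrite lt_min ltr01 invr_gt0.
  have q1 : q <= 1 by rewrite ge_min lexx.
  have qt : q * t <= 1 by rewrite -ler_pdivlMr// div1r ge_min lexx orbT.
  have := xm _ (segment_closure cxi ct (t := q) ltac:(by rewrite (ltW q0))).
  rewrite [xi + t *: _ - xi]addrC addKr scalerA.
  have -> : x - (xi + (q * t) *: (x - xi)) = (1 - q * t) *: (x - xi).
    by apply/rowP => i; rewrite !mxE; ring.
  rewrite dotZl dotZr mulrA -[leLHS]mul1r ler_pM2r//.
  have : 0 < q * t by rewrite mulr_gt0.
  by move: (q * t) qt => a a1 a0; nra.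
exists xi; split=> //; apply/(boundaryE dom); split=> // Oxi.
have := @line_continuous xi (x - xi) 0; rewrite /continuous_at scale0r addr0.
move=> /(_ _ (open_nbhs_nbhs (conj oO Oxi))) => H.
have : \forall t \near (0 : R)^'+, False.
  near=> t; apply: (out t); first by near: t; exact: nbhs_right_gt.
  apply: subset_closure; near: t; exact: cvg_at_right_filter H.
by move/filter_ex => [].
Unshelve. all: by end_near. Qed.

End global_geometry.

(** * Boundary values of a solution are semi-convex *)

Section necessity.
Context {R : realType} {n : nat}.

Lemma cvg_within_comp (V : topologicalType) (E : set V) (u : V -> R)
    (T : Type) (F : set_system T) {FF : Filter F} (f : T -> V) z :
  {within E, continuous u} -> E z -> f @ F --> z -> (\forall t \near F, E (f t)) ->
  u (f t) @[t --> F] --> u z.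
Proof.
move=> /subspace_continuousP cu Ez fz Ef A HA.
have H : F [set t | E (f t) -> A (u (f t))] := fz _ (cu z Ez A HA).
suff : F [set t | A (u (f t))] by [].
exact: (@filterS2 _ F FF _ _ _ (fun t Et Ht => Ht Et) Ef H).
Qed.

Lemma vertical_arith (a b m th K d e : R) : 0 < th -> 0 <= d -> 0 <= m ->
  b - a <= m -> 0 <= e -> e <= d / th -> m / th <= K ->
  (1 - e) * a + e * b <= a + K * d.
Proof.
move=> th0 d0 m0 bam e0 ed mK.
have h1 : e * (b - a) <= e * m by rewrite ler_wpM2l.
have h2 : e * m <= d / th * m by rewrite ler_wpM2r.
have h3 : d / th * m = m / th * d by ring.
have h4 : m / th * d <= K * d by rewrite ler_wpM2r.
lra.
Qed.

Lemma half_arith (a : R) : a <= (2 * a + 1) / 2.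
Proof. lra. Qed.

(** Chords between boundary points cross the domain, so the convexity of [u]
    is used first along the tangent hyperplane at the middle point, and then
    along the last axis, where it bounds by a multiple of the distance the
    decrease of [u] from the graph down to that hyperplane.  The distance is
    quadratic in the length of the chord, whence the semi-convexity constant. *)
Lemma semi_convex_of_solution (Omega : set 'rV[R]_n.+1) phi (u : 'rV[R]_n.+1 -> R) :
  (0 < n)%N -> domain Omega -> strictly_convex Omega ->
  {within ~` Omega, continuous u} ->
  Defs.locally_convex (~` closure Omega) u ->
  (forall x : 'rV[R]_n.+1, boundary Omega x -> u x = phi x) ->
  semi_convex_wrt Omega phi.
Proof.
move=> n0 dom sconv cu lu uphi xi bxi.
have [Q [delta [h [r [k [L [rho [g [lc cc [r0 k0 L0]]]]]]]]]] :=
  convex_chart_exists n0 sconv bxi.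
have [QQ [h0 rho0] Hb Hg Hr] := cc.
have muD (z : 'rV[R]_n.+1) : ~ closure Omega z -> midconvex_at u z.
  by move=> nz; exact: midconvex_of_locally_convex lu nz.
have below (x : 'rV[R]_n) t : `|x| < r -> `|t| < h -> t < rho x ->
    ~ closure Omega (chart xi Q x t).
  move=> xr th tr /(closureE dom) [Oz|bz].
    by have [_ /(_ t th) [_ [/(_ Oz)]]] := Hb x xr; rewrite ltNge ltW.
  have [_ /(_ t th) [[/(_ bz) E _] _]] := Hb x xr.
  by rewrite E ltxx in tr.
have onb (x : 'rV[R]_n) : `|x| < r -> boundary Omega (chart xi Q x (rho x)).
  by move=> xr; have [rh /(_ _ rh) [[_ +] _]] := Hb x xr; apply.
have notO (z : 'rV[R]_n.+1) : ~ closure Omega z -> (~` Omega) z.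
  by move=> nz Oz; apply: nz; exact: subset_closure.
have notOb (z : 'rV[R]_n.+1) : boundary Omega z -> (~` Omega) z by move/(boundaryE dom) => [].
pose psi (x : 'rV[R]_n) := u (chart xi Q x (rho x)).
have near_r (x : 'rV[R]_n) : `|x| < r -> \forall y \near x, `|y| < r.
  move=> xr; have [s s0 Hs] : exists2 s : R, 0 < s & s <= r - `|x|.
    by exists (r - `|x|); rewrite ?subr_gt0.
  have := nbhs_rV_ball x s0; apply: filterS => y yx.
  rewrite -(subrK x y) (le_lt_trans (ler_normD _ _))//; lra.
have psi_cont (x : 'rV[R]_n) : `|x| < r -> {for x, continuous psi}.
  move=> xr; apply: (@cvg_within_comp _ (~` Omega) u _ (nbhs x) _
    (fun y => chart xi Q y (rho y)) (chart xi Q x (rho x)) cu); first exact/notOb/onb.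
    by apply: chart_continuous; [exact: cvg_id|exact: (Hg x xr).1].
  by have := near_r x xr; apply: filterS => y yr; exact/notOb/onb.
pose bot (x : 'rV[R]_n) := u (chart xi Q x (- (h / 2))).
have h2 : `|- (h / 2)| < h by rewrite normrN gtr0_norm; lra.
have r00 : `|0 : 'rV[R]_n| < r by rewrite normr0.
have small_rho : \forall y \near (0 : 'rV[R]_n), `|rho y| < h / 4.
  have h4 : 0 < h / 4 by rewrite divr_gt0.
  have /cvgrPdist_lt/(_ _ h4) := (Hg 0 r00).1.
  by rewrite rho0; apply: filterS => y; rewrite sub0r normrN.
have bot_cont : {for 0, continuous bot}.
  have nb0 : ~ closure Omega (chart xi Q 0 (- (h / 2))).
    by apply: below => //; rewrite rho0 oppr_lt0 divr_gt0.
  apply: (@cvg_within_comp _ (~` Omega) u _ (nbhs (0 : 'rV[R]_n)) _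
    (fun y => chart xi Q y (- (h / 2))) (chart xi Q 0 (- (h / 2))) cu);
    first exact: notO.
    by apply: chart_continuous; [exact: cvg_id|exact: cvg_cst].
  have := near_r 0 r00; apply: filterS2 small_rho => y yh yr.
  apply/notO/below => //; move: yh; rewrite ltr_norml => /andP[? ?]; lra.
have near0 (f : 'rV[R]_n -> R) : {for 0, continuous f} ->
    \forall y \near (0 : 'rV[R]_n), `|f y - f 0| <= 1.
  by move=> /cvgrPdist_le/(_ 1 ltr01); apply: filterS => y; rewrite distrC.
have [d d0 Hd] : exists2 d : R, 0 < d & forall y : 'rV[R]_n, `|y| < d ->
    [/\ `|y| < r, `|rho y| < h / 4, `|psi y - psi 0| <= 1 & `|bot y - bot 0| <= 1].
  have [d d0 Hd] : exists2 d : R, 0 < d & forall y : 'rV[R]_n, `|y - 0| < d ->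
    [/\ `|y| < r, `|rho y| < h / 4, `|psi y - psi 0| <= 1 & `|bot y - bot 0| <= 1].
    apply: near_ball_rV.
    have N1 := near_r 0 r00; have N2 := near0 _ (psi_cont 0 r00).
    have N3 := near0 _ bot_cont.
    by near=> y; split; near: y.
  by exists d => // y yd; apply: Hd; rewrite subr0.
pose m : R := `|bot 0 - psi 0| + 2.
have m0 : 0 <= m by rewrite addr_ge0.
have Hm (y : 'rV[R]_n) : `|y| < d -> bot y - psi y <= m.
  move=> /Hd [_ _]; rewrite !ler_norml => /andP[a1 a2] /andP[a3 a4].
  have := ler_norm (bot 0 - psi 0); rewrite /m; lra.
pose K1 := m / (h / 4).
have h4 : 0 < h / 4 by rewrite divr_gt0.
have K10 : 0 <= K1 by rewrite divr_ge0// ltW.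
(* On the vertical segment from depth [h / 2] up to the graph, the slope of [u]
   is controlled by its values at the two ends. *)
have vertical (y : 'rV[R]_n) t : `|y| < d -> - (h / 2) <= t -> t <= rho y ->
    u (chart xi Q y t) <= psi y + K1 * (rho y - t).
  move=> yd t1 t2; have [yr yh _ _] := Hd y yd.
  move: (yh); rewrite ltr_norml => /andP[y1 y2].
  have len0 : 0 < rho y + h / 2 by move: y1 h0; clear; lra.
  pose e := (rho y - t) / (rho y + h / 2).
  have e0 : 0 <= e by rewrite divr_ge0 ?subr_ge0// ltW.
  have e1 : e <= 1 by rewrite ler_pdivrMr// mul1r; move: t1; clear; lra.
  have pt (s : R) : (1 - s) *: chart xi Q y (rho y) + s *: chart xi Q y (- (h / 2)) =
      chart xi Q y (rho y - s * (rho y + h / 2)).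
    have -> : s = 1 - (1 - s) by ring.
    rewrite subKr -[in X in X + _](subKr 1 s).
    have := chart_line xi Q y y (rho y) (- (h / 2)) (1 - s).
    rewrite subKr => ->; congr chart; last by ring.
    by rewrite -scalerDl subrK scale1r.
  have := @segment_chord _ _ (~` Omega) u (chart xi Q y (rho y))
    (chart xi Q y (- (h / 2))) cu _ _ e _.
  rewrite pt (_ : rho y - e * _ = t); last first.
    by rewrite /e divfK ?gt_eqF//; ring.
  move=> H; apply: (le_trans (H _ _ _)).
  - move=> s /andP[s0 s1]; rewrite pt.
    have [->|sn] := eqVneq s 0; first by rewrite mul0r subr0; exact/notOb/onb.
    have sp : 0 < s by rewrite lt_neqAle eq_sym sn.
    have P1 : 0 < s * (rho y + h / 2) by rewrite mulr_gt0.
    have P2 : s * (rho y + h / 2) <= rho y + h / 2.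
      by rewrite ler_piMl// ltW.
    apply/notO/below => //; last by move: P1; clear; lra.
    rewrite ltr_norml; move: P1 P2 y1 y2 h0; clear; move=> *.
    by apply/andP; split; lra.
  - move=> s /andP[s0 s1]; rewrite pt.
    have P1 : 0 < s * (rho y + h / 2) by rewrite mulr_gt0.
    have P2 : s * (rho y + h / 2) <= rho y + h / 2.
      by rewrite ler_piMl// ltW.
    apply/muD/below => //; last by move: P1; clear; lra.
    rewrite ltr_norml; move: P1 P2 y1 y2 h0; clear; move=> *.
    by apply/andP; split; lra.
  - by rewrite e0 e1.
  - apply: (vertical_arith h4 _ m0 (Hm y yd) e0) => //; first by rewrite subr_ge0.
    rewrite /e; apply: ler_wpM2l; first by rewrite subr_ge0.
    by rewrite lef_pV2 ?posrE//; move: y1 h0; clear; lra.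
(* The chord in the tangent hyperplane touches the boundary at its middle point,
   so it is lowered by [e], and [e] tends to 0. *)
have tangent (x w : 'rV[R]_n) : `|x| < d -> `|x + w| < d -> `|x - w| < d ->
    `|dot (g x) w| < h / 8 ->
    psi x <= 2^-1 * (psi (x - w) + psi (x + w)) + K1 * L * `|w| ^+ 2.
  move=> xd xpd xmd gw.
  have [xr xh _ _] := Hd x xd.
  set q := dot (g x) w in gw.
  move: (gw); rewrite ltr_norml => /andP[g1 g2].
  move: (xh); rewrite ltr_norml => /andP[y1 y2].
  have key (e : R) : 0 < e -> e < h / 8 ->
      u (chart xi Q x (rho x - e)) <=
      2^-1 * (psi (x - w) + psi (x + w)) + K1 * L * `|w| ^+ 2 + K1 * e.
    move=> e0 e8.
    have pt (s : R) : (1 - s) *: chart xi Q (x - w) (rho x - q - e) +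
        s *: chart xi Q (x + w) (rho x + q - e) =
        chart xi Q (x + (2 * s - 1) *: w) (rho x + (2 * s - 1) * q - e).
      have := chart_line xi Q (x - w) (x + w) (rho x - q - e) (rho x + q - e) (1 - s).
      rewrite subKr => ->; congr chart; last by ring.
      by apply/rowP => i; rewrite !mxE; ring.
    have out (s : R) : 0 <= s <= 1 ->
        ~ closure Omega (chart xi Q (x + (2 * s - 1) *: w) (rho x + (2 * s - 1) * q - e)).
      move=> /andP[s0 s1].
      have zd : `|x + (2 * s - 1) *: w| < d.
        have := @ball_convex_rV _ _ 0 (x + w) (x - w) d.
        rewrite !subr0 => /(_ xpd xmd s s0 s1); rewrite subr0.
        rewrite (_ : s *: (x + w) + _ = x + (2 * s - 1) *: w)//.
        by apply/rowP => i; rewrite !mxE; ring.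
      have [zr zh _ _] := Hd _ zd.
      have := Hr x (x + (2 * s - 1) *: w) xr zr.
      rewrite [x + _ - x]addrC addKr dotZr -/q => /andP[Hr1 _].
      have Hr2 : 0 <= k * `|(2 * s - 1) *: w| ^+ 2 by rewrite mulr_ge0 ?sqr_ge0// ltW.
      have aq : `|(2 * s - 1) * q| <= h / 8.
        have sn : `|2 * s - 1| <= 1.
          by rewrite ler_norml; move: s0 s1; clear; move=> *; apply/andP; split; lra.
        by rewrite normrM -[h / 8]mul1r ler_pM// ltW.
      move: aq; rewrite ler_norml => /andP[a1 a2].
      apply: below => //; last by move: Hr1 Hr2 e0; clear; lra.
      rewrite ltr_norml; move: y1 y2 a1 a2 e0 e8; clear; move=> *.
      by apply/andP; split; lra.
    have := @segment_chord _ _ (~` Omega) u (chart xi Q (x - w) (rho x - q - e))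
      (chart xi Q (x + w) (rho x + q - e)) cu _ _ 2^-1 _.
    rewrite pt (_ : 2 * 2^-1 - 1 = 0); last by field.
    rewrite scale0r addr0 mul0r addr0 => H; apply: (le_trans (H _ _ _)).
    - by move=> s s01; rewrite pt; exact/notO/out.
    - move=> s /andP[s0 s1]; rewrite pt; apply/muD/out.
      by rewrite !ltW.
    - by rewrite invr_ge0 ler0n invf_le1 ?ler1n.
    have [xpr _ _ _] := Hd _ xpd; have [xmr _ _ _] := Hd _ xmd.
    have := Hr x (x + w) xr xpr.
    rewrite [x + w - x]addrC addKr -/q => /andP[Hp1 Hp2].
    have := Hr x (x - w) xr xmr.
    rewrite [x - w - x]addrC addKr dotNr normrN -/q => /andP[Hq1 Hq2].
    have W0 : 0 <= k * `|w| ^+ 2 by rewrite mulr_ge0 ?sqr_ge0// ltW.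
    have V1 : u (chart xi Q (x + w) (rho x + q - e)) <=
        psi (x + w) + K1 * (L * `|w| ^+ 2 + e).
      apply: (le_trans (vertical _ _ xpd _ _)).
      - by move: y1 g1 e8 h0; clear; lra.
      - by move: Hp1 W0 e0; clear; lra.
      - by rewrite lerD2l ler_wpM2l//; move: Hp2; clear; lra.
    have V2 : u (chart xi Q (x - w) (rho x - q - e)) <=
        psi (x - w) + K1 * (L * `|w| ^+ 2 + e).
      apply: (le_trans (vertical _ _ xmd _ _)).
      - by move: y1 g2 e8 h0; clear; lra.
      - by move: Hq1 W0 e0; clear; lra.
      - by rewrite lerD2l ler_wpM2l//; move: Hq2; clear; lra.
    rewrite (_ : 1 - 2^-1 = 2^-1); last by clear; lra.
    have -> : 2^-1 * (psi (x - w) + psi (x + w)) + K1 * L * `|w| ^+ 2 + K1 * e =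
      2^-1 * (psi (x - w) + K1 * (L * `|w| ^+ 2 + e)) +
      2^-1 * (psi (x + w) + K1 * (L * `|w| ^+ 2 + e)) by field.
    by apply: lerD; rewrite ler_pM2l ?invr_gt0.
  have c1 : u (chart xi Q x (rho x - e)) @[e --> (0 : R)^'+] --> psi x.
    apply: (@cvg_within_comp _ (~` Omega) u _ (0 : R)^'+ _
      (fun e => chart xi Q x (rho x - e)) (chart xi Q x (rho x)) cu);
      first exact/notOb/onb.
      apply: chart_continuous; first exact: cvg_cst.
      rewrite -[X in _ --> X]subr0; apply: cvgB; first exact: cvg_cst.
      exact: cvg_at_right_filter cvg_id.
    near=> e; have e0 : 0 < e by near: e; exact: nbhs_right_gt.
    have e8 : e < h / 8 by near: e; apply: nbhs_right_lt; rewrite divr_gt0.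
    apply/notO/below => //; last by move: e0; clear; lra.
    rewrite ltr_norml; move: y1 y2 e0 e8; clear; move=> *.
    by apply/andP; split; lra.
  have c2 : 2^-1 * (psi (x - w) + psi (x + w)) + K1 * L * `|w| ^+ 2 + K1 * e
      @[e --> (0 : R)^'+] -->
      2^-1 * (psi (x - w) + psi (x + w)) + K1 * L * `|w| ^+ 2 + K1 * 0.
    apply: cvgD; first exact: cvg_cst.
    apply: cvgM; first exact: cvg_cst.
    exact: cvg_at_right_filter cvg_id.
  have := cvg_le_lims c1 c2; rewrite mulr0 addr0; apply.
  have h8 : 0 < h / 8 by rewrite divr_gt0.
  near=> e; apply: key; first by near: e; exact: nbhs_right_gt.
  by near: e; exact: nbhs_right_lt.
have dr : d <= r.
  rewrite leNgt; apply/negP => rd.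
  have [x xE] : exists x : 'rV[R]_n, `|x| = r.
    exists (const_mx r); apply/eqP; rewrite eq_le; apply/andP; split.
      by apply: norm_leP => [|i]; rewrite ?mxE ?gtr0_norm// ltW.
    by have := le_coord_norm (const_mx r : 'rV[R]_n) (Ordinal n0); rewrite mxE gtr0_norm.
  by have [] := Hd x; rewrite xE// ltxx.
exists Q, d, rho; split.
  split=> //; exists h => // x /eball_norm; rewrite subr0 => xd.
  by apply: Hb; exact: lt_le_trans dr.
pose K := 2 * (K1 * L) + 1.
have KL : 0 <= K1 * L by rewrite mulr_ge0// ltW.
have K0 : 0 < K by rewrite ltr_wpDl// mulr_ge0.
exists K => //; apply/convex_functionP.
pose Psi (x : 'rV[R]_n) := psi x + K / 2 * dot x x.
have phiE x : eball 0 d x ->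
    phi (chart xi Q x (rho x)) + K / 2 * enorm x ^+ 2 = Psi x.
  move=> /eball_norm; rewrite subr0 => xd; have [xr _ _ _] := Hd x xd.
  by rewrite -(uphi _ (onb x xr)) /Psi /enorm sqr_sqrtr// dot_ge0.
suff C : cvx (eball 0 d) Psi.
  move=> x y Ex Ey t t0 t1; rewrite !phiE//; first exact: C.
  exact: eball_convex.
apply: (@cvx_ball_of_midconvex _ _ (eball 0 d)) => //; last first.
- by move=> a b; exact: eball_convex.
- move=> x Ex; have xd : `|x| < d by move/eball_norm : (Ex); rewrite subr0.
  suff : \forall w \near (0 : 'rV[R]_n), Psi x <= 2^-1 * (Psi (x - w) + Psi (x + w)).
    by [].
  have Nd : \forall z \near x, `|z| < d.
    have := @open_eball _ _ (0 : 'rV[R]_n) d; rewrite openE => /(_ x Ex).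
    by apply: filterS => z /eball_norm; rewrite subr0.
  have Ng : \forall w \near (0 : 'rV[R]_n), `|dot (g x) w| < h / 8.
    have h8 : 0 < h / 8 by rewrite divr_gt0.
    have /cvgrPdist_lt/(_ _ h8) := @dot_continuous _ _ (g x) 0.
    by rewrite dot0r; apply: filterS => w; rewrite sub0r normrN.
  apply: filterS2 Ng (near_add_opp Nd) => w wg [wp wm].
  have := tangent x w xd wp wm wg.
  have E : 2^-1 * (dot (x - w) (x - w) + dot (x + w) (x + w)) = dot x x + dot w w.
    by rewrite !(dotDl, dotDr, dotNl, dotNr) (dotC w x); field.
  have W : K1 * L * `|w| ^+ 2 <= K / 2 * dot w w.
    apply: (@le_trans _ _ (K1 * L * dot w w)).
      by rewrite ler_wpM2l ?norm_sqr_le_dot// mulr_ge0// ltW.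
    by apply: ler_wpM2r; [exact: dot_ge0|exact: half_arith].
  have -> : 2^-1 * (Psi (x - w) + Psi (x + w)) =
     2^-1 * (psi (x - w) + psi (x + w)) +
     K / 2 * (2^-1 * (dot (x - w) (x - w) + dot (x + w) (x + w))).
    by rewrite /Psi; ring.
  rewrite E /Psi => T; apply: (@le_trans _ _ (2^-1 * (psi (x - w) + psi (x + w)) +
     K1 * L * `|w| ^+ 2 + K / 2 * dot x x)); first by rewrite lerD2r.
  by rewrite (mulrDr (K / 2)) [K / 2 * dot x x + _]addrC addrA lerD2r lerD2l.
- move=> x /eball_norm; rewrite subr0 => xd; have [xr _ _ _] := Hd x xd.
  apply: (@cvgD _ _ _ (nbhs x) _ psi); first exact: psi_cont.
  apply: (@cvgM _ _ (nbhs x) _ (fun=> K / 2)); first exact: cvg_cst.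
  exact: (@cvg_dot _ _ _ (nbhs x) _ id id x x cvg_id cvg_id).
Unshelve. all: by end_near. Qed.

End necessity.

(** * Barriers of prescribed quadratic part at the boundary *)

Section boundary_data.
Context {R : realType} {n : nat}.
Variable (Omega : set 'rV[R]_n.+1) (phi : 'rV[R]_n.+1 -> R).
Implicit Types (xi eta z : 'rV[R]_n.+1).

(** In the chart, [phi] plus a multiple of the square of the norm is convex and
    has a subgradient; it becomes [p] when extended by 0 along the last axis. *)
Lemma semi_convex_local xi : boundary Omega xi -> semi_convex_at Omega phi xi ->
  exists s C : R, [/\ 0 < s, 0 < C & forall eta, boundary Omega eta ->
    `|eta - xi| < s -> exists2 p : 'rV[R]_n.+1, `|p| <= C &
      forall z, boundary Omega z -> `|z - xi| < s ->
        phi eta + dot p (z - eta) - C * `|z - eta| ^+ 2 <= phi z].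
Proof.
move=> bxi [Q [delta [rho [[QQ d0 rho0 [h h0 Hh]] [K K0 /convex_functionP cF]]]]].
pose F (x : 'rV[R]_n) := phi (chart xi Q x (rho x)) + K / 2 * enorm x ^+ 2.
have [r0 r00 Hr0] := @norm_eball _ n delta d0.
have E0 (x : 'rV[R]_n) : `|x| < r0 -> eball 0 delta x.
  by move=> xr; have := Hr0 0 x; rewrite subr0; apply.
have cF0 : cvx [set x : 'rV[R]_n | `|x| < r0] F.
  by move=> x y /E0 Ex /E0 Ey; exact: cF.
have [r1 [M [r10 HM]]] := cvx_bounded_above r00 cF0.
pose r := Num.min r0 r1.
have rp : 0 < r by rewrite lt_min r00.
have rr (x : 'rV[R]_n) : `|x| < r -> `|x| < r0 /\ `|x| < r1.
  by rewrite lt_min => /andP.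
have cFr : cvx [set x : 'rV[R]_n | `|x - 0| < r] F.
  move=> x y /=; rewrite !subr0 => /rr [x0 _] /rr [y0 _]; exact: cF0.
have MFr (x : 'rV[R]_n) : `|x - 0| < r -> F x <= M.
  by rewrite subr0 => /rr [_]; exact: HM.
have lowF (x : 'rV[R]_n) : `|x| < r / 2 -> 2 * F 0 - M <= F x.
  move=> xr; have := cvx_lip_center rp cFr MFr (x := x); rewrite subr0 => /(_ xr).
  have F0M : F 0 <= M by apply: MFr; rewrite subrr normr0.
  have : `|x| * (2 * (M - F 0) / r) <= r / 2 * (2 * (M - F 0) / r).
    by apply: ler_wpM2r; [rewrite divr_ge0 ?mulr_ge0 ?subr_ge0// ltW|exact: ltW].
  have -> : r / 2 * (2 * (M - F 0) / r) = M - F 0 by field; rewrite gt_eqF.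
  rewrite ler_norml => H1 /andP[H2 _]; lra.
pose P := 2 * (M - (2 * F 0 - M)) / (r / 2).
have r4 : 0 < Num.min (r / 4) h by rewrite lt_min divr_gt0.
have [s s0 Hs] := chart_near xi Q r4.
have [CQ CQ0 HCQ] := norm_mulmx_le Q.
have [CT CT0 HCT] := norm_mulmx_le Q^T.
have F0M : F 0 <= M by apply: MFr; rewrite subrr normr0.
have P0 : 0 <= P.
  rewrite /P; apply: divr_ge0; last by rewrite divr_ge0// ltW.
  by rewrite mulr_ge0//; lra.
pose C := CQ * (P + K * r) + K / 2 * (n%:R * CT ^+ 2) + 1.
have P1 : 0 <= CQ * (P + K * r).
  by rewrite mulr_ge0 ?(ltW CQ0)// addr_ge0// mulr_ge0// ltW.
have P2 : 0 <= K / 2 * (n%:R * CT ^+ 2).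
  by rewrite mulr_ge0 ?mulr_ge0 ?sqr_ge0// ?invr_ge0// ltW.
exists s, C; split=> //; first by rewrite ltr_wpDl// addr_ge0.
have coord z : boundary Omega z -> `|z - xi| < s ->
    `|cbase xi Q z| < r / 4 /\
    phi z = F (cbase xi Q z) - K / 2 * dot (cbase xi Q z) (cbase xi Q z).
  move=> bz zs; have [] := Hs z zs; rewrite !lt_min => /andP[xr _] /andP[_ th].
  split=> //.
  have xr0 : `|cbase xi Q z| < r by lra.
  have [_ /(_ _ th)] := Hh _ (E0 _ (rr _ xr0).1).
  rewrite (chartK xi QQ) => -[[/(_ bz) E _] _].
  by rewrite /F -E (chartK xi QQ) /enorm sqr_sqrtr ?dot_ge0// addrK.
move=> eta be etas; have [xr phix] := coord eta be etas.
set x := cbase xi Q eta in xr phix.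
have r2 : 0 < r / 2 by rewrite divr_gt0.
have sub (y : 'rV[R]_n) : `|y - x| < r / 2 -> `|y| < r.
  by move=> yx; rewrite -(subrK x y) (le_lt_trans (ler_normD _ _))//; lra.
have cFx : cvx [set y : 'rV[R]_n | `|y - x| < r / 2] F.
  move=> a b /= /sub /rr [a0 _] /sub /rr [b0 _]; exact: cF0.
have MFx (y : 'rV[R]_n) : `|y - x| < r / 2 -> F y <= M.
  by move=> /sub /rr [_]; exact: HM.
have [p pP Hp] := cvx_subgradient r2 cFx MFx.
have xr2 : `|x| < r / 2 by lra.
have {}pP : `|p| <= P.
  apply: (le_trans pP); rewrite /P ler_wpM2r ?invr_ge0 ?(ltW r2)//.
  by have := lowF x xr2; clear; lra.
pose p' := p - K *: x.
have p'P : `|p'| <= P + K * r.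
  apply: (le_trans (ler_normB _ _)); apply: lerD => //.
  by rewrite normrZ gtr0_norm// ler_wpM2l ?(ltW K0)//; lra.
exists (rjoin p' 0 *m Q).
  apply: (le_trans (HCQ _)); apply: (@le_trans _ _ (CQ * (P + K * r))); last first.
    by rewrite /C -addrA lerDl addr_ge0.
  rewrite ler_wpM2l ?(ltW CQ0)// (le_trans (norm_rjoin _ _))// normr0 addr0//.
move=> z bz zs; have [yr phiz] := coord z bz zs.
set y := cbase xi Q z in yr phiz.
have yx : `|y - x| < r / 2.
  by rewrite (le_lt_trans (ler_normB _ _))//; move: xr yr; clear; lra.
have zE : (z - eta) *m Q^T = rjoin (y - x) (ctop xi Q z - ctop xi Q eta).
  rewrite -{1}(chartK xi QQ z) -{1}(chartK xi QQ eta) chartB -mulmxA QQ mulmx1//.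
have -> : dot (rjoin p' 0 *m Q) (z - eta) = dot p' (y - x).
  by rewrite dot_mulmxl zE dot_rjoin mul0r addr0.
have D1 : dot (y - x) (y - x) <= n%:R * CT ^+ 2 * `|z - eta| ^+ 2.
  apply: (le_trans (dot_le_norm_sqr _)); rewrite -mulrA ler_wpM2l// -exprMn.
  rewrite ler_pXn2r ?nnegrE ?mulr_ge0 ?(ltW CT0)//.
  apply: le_trans (HCT _); rewrite zE -[y - x in leLHS](rbaseK _ (ctop xi Q z - ctop xi Q eta)).
  exact: norm_rbase.
have := Hp y yx; rewrite phix phiz.
have -> : dot p' (y - x) = dot p (y - x) - K * dot x (y - x).
  by rewrite /p' dotBl dotZl.
have E2 : dot y y = dot x x + 2 * dot x (y - x) + dot (y - x) (y - x).
  by rewrite !(dotDr, dotDl, dotNr, dotNl) (dotC y x); ring.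
have D2 : K / 2 * dot (y - x) (y - x) <= C * `|z - eta| ^+ 2.
  apply: (@le_trans _ _ (K / 2 * (n%:R * CT ^+ 2) * `|z - eta| ^+ 2)).
    by rewrite -[leRHS]mulrA; apply: ler_wpM2l => //; rewrite divr_ge0// ltW.
  rewrite ler_wpM2r ?sqr_ge0// /C [CQ * _ + _]addrC -addrA lerDl addr_ge0//.
rewrite E2; move: D2; move: (C * _) (F y) (F x) (dot p _) (dot x x) (dot x _) (dot _ _).
by clear; move=> a1 a2 a3 a4 a5 a6 a7 *; lra.
Qed.

(** The inequality of [semi_convex_local] is used with either point as the base
    point. *)
Lemma semi_convex_lipschitz xi : boundary Omega xi -> semi_convex_at Omega phi xi ->
  exists s C : R, [/\ 0 < s, 0 < C & forall z, boundary Omega z -> `|z - xi| < s ->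
    `|phi z - phi xi| <= C * `|z - xi|].
Proof.
move=> bxi /(semi_convex_local bxi) [s [C [s0 C0 H]]].
pose L := n.+1%:R * C + C * s.
have L0 : 0 < L by rewrite addr_gt0// mulr_gt0.
exists s, L; split=> // z bz zs.
have key a c : boundary Omega a -> boundary Omega c -> `|a - xi| < s ->
    `|c - xi| < s -> `|c - a| < s -> - (L * `|c - a|) <= phi c - phi a.
  move=> ba bc as' cs ca; have [p pC Hp] := H a ba as'.
  have := Hp c bc cs.
  have D1 : `|dot p (c - a)| <= n.+1%:R * C * `|c - a|.
    apply: (le_trans (norm_dot_le _ _)); apply: ler_wpM2r => //.
    exact: ler_wpM2l.
  have D2 : C * `|c - a| ^+ 2 <= C * s * `|c - a|.
    rewrite expr2 mulrA; apply: ler_wpM2r => //; apply: ler_wpM2l; exact: ltW.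
  move: D1; rewrite ler_norml /L mulrDl => /andP[D1 _].
  by move: D1 D2; move: (n.+1%:R * C * _) (C * `|c - a| ^+ 2) => *; lra.
have xs : `|xi - xi| < s by rewrite subrr normr0.
have zs' : `|xi - z| < s by rewrite distrC.
have k1 := key xi z bxi bz xs zs zs.
have k2 := key z xi bz bxi zs xs zs'.
rewrite distrC in k2; rewrite ler_norml; apply/andP; split; first exact: k1.
by move: k2; move: (L * _) => *; lra.
Qed.

End boundary_data.

Section barrier.
Context {R : realType} {n : nat}.
Variable (Omega : set 'rV[R]_n.+1) (phi : 'rV[R]_n.+1 -> R).
Hypothesis n0 : (0 < n)%N.
Hypothesis dom : domain Omega.
Hypothesis bdd : bounded_set Omega.
Hypothesis sconv : strictly_convex Omega.
Hypothesis sphi : semi_convex_wrt Omega phi.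
Implicit Types (xi eta z : 'rV[R]_n.+1).

(** Compactness of the boundary: a property that holds near each point for all
    large constants holds everywhere for one constant. *)
Lemma cover_boundary (P : R -> 'rV[R]_n.+1 -> Prop) :
  (forall xi, boundary Omega xi -> exists s C : R, 0 < s /\
     forall eta c, boundary Omega eta -> `|eta - xi| < s -> C < c -> P c eta) ->
  exists2 C : R, 0 < C & forall eta, boundary Omega eta -> P C eta.
Proof.
move=> H.
suff K : \forall c \near +oo, boundary Omega `<=` (fun eta => boundary Omega eta -> P c eta).
  have : \forall c \near (+oo : set_system R), 0 < c /\
      (boundary Omega `<=` (fun eta => boundary Omega eta -> P c eta)).
    by near=> c; split; near: c; [exact: nbhs_pinfty_gt|exact: K].
  by move=> /filter_ex [c [c0 Hc]]; exists c => // eta be; exact: Hc.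
have cK := (compact_near_coveringP _).1 (compact_boundary dom bdd).
apply: (cK _ _ (fun c eta => boundary Omega eta -> P c eta)).
move=> xi bxi; have [s [C [s0 HC]]] := H xi bxi.
exists ([set eta : 'rV[R]_n.+1 | `|eta - xi| < s], [set c : R | C < c]) => /=.
  by split; [exact: nbhs_rV_ball|exact: nbhs_pinfty_gt (num_real _)].
by move=> [eta c] /= [es Cc] be; exact: HC.
Unshelve. all: by end_near. Qed.

Lemma phi_bounded : exists2 B : R, 0 < B & forall z, boundary Omega z -> `|phi z| <= B.
Proof.
apply: cover_boundary => xi bxi.
have [s [C [s0 C0 H]]] := semi_convex_lipschitz bxi (sphi bxi).
exists s, (`|phi xi| + C * s); split=> // z c bz zs /ltW; apply: le_trans.
rewrite -(subrK (phi xi) (phi z)) addrC (le_trans (ler_normD _ _))// lerD2l.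
by rewrite (le_trans (H z bz zs))// ler_wpM2l ?ltW.
Qed.

Lemma far_arith (f1 f2 B d a1 a2 a3 a4 : R) :
  d <= a1 -> 2 * B <= a2 -> a3 + (a2 + a1) <= a4 -> 0 <= a3 -> f1 <= B -> - B <= f2 ->
  f1 + d - a4 <= f2.
Proof. lra. Qed.

Lemma barrier_arith (f d l q a1 a2 : R) :
  a1 + a2 <= l -> q <= a2 -> 0 <= a2 -> f + (d - l) + 2^-1 * q <= f + d - a1.
Proof. lra. Qed.

(** Beyond a fixed distance the quadratic term absorbs the bound on [phi]. *)
Lemma phi_support : exists2 C : R, 0 < C & forall eta, boundary Omega eta ->
  exists2 p : 'rV[R]_n.+1, `|p| <= C & forall z, boundary Omega z ->
    phi eta + dot p (z - eta) - C * `|z - eta| ^+ 2 <= phi z.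
Proof.
have [B B0 HB] := phi_bounded.
apply: cover_boundary => xi bxi.
have [s [C [s0 C0 H]]] := semi_convex_local bxi (sphi bxi).
have s2 : 0 < s / 2 by rewrite divr_gt0.
pose q := s / 2.
pose C1 := C + (2 * B / q ^+ 2 + n.+1%:R * C / q).
exists (s / 2), C1; split=> // eta c be es cC1.
have Q1 : 0 <= 2 * B / q ^+ 2 by rewrite divr_ge0 ?sqr_ge0 ?mulr_ge0// ltW.
have Q2 : 0 <= n.+1%:R * C / q by rewrite divr_ge0 ?mulr_ge0// ltW.
have es' : `|eta - xi| < s by lra.
have [p pC Hp] := H eta be es'.
exists p; first by rewrite (le_trans pC)// ltW// (le_lt_trans _ cC1)// lerDl addr_ge0.
move=> z bz; have [zs|zs] := ltP `|z - xi| s.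
  apply: le_trans (Hp z bz zs); rewrite lerD2l lerN2 ler_wpM2r ?sqr_ge0//.
  by rewrite ltW// (le_lt_trans _ cC1)// lerDl addr_ge0.
have qd : q <= `|z - eta|.
  have := ler_normD (z - eta) (eta - xi); rewrite addrA subrK.
  by rewrite /q; lra.
have D1 : dot p (z - eta) <= n.+1%:R * C * `|z - eta|.
  apply: (le_trans (ler_norm _)); apply: (le_trans (norm_dot_le _ _)).
  by apply: ler_wpM2r => //; exact: ler_wpM2l.
have {}D1 : dot p (z - eta) <= n.+1%:R * C / q * `|z - eta| ^+ 2.
  apply: (le_trans D1).
  have -> : n.+1%:R * C * `|z - eta| = n.+1%:R * C / q * (q * `|z - eta|).
    by field; rewrite gt_eqF.
  by rewrite ler_wpM2l// expr2 ler_wpM2r.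
have D2 : 2 * B <= 2 * B / q ^+ 2 * `|z - eta| ^+ 2.
  rewrite mulrAC ler_pdivlMr ?exprn_gt0// ler_wpM2l ?mulr_ge0 ?(ltW B0)//.
  by rewrite ler_pXn2r ?nnegrE ?(ltW s2).
have D3 : C1 * `|z - eta| ^+ 2 <= c * `|z - eta| ^+ 2.
  by rewrite ler_wpM2r ?sqr_ge0// ltW.
have D4 : 0 <= C * `|z - eta| ^+ 2 by rewrite mulr_ge0 ?sqr_ge0// ltW.
have := HB z bz; have := HB eta be; rewrite !ler_norml => /andP[_ b1] /andP[b2 _].
rewrite /C1 (mulrDl C) (mulrDl (2 * B / _)) in D3.
exact: (far_arith D1 D2 D3 D4 b1 b2).
Qed.

(** Where the enclosing-ball property is steep enough to absorb both the
    semi-convexity constant and the form [A]. *)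
Lemma quadratic_barrier (A : 'M[R]_n.+1) : exists2 C : R, 0 < C &
  forall eta, boundary Omega eta -> exists2 p : 'rV[R]_n.+1, `|p| <= C &
    forall z, boundary Omega z ->
      phi eta + dot p (z - eta) + 2^-1 * qf A (z - eta) <= phi z.
Proof.
have [C1 C10 H1] := phi_support.
have [C2 C20 H2] := global_support n0 dom bdd sconv.
have [a a0 Ha] := bf_le A.
pose L := C2 * (C1 + a).
have L0 : 0 < L by rewrite mulr_gt0// addr_gt0.
exists (C1 + L * C2); first by rewrite addr_gt0// mulr_gt0.
move=> eta be; have [p pC Hp] := H1 eta be; have [nu nuC Hnu] := H2 eta be.
exists (p - L *: nu).
  by rewrite (le_trans (ler_normB _ _))// lerD// normrZ gtr0_norm// ler_wpM2l// ltW.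
move=> z bz; have cz : closure Omega z by case: bz.
apply: le_trans (Hp z bz); rewrite dotBl dotZl.
have K1 : (C1 + a) * `|z - eta| ^+ 2 <= L * dot nu (z - eta).
  have -> : L * dot nu (z - eta) = (C1 + a) * (C2 * dot nu (z - eta)).
    by rewrite /L; ring.
  by rewrite ler_wpM2l ?Hnu// addr_ge0// ltW.
have K2 : qf A (z - eta) <= a * `|z - eta| ^+ 2.
  by rewrite expr2 mulrA; apply: (le_trans (ler_norm _)); exact: Ha.
have K3 : 0 <= a * `|z - eta| ^+ 2 by rewrite mulr_ge0 ?sqr_ge0// ltW.
by rewrite (mulrDl C1) in K1; exact: (barrier_arith _ _ K1 K2 K3).
Qed.

End barrier.

(** * A subsolution asymptotic to a paraboloid *)

Section subsolutions.
Context {R : realType} {n : nat}.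
Implicit Types (x y h b : 'rV[R]_n) (A : 'M[R]_n) (a c s : R).

(** In the variable [w = z ^ 4 - 1] the right-hand side is the expansion of
    [(1 + w) ^ (-1/4)], whose second coefficient [5/32] is rounded up to [1/6]. *)
Lemma inv_le_quartic (z : R) : 59 / 60 <= z ->
  z^-1 <= 1 - (z ^+ 4 - 1) / 4 + (z ^+ 4 - 1) ^+ 2 / 6.
Proof.
move=> z1; have z0 : 0 < z by lra.
rewrite -(ler_pM2l z0) divff ?gt_eqF// -subr_ge0.
pose e := z - 1; have e1 : - (1 / 60) <= e by rewrite /e; lra.
have -> : z * (1 - (z ^+ 4 - 1) / 4 + (z ^+ 4 - 1) ^+ 2 / 6) - 1 =
    e ^+ 2 * ((1 + 49 * e) / 6 + e ^+ 2 * (217 + 245 * e) / 12 +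
      e ^+ 4 * (14 + 6 * e) + e ^+ 6 * (9 + e) / 6) by rewrite /e; field.
have p2 k : 0 <= e ^+ (2 * k) by rewrite exprM exprn_ge0// sqr_ge0.
have := (p2 1%N, p2 2%N, p2 3%N); rewrite !muln1 => -[[q1 q2] q3].
have h1 : 0 <= (1 + 49 * e) / 6 by lra.
have h2 : 0 <= (217 + 245 * e) / 12 by lra.
have h3 : 0 <= 14 + 6 * e by lra.
have h4 : 0 <= (9 + e) / 6 by lra.
rewrite -!(mulrA (e ^+ _)); apply: mulr_ge0; first exact: q1.
apply: addr_ge0; last exact: mulr_ge0 q3 h4.
apply: addr_ge0; last exact: mulr_ge0 q2 h3.
by apply: addr_ge0; [exact: h1|exact: mulr_ge0 q1 h2].
Qed.

Definition quarter s : R := Num.sqrt (Num.sqrt s).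

Lemma quarter_ge0 s : 0 <= quarter s.
Proof. exact: sqrtr_ge0. Qed.

Lemma quarterX4 s : 0 <= s -> quarter s ^+ 4 = s.
Proof.
by move=> s0; rewrite (exprM _ 2 2) sqr_sqrtr ?sqrtr_ge0// sqr_sqrtr.
Qed.

(** The fourth root of the form [A], i.e. the square root of the [A]-length. *)
Definition radius A x : R := quarter (qf A x).

Lemma posdef_ge0 A x : posdef A -> 0 <= qf A x.
Proof.
move=> [_ pA]; have [->|x0] := eqVneq x 0; first by rewrite qf0.
by rewrite ltW// pA.
Qed.

Lemma radiusX4 A x : posdef A -> radius A x ^+ 4 = qf A x.
Proof. by move=> pA; rewrite quarterX4// posdef_ge0. Qed.

Lemma radius_continuous A : continuous (radius A).
Proof.
move=> x; apply: (@continuous_comp _ _ _ (fun x => Num.sqrt (qf A x)) Num.sqrt).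
  apply: (@continuous_comp _ _ _ (qf A) Num.sqrt); first exact: qf_continuous.
  exact: sqrt_continuous.
exact: sqrt_continuous.
Qed.

(** The Hessian of a function of [qf A] is of this shape: the square of the
    differential of [qf A] is the rank one term. *)
Lemma rank1_form A x0 (al be : R) : posdef A -> \det A = 1 -> x0 != 0 ->
  0 <= be -> be < al ->
  let M := al *: A - (be / qf A x0) *: ((x0 *m A)^T *m (x0 *m A)) in
  [/\ posdef M, \det M = al ^+ n * (1 - be / al) &
    forall h, qf M h = al * qf A h - be / qf A x0 * dot (x0 *m A) h ^+ 2].
Proof.
move=> pA dA x00 be0 beal M.
have s0 : 0 < qf A x0 by exact: pA.2.
have al0 : 0 < al by apply: le_lt_trans beal.
have qM h : qf M h = al * qf A h - be / qf A x0 * dot (x0 *m A) h ^+ 2.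
  rewrite /M qfDM qfNM !qfZM; congr (_ - _ * _).
  rewrite /qf mulmxA {1}/dot -mulmxA mxE big_ord1 -/(dot (x0 *m A) h) expr2.
  by rewrite -/(dot h (x0 *m A)) dotC.
split=> //.
- split.
    by rewrite /M linearB !linearZ /= pA.1 trmx_mul trmxK.
  move=> h h0; rewrite qM.
  have q0 : 0 < qf A h by exact: pA.2.
  have CS := bf_sqr_le h pA.1 (fun z => posdef_ge0 z pA) s0.
  have : be / qf A x0 * dot (x0 *m A) h ^+ 2 <= be * qf A h.
    rewrite -mulrA ler_wpM2l// ler_pdivrMl//.
  have : be * qf A h < al * qf A h by rewrite ltr_pM2r.
  lra.
- have -> : M = (al%:M - (be / qf A x0) *: ((x0 *m A)^T *m x0)) *m A.
    by rewrite mulmxBl mul_scalar_mx -scalemxAl -mulmxA.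
  rewrite det_mulmx dA mulr1 det_scalar_rank1 ?gt_eqF//; congr (_ * (1 - _)).
  rewrite -/(dot x0 (x0 *m A)) dotC -/(qf A x0); field.
  by rewrite !gt_eqF.
Qed.

(** [1/2 s + b.x + c - a / s^(1/4)] with [s = qf A x]. In the normalised radial
    variable the Hessian determinant is [(1+y)^(n-1) (1 - 3y/2)] with [y] of
    order [a / s^(5/4)]; it exceeds [1] for small [y] because [n >= 3]. *)
Definition outer_profile A b c a (sg : R) x : R :=
  2^-1 * qf A x + dot b x + c - a / Num.max (radius A x) sg.

Lemma outer_profile_continuous A b c a (sg : R) : 0 < sg ->
  continuous (outer_profile A b c a sg).
Proof.
move=> sg0 x.
have c1 : {for x, continuous (fun x => 2^-1 * qf A x + dot b x + c)}.
  apply: (@cvgD _ _ _ (nbhs x) _ (fun x => 2^-1 * qf A x + dot b x)); last exact: cvg_cst.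
  apply: (@cvgD _ _ _ (nbhs x) _ (fun x => 2^-1 * qf A x)); last exact: dot_continuous.
  apply: (@cvgM _ _ (nbhs x) _ (fun=> 2^-1)); [exact: cvg_cst|exact: qf_continuous].
have c2 : {for x, continuous (fun x => Num.max (radius A x) sg)}.
  apply: (@continuous_max _ _ (radius A) (fun=> sg) x); first exact: radius_continuous.
  exact: (@cst_continuous _ _ sg x).
apply: (@cvgB _ _ _ (nbhs x) _ _ _ _ _ c1).
apply: (@cvgM _ _ (nbhs x) _ (fun=> a)); first exact: cvg_cst.
by apply: (@cvgV _ _ (nbhs x)); [rewrite gt_eqF// lt_max sg0 orbT|exact: c2].
Qed.

(** The determinant is [al ^ (n-1) * (1 - 26/15 * Y)] with [al = 1 + 14/15 * Y];
    for [n = 3] the first order term is [(28 - 26) / 15 * Y > 0]. *)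
Lemma profile_det_ge1 (Y : R) : (3 <= n)%N -> 0 < Y -> Y < 1 / 20 ->
  1 <= (1 + 14 / 15 * Y) ^+ n * (1 - (8 / 3 * Y) / (1 + 14 / 15 * Y)).
Proof.
move=> n3 Y0 Y1; set al := 1 + 14 / 15 * Y.
have al1 : 1 <= al by rewrite /al; lra.
have al0 : 0 < al by lra.
have -> : al ^+ n = al ^+ (n - 3) * al ^+ 3 by rewrite -exprD subnK.
have -> : al ^+ (n - 3) * al ^+ 3 * (1 - 8 / 3 * Y / al) =
   al ^+ (n - 3) * (al ^+ 2 * (al - 8 / 3 * Y)).
  by field; rewrite gt_eqF.
rewrite -[leLHS]mulr1 ler_pM// ?exprn_ege1// /al.
rewrite expr2; have := mulr_gt0 Y0 Y0.
have : Y * Y <= 1 / 20 * Y by nra.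
have : Y * (Y * Y) <= 1 / 20 * (Y * Y) by nra.
by nra.
Qed.

Lemma profile_arith (s0 ta q bx bh c0 at1 at0 Y ell : R) : 0 < s0 -> 0 < Y ->
  0 <= q -> ta = 2 * ell + q -> 4 * ell + q <= s0 / 10 ->
  at1 <= at0 - Y * ta / 2 + Y / (3 * s0) * ta ^+ 2 ->
  2^-1 * s0 + bx + c0 - at0 + (bh + (1 + Y) * ell) +
    2^-1 * ((1 + 14 / 15 * Y) * q - 8 / 3 * Y / s0 * ell ^+ 2) <=
  2^-1 * (s0 + ta) + (bx + bh) + c0 - at1.
Proof.
move=> s00 Y0 q0 taE small H.
have T : ta ^+ 2 <= 4 * ell ^+ 2 + s0 / 10 * q.
  rewrite taE (_ : (2 * ell + q) ^+ 2 = 4 * ell ^+ 2 + (4 * ell + q) * q); last by ring.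
  by rewrite lerD2l ler_wpM2r.
have Yp : 0 <= Y / (3 * s0) by rewrite divr_ge0 ?mulr_ge0 ?ltW.
have : Y / (3 * s0) * ta ^+ 2 <= Y / (3 * s0) * (4 * ell ^+ 2 + s0 / 10 * q).
  by rewrite ler_wpM2l.
have -> : Y / (3 * s0) * (4 * ell ^+ 2 + s0 / 10 * q) =
   2^-1 * (8 / 3 * Y / s0 * ell ^+ 2) + Y * q / 30 by field; rewrite gt_eqF.
rewrite {}taE in H *; move: H.
move: (8 / 3 * Y / s0 * ell ^+ 2) (Y / (3 * s0) * _) => u v H1 H2.
lra.
Qed.

(** At [x0] the exact Hessian has the coefficients [1 + Y] and [5/2 * Y]; they are
    weakened to [1 + 14/15 * Y] and [8/3 * Y], so that the paraboloid lies below
    the profile while its determinant still exceeds 1. *)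
Lemma outer_profile_germ A b c (sg : R) x0 : (3 <= n)%N -> posdef A -> \det A = 1 ->
  0 < sg -> sg < radius A x0 ->
  germ (outer_profile A b c (sg ^+ 5 / 10) sg) x0.
Proof.
move=> n3 pA dA sg0 st; set a := sg ^+ 5 / 10; set t0 := radius A x0 in st.
have t00 : 0 < t0 by apply: lt_trans st.
have t04 : t0 ^+ 4 = qf A x0 by exact: radiusX4.
set s0 := qf A x0 in t04.
have s00 : 0 < s0 by rewrite -t04 exprn_gt0.
have a0 : 0 < a by rewrite divr_gt0// exprn_gt0.
have x00 : x0 != 0 by apply: contraTneq s00 => x0E; rewrite /s0 x0E qf0 ltxx.
pose Y := a / (2 * t0 * s0).
have Y0 : 0 < Y by rewrite divr_gt0// !mulr_gt0.
have Y1 : Y < 1 / 20.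
  rewrite /Y -t04 ltr_pdivrMr ?mulr_gt0 ?exprn_gt0// /a.
  have : sg ^+ 5 < t0 ^+ 5 by rewrite ltr_pXn2r ?nnegrE ?ltW.
  rewrite (_ : 1 / 20 * (2 * t0 * t0 ^+ 4) = t0 ^+ 5 / 10); last by field.
  by move=> H; rewrite ltr_pM2r// invr_gt0.
have be0 : 0 <= 8 / 3 * Y by rewrite mulr_ge0 ?ltW.
have beal : 8 / 3 * Y < 1 + 14 / 15 * Y by lra.
have [pM dM qM] := rank1_form pA dA x00 be0 beal.
apply: (@germ_of_touch_below _ _ _ _ (b + (1 + Y) *: (x0 *m A)) _ _ pM).
- exact: outer_profile_continuous.
- by rewrite dM; exact: profile_det_ge1.
have N1 : \forall h \near (0 : 'rV[R]_n), sg < radius A (x0 + h).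
  apply: (@near0_add _ _ x0 (fun z => sg < radius A z)).
  exact: (cvgr_gt _ (@radius_continuous A x0) _ st).
have N2 : \forall h \near (0 : 'rV[R]_n), 59 / 60 * t0 < radius A (x0 + h).
  apply: (@near0_add _ _ x0 (fun z => 59 / 60 * t0 < radius A z)).
  apply: (cvgr_gt _ (@radius_continuous A x0)).
  by rewrite -/t0; lra.
have N4 : \forall h \near (0 : 'rV[R]_n), 4 * dot (x0 *m A) h < s0 / 20.
  have H0 : dot (x0 *m A) 0 < s0 / 80 by rewrite dot0r divr_gt0.
  have H1 : \forall h \near (0 : 'rV[R]_n), dot (x0 *m A) h < s0 / 80.
    exact: (cvgr_lt _ (@dot_continuous _ _ (x0 *m A) 0) _ H0).
  near=> h; have : dot (x0 *m A) h < s0 / 80 by near: h.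
  lra.
have N5 : \forall h \near (0 : 'rV[R]_n), qf A h < s0 / 20.
  have H0 : qf A 0 < s0 / 20 by rewrite qf0 divr_gt0.
  exact: (cvgr_lt _ (@qf_continuous _ _ A 0) _ H0).
near=> h.
have h1 : sg < radius A (x0 + h) by near: h.
have h2 : 59 / 60 * t0 < radius A (x0 + h) by near: h.
have h4 : 4 * dot (x0 *m A) h < s0 / 20 by near: h.
have h5 : qf A h < s0 / 20 by near: h.
have t4 : radius A (x0 + h) ^+ 4 = qf A (x0 + h) by exact: radiusX4.
rewrite /outer_profile (max_l (ltW h1)) (max_l (ltW st)) -/t0.
set t := radius A (x0 + h) in h1 h2 t4 *.
have tp : 0 < t by apply: lt_trans h1.
rewrite qM -/s0 dotDl dotZl dotDr.
have sE : qf A (x0 + h) = s0 + (2 * dot (x0 *m A) h + qf A h).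
  by rewrite qfD ?pA.1// addrA.
rewrite sE in t4 *.
set ell := dot (x0 *m A) h in h4 t4 *; set q := qf A h in h5 t4 *.
have small : 4 * ell + q <= s0 / 10 by lra.
have q0 : 0 <= q by exact: posdef_ge0.
apply: (@profile_arith s0 (2 * ell + q) q _ _ _ _ _ Y) => //.
have zb : 59 / 60 <= t / t0 by rewrite ler_pdivlMr// ltW.
have := inv_le_quartic zb.
have -> : (t / t0) ^+ 4 - 1 = (2 * ell + q) / s0.
  have E4 : (t / t0) ^+ 4 = t ^+ 4 / t0 ^+ 4 by exact: expr_div_n.
  by rewrite E4 t4 t04; field; rewrite gt_eqF.
move=> H; have := ler_wpM2l (ltW (divr_gt0 a0 t00)) H.
have -> : a / t0 * (t / t0)^-1 = a / t by field; rewrite !gt_eqF.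
move=> /le_trans; apply; rewrite /Y le_eqVlt; apply/orP; left; apply/eqP.
by field; rewrite !gt_eqF.
Unshelve. all: by end_near. Qed.

End subsolutions.

(** * Subsolutions through a boundary point *)

Section gluing.
Context {R : realType} {n : nat}.
Implicit Types (x y h eta p b : 'rV[R]_n) (A : 'M[R]_n).

Definition paraboloid (k : R) p A eta x : R :=
  k + dot p (x - eta) + 2^-1 * qf A (x - eta).

Lemma paraboloidD k p A eta x h : A^T = A ->
  paraboloid k p A eta (x + h) =
  paraboloid k p A eta x + dot (p + (x - eta) *m A) h + 2^-1 * qf A h.
Proof.
move=> sA; rewrite /paraboloid [x + h - eta]addrAC (qfD (x - eta) h sA) (dotDr (x - eta) h) (dotDl p); lra.
Qed.

Lemma paraboloid_continuous k p A eta : continuous (paraboloid k p A eta).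
Proof.
move=> x.
have c1 := @subr_continuous R 'rV[R]_n eta x.
apply: (@cvgD _ _ _ (nbhs x) _ (fun x => k + dot p (x - eta))).
  apply: (@cvgD _ _ _ (nbhs x) _ (fun=> k)); first exact: cvg_cst.
  exact: (@continuous_comp _ _ _ (fun x => x - eta) (dot p) x c1 (@dot_continuous _ _ p _)).
apply: (@cvgM _ _ (nbhs x) _ (fun=> 2^-1)); first exact: cvg_cst.
exact: (@continuous_comp _ _ _ (fun x => x - eta) (qf A) x c1 (@qf_continuous _ _ A _)).
Qed.

Lemma paraboloid_germ k p A eta x : posdef A -> 1 <= \det A ->
  germ (paraboloid k p A eta) x.
Proof.
move=> pA dA; apply: (@germ_of_touch_below _ _ _ _ (p + (x - eta) *m A) _ _ pA dA).
  exact: paraboloid_continuous.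
by near=> h; rewrite paraboloidD// pA.1.
Unshelve. all: by end_near. Qed.

Lemma glue_arith (C sg : R) : 0 <= C -> 1 <= sg -> 20 * (7 * C + 1) < sg ^+ 2 ->
  C * (2 + 5 * sg ^+ 2) + 1 < sg ^+ 4 / 20.
Proof.
move=> C0 s1; rewrite (exprM sg 2 2).
have : 1 <= sg ^+ 2 by rewrite exprn_ege1.
move: (sg ^+ 2) => q q1 Hq.
have h1 : 20 * (7 * C + 1) * q < q ^+ 2 by rewrite expr2 ltr_pM2r//; lra.
have h2 : 0 <= C * (q - 1) by rewrite mulr_ge0// subr_ge0.
by rewrite ltr_pdivlMr//; nra.
Qed.

(** Near the domain the barrier dominates, from radius [2 sg] on the outer
    profile does; in between the maximum of the two is taken. On that annulus
    the profile gains [sg^4 / 20] on its asymptotic paraboloid, which beats the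
    barrier, affine relative to that paraboloid and hence of size [sg^2]. *)
Lemma glue A b k p eta (C sg : R) : (3 <= n)%N -> posdef A -> \det A = 1 ->
  0 <= C -> 1 <= sg -> 20 * (7 * C + 1) < sg ^+ 2 ->
  (forall x, `|paraboloid k p A eta x - (2^-1 * qf A x + dot b x)| <=
     C * (1 + radius A x ^+ 2)) ->
  let c := sg ^+ 4 / 10 - C * (1 + sg ^+ 2) - 1 in
  exists w, [/\ forall x, germ w x,
    forall x, radius A x <= sg -> w x = paraboloid k p A eta x,
    forall x, w x <= 2^-1 * qf A x + dot b x + c &
    forall x, 2 * sg <= radius A x ->
      w x = 2^-1 * qf A x + dot b x + c - sg ^+ 5 / 10 / radius A x].
Proof.
move=> n3 pA dA C0 s1 sC HD c.
have s0 : 0 < sg by apply: lt_le_trans s1.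
have key := glue_arith C0 s1 sC.
pose W := outer_profile A b c (sg ^+ 5 / 10) sg.
pose wi := paraboloid k p A eta.
have cW : continuous W by exact: outer_profile_continuous.
have cwi : continuous wi by exact: paraboloid_continuous.
have cr := @radius_continuous R n A.
have s5 : 0 < sg ^+ 5 / 10 by rewrite divr_gt0// exprn_gt0.
have s4E : sg ^+ 5 / 10 / sg = sg ^+ 4 / 10 by field; rewrite gt_eqF.
have r0 x : 0 <= radius A x by exact: quarter_ge0.
have rle x (t : R) : 0 <= t -> radius A x <= t -> radius A x ^+ 2 <= t ^+ 2.
  by move=> t0 xt; rewrite ler_pXn2r ?nnegrE.
have inner x : radius A x <= sg -> W x < wi x.
  move=> xs; have := HD x; rewrite ler_norml => /andP[H _].
  rewrite /W /outer_profile max_r// s4E /c.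
  have : C * (1 + radius A x ^+ 2) <= C * (1 + sg ^+ 2).
    by rewrite ler_wpM2l// lerD2l rle// ltW.
  by rewrite /wi; move: H; move: (paraboloid _ _ _ _ _) (C * _) (C * _) => *; lra.
have D2 x : radius A x <= 2 * sg ->
    wi x - (2^-1 * qf A x + dot b x) <= C * (1 + 4 * sg ^+ 2).
  move=> xs; have := HD x; rewrite ler_norml => /andP[_ /le_trans]; apply.
  rewrite ler_wpM2l// lerD2l (_ : 4 * sg ^+ 2 = (2 * sg) ^+ 2); last by ring.
  by rewrite rle// mulr_ge0// ltW.
have cE : c = sg ^+ 4 / 10 - (C + C * sg ^+ 2) - 1 by rewrite /c; ring.
have kE : C * (2 + 5 * sg ^+ 2) = 2 * C + 5 * (C * sg ^+ 2) by ring.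
have dE : C * (1 + 4 * sg ^+ 2) = C + 4 * (C * sg ^+ 2) by ring.
have outer x : radius A x = 2 * sg -> wi x < W x.
  move=> xs; have := D2 x; rewrite xs lexx => /(_ isT).
  rewrite /W /outer_profile xs max_l; last by rewrite ler_peMl ?ltW// ltr1n.
  have -> : sg ^+ 5 / 10 / (2 * sg) = sg ^+ 4 / 20 by field; rewrite gt_eqF.
  rewrite dE cE; rewrite kE in key; move: key.
  move: (C * sg ^+ 2) (wi x) => u v key H; lra.
have capwi x : radius A x <= 2 * sg -> wi x <= 2^-1 * qf A x + dot b x + c.
  move=> /D2; rewrite dE cE; rewrite kE in key; move: key.
  have : 0 <= sg ^+ 4 by rewrite exprn_ge0// ltW.
  have : 0 <= C * sg ^+ 2 by rewrite mulr_ge0// sqr_ge0.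
  move: (C * sg ^+ 2) (wi x) => u v u0 q0 key H; lra.
have capW x : W x <= 2^-1 * qf A x + dot b x + c.
  rewrite /W /outer_profile lerBlDr lerDl divr_ge0 ?(ltW s5)//.
  by rewrite le_max (ltW s0) orbT.
pose w x := if radius A x < 2 * sg then Num.max (wi x) (W x) else W x.
have gwi x : germ wi x by apply: paraboloid_germ => //; rewrite dA.
have gW x : sg < radius A x -> germ W x by move=> xs; exact: outer_profile_germ.
exists w; split.
- move=> x; have [xs|xs|xs] := ltgtP (radius A x) (2 * sg).
  + have N1 : \forall z \near x, radius A z < 2 * sg.
      exact: (cvgr_lt _ (cr x) _ xs).
    have [xs1|xs1] := leP (radius A x) sg.
      have N2 : \forall z \near x, W z < wi z.
        have N3 : \forall z \near x, 0 < wi z - W z.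
          have cd : {for x, continuous (fun z => wi z - W z)}.
            exact: (@cvgB _ _ _ (nbhs x) _ wi W _ _ (cwi x) (cW x)).
          have H0 : 0 < wi x - W x by rewrite subr_gt0 inner.
          exact: (cvgr_gt _ cd _ H0).
        near=> z; have : 0 < wi z - W z by near: z.
        by rewrite subr_gt0.
      apply: germ_eq (gwi x); near=> z.
      have h1 : radius A z < 2 * sg by near: z.
      have h2 : W z < wi z by near: z.
      by rewrite /w h1 max_l// ltW.
    apply: germ_eq (germ_max (gwi x) (gW x xs1)); near=> z.
    have h1 : radius A z < 2 * sg by near: z.
    by rewrite /w h1.
  + have xs1 : sg < radius A x by apply: le_lt_trans xs; rewrite ler_peMl ?ltW// ltr1n.
    have N1 : \forall z \near x, 2 * sg < radius A z.
      exact: (cvgr_gt _ (cr x) _ xs).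
    apply: germ_eq (gW x xs1); near=> z.
    have h1 : 2 * sg < radius A z by near: z.
    by rewrite /w ltNge (ltW h1).
  + have xs1 : sg < radius A x by rewrite xs ltr_pMl// ltr1n.
    have N2 : \forall z \near x, wi z < W z.
      have N3 : \forall z \near x, 0 < W z - wi z.
        have cd : {for x, continuous (fun z => W z - wi z)}.
          exact: (@cvgB _ _ _ (nbhs x) _ W wi _ _ (cW x) (cwi x)).
        have H0 : 0 < W x - wi x by rewrite subr_gt0 outer.
        exact: (cvgr_gt _ cd _ H0).
      near=> z; have : 0 < W z - wi z by near: z.
      by rewrite subr_gt0.
    apply: germ_eq (gW x xs1); near=> z.
    have h2 : wi z < W z by near: z.
    by rewrite /w (max_r (ltW h2)); case: ifP.
- move=> x xs; have x2 : radius A x < 2 * sg.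
    by apply: (le_lt_trans xs); rewrite ltr_pMl// ltr1n.
  by rewrite /w x2 max_l// ltW// inner.
- move=> x; rewrite /w; case: ifP => [/ltW xs|_]; last exact: capW.
  by rewrite ge_max capwi// capW.
- move=> x xs; rewrite /w ltNge xs /= /W /outer_profile max_l//.
  by apply: le_trans xs; rewrite ler_peMl ?ltW// ltr1n.
Unshelve. all: by end_near. Qed.

End gluing.

Section family.
Context {R : realType} {n : nat}.
Variable (Omega : set 'rV[R]_n.+1) (phi : 'rV[R]_n.+1 -> R).
Hypothesis n3 : (3 <= n.+1)%N.
Hypothesis dom : domain Omega.
Hypothesis bdd : bounded_set Omega.
Hypothesis sconv : strictly_convex Omega.
Hypothesis sphi : semi_convex_wrt Omega phi.
Variables (A : 'M[R]_n.+1) (b : 'rV[R]_n.+1).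
Hypotheses (pA : posdef A) (dA : \det A = 1).

Lemma norm_le_radius : exists2 mu : R, 0 < mu &
  forall x : 'rV[R]_n.+1, `|x| <= radius A x ^+ 2 / mu.
Proof.
have [m m0 Hm] := posdef_ge pA.
pose mu := Num.min 1 m.
have mu0 : 0 < mu by rewrite lt_min ltr01.
exists mu => // x; rewrite ler_pdivlMr//.
have h1 : 0 <= `|x| * mu by rewrite mulr_ge0// ltW.
have h2 : 0 <= radius A x ^+ 2 by exact: sqr_ge0.
rewrite -(@ler_pXn2r _ 2)// -exprM (radiusX4 x pA); apply: le_trans (Hm x).
rewrite exprMn mulrC ler_wpM2r ?sqr_ge0//.
apply: (@le_trans _ _ mu); last by rewrite ge_min lexx orbT.
by rewrite expr2 ger_pMr// ge_min lexx.
Qed.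

Lemma radius_at_infinity (T : R) : 0 <= T ->
  exists M : R, forall x : 'rV[R]_n.+1, M < enorm x -> T < radius A x.
Proof.
move=> T0; have [m m0 Hm] := posdef_ge pA.
pose K := T ^+ 4 * n.+1%:R / m.
have K0 : 0 <= K by rewrite divr_ge0 ?mulr_ge0 ?exprn_ge0// ltW.
exists (K + 1) => x Kx.
rewrite -(@ltr_pXn2r _ 4)// ?nnegrE ?quarter_ge0// radiusX4//.
apply: lt_le_trans (Hm x).
have E2 : enorm x ^+ 2 = dot x x by rewrite sqr_sqrtr// dot_ge0.
have e1 : 1 <= enorm x by lra.
have : K < dot x x.
  rewrite -E2 expr2; apply: (@lt_le_trans _ _ (enorm x)); first by lra.
  by rewrite ler_peMl// (le_trans ler01).
rewrite /K ltr_pdivrMr// => H.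
have D := dot_le_norm_sqr x.
have : dot x x * m <= n.+1%:R * `|x| ^+ 2 * m by rewrite ler_wpM2r// ltW.
move=> /(lt_le_trans H); rewrite -mulrA [T ^+ 4 * _]mulrC ltr_pM2l//.
by rewrite mulrC.
Qed.

(** The bounds on the barriers are uniform in [eta], so one radius [sg] and with
    it one constant [c] serve all of them; [sg] is also taken so large that the
    boundary lies where the glued function is the barrier. *)
Lemma subsolution_family : exists c : R, forall eta, boundary Omega eta ->
  exists w, [/\ forall x, germ w x, w eta = phi eta,
    forall z, boundary Omega z -> w z <= phi z,
    forall x, w x <= quadratic A b c x &
    forall e : R, 0 < e -> exists M : R, forall x, M < enorm x ->
      quadratic A b c x - w x <= e].
Proof.
have n0 : (0 < n)%N by case: n n3.
have [C C0 HC] := quadratic_barrier n0 dom bdd sconv sphi A.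
have [B B0 HB] := phi_bounded dom bdd sphi.
have [CB CB0 HCB] := closure_bound bdd.
have [CA CA0 HCA] := bf_le A.
have [CM CM0 HCM] := norm_mulmx_le A.
have [mu mu0 Hmu] := norm_le_radius.
pose c1 : R := B + n.+1%:R * C * CB + CA * CB * CB.
pose c2 : R := C + CM * CB + `|b|.
pose C3 : R := c1 + n.+1%:R * c2 / mu.
have c10 : 0 <= c1 by rewrite /c1 !addr_ge0 ?mulr_ge0 ?(ltW B0) ?(ltW C0) ?(ltW CA0) ?(ltW CB0).
have c20 : 0 <= c2 by rewrite /c2 !addr_ge0 ?mulr_ge0 ?(ltW C0) ?(ltW CM0) ?(ltW CB0).
have c2m : 0 <= n.+1%:R * c2 / mu by rewrite divr_ge0 ?mulr_ge0 ?(ltW mu0).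
have C30 : 0 <= C3 by rewrite addr_ge0.
pose K : R := CA * CB * CB.
have K0 : 0 <= K by rewrite !mulr_ge0// ltW.
pose sg : R := 1 + 20 * (7 * C3 + 1) + K.
have C37 : 0 <= 20 * (7 * C3 + 1) by rewrite mulr_ge0// addr_ge0// mulr_ge0.
have s1 : 1 <= sg by rewrite /sg -addrA lerDl addr_ge0.
have sg0 : 0 < sg by apply: lt_le_trans s1.
have ss (k : nat) : sg <= sg ^+ k.+1 by rewrite exprS ler_peMr ?(ltW sg0)// exprn_ege1.
have sC : 20 * (7 * C3 + 1) < sg ^+ 2.
  have K1 : 0 < 1 + K by rewrite ltr_pwDl.
  by apply: lt_le_trans (ss 1%N); rewrite /sg addrAC ltr_pwDl.
exists (sg ^+ 4 / 10 - C3 * (1 + sg ^+ 2) - 1) => eta be.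
have [p pC Hp] := HC eta be.
have eB : `|eta| <= CB by apply: HCB; case: be.
have bound x : `|paraboloid (phi eta) p A eta x - (2^-1 * qf A x + dot b x)| <=
    C3 * (1 + radius A x ^+ 2).
  have -> : paraboloid (phi eta) p A eta x - (2^-1 * qf A x + dot b x) =
      (phi eta - dot p eta + 2^-1 * qf A eta) + dot (p - eta *m A - b) x.
    rewrite /paraboloid (qfD x (- eta) pA.1) qfN dotNr dotBr !dotBl (bf_sym eta x pA.1).
    by lra.
  have k1 : `|phi eta - dot p eta + 2^-1 * qf A eta| <= c1.
    apply: (le_trans (ler_normD _ _)); rewrite /c1; apply: lerD.
      apply: (le_trans (ler_normB _ _)); apply: lerD; first exact: HB.
      apply: (le_trans (norm_dot_le _ _)); apply: ler_pM => //.
      by apply: ler_wpM2l.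
    rewrite normrM gtr0_norm ?invr_gt0//.
    have q1 : `|qf A eta| <= CA * CB * CB.
      apply: (le_trans (HCA _ _)); apply: ler_pM => //; first by rewrite mulr_ge0// ltW.
      by apply: ler_wpM2l => //; exact: ltW.
    by apply: le_trans q1; apply: ler_piMl => //; rewrite invf_le1 ?ler1n.
  have k2 : `|dot (p - eta *m A - b) x| <= n.+1%:R * c2 / mu * radius A x ^+ 2.
    apply: (le_trans (norm_dot_le _ _)).
    have v2 : `|p - eta *m A - b| <= c2.
      apply: (le_trans (ler_normB _ _)); rewrite /c2 lerD2r.
      apply: (le_trans (ler_normB _ _)); apply: lerD => //.
      by apply: (le_trans (HCM _)); apply: ler_wpM2l => //; exact: ltW.
    have -> : n.+1%:R * c2 / mu * radius A x ^+ 2 = n.+1%:R * c2 * (radius A x ^+ 2 / mu).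
      by ring.
    by apply: ler_pM => //; apply: ler_wpM2l.
  apply: (le_trans (ler_normD _ _)).
  have r2 : 0 <= radius A x ^+ 2 by exact: sqr_ge0.
  have : 0 <= c1 * radius A x ^+ 2 by exact: mulr_ge0.
  have -> : C3 * (1 + radius A x ^+ 2) = c1 + n.+1%:R * c2 / mu * radius A x ^+ 2 +
      (c1 * radius A x ^+ 2 + n.+1%:R * c2 / mu) by rewrite /C3; ring.
  move=> H; apply: (le_trans (lerD k1 k2)); rewrite lerDl; exact: addr_ge0.
have [w [gw win wcap wout]] := @glue _ _ A b (phi eta) p eta C3 sg n3 pA dA C30 s1 sC bound.
have rz z : boundary Omega z -> radius A z <= sg.
  move=> bz; have zB : `|z| <= CB by apply: HCB; case: bz.
  rewrite -(@ler_pXn2r _ 4)// ?nnegrE ?quarter_ge0 ?(ltW sg0)// radiusX4//.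
  apply: (@le_trans _ _ K).
    apply: (le_trans (ler_norm _)); apply: (le_trans (HCA _ _)).
    by apply: ler_pM => //; [rewrite mulr_ge0// ltW|apply: ler_wpM2l => //; exact: ltW].
  by apply: le_trans (ss 3%N); rewrite /sg lerDr addr_ge0.
exists w; split.
- exact: gw.
- by rewrite win ?rz// /paraboloid subrr dot0r qf0 mulr0 !addr0.
- by move=> z bz; rewrite win ?rz//; exact: Hp.
- exact: wcap.
- move=> e e0.
  have a0 : 0 < sg ^+ 5 / 10 by rewrite divr_gt0// exprn_gt0.
  have s20 : 0 < 2 * sg by rewrite mulr_gt0.
  pose T := Num.max (2 * sg) (sg ^+ 5 / 10 / e).
  have T0 : 0 <= T by rewrite le_max (ltW s20).
  have [M HM] := radius_at_infinity T0.
  exists M => x /HM; rewrite gt_max => /andP[x1 x2].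
  have x0 : 0 < radius A x by apply: lt_trans x1.
  rewrite (wout x (ltW x1)) /quadratic -[(x *m A *m x^T) 0 0]/(qf A x).
  rewrite opprB addrC subrK ler_pdivrMr//.
  by rewrite ltr_pdivrMr// in x2; rewrite [leRHS]mulrC ltW.
Qed.

End family.

(** * The upper envelope of the subsolutions *)

Lemma perron_upper_arith (R : realType) (wx a1 a2 a3 a4 a5 a6 a7 a8 p q : R) :
  a1 <= a2 -> a3 <= p - a4 -> a2 - a4 <= a5 -> a5 <= a6 -> a7 <= a8 -> p - q <= a7 ->
  wx <= a3 + a1 -> wx <= q + (a8 + a6).
Proof. lra. Qed.

Section perron.
Context {R : realType} {n : nat}.
Variable (Omega : set 'rV[R]_n.+1) (phi : 'rV[R]_n.+1 -> R).
Hypothesis n3 : (3 <= n.+1)%N.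
Hypothesis dom : domain Omega.
Hypothesis bdd : bounded_set Omega.
Hypothesis sconv : strictly_convex Omega.
Hypothesis sphi : semi_convex_wrt Omega phi.
Variables (A : 'M[R]_n.+1) (b : 'rV[R]_n.+1) (c : R).
Hypotheses (pA : posdef A) (dA : \det A = 1).
Hypothesis family : forall eta, boundary Omega eta ->
  exists w, [/\ forall x, germ w x, w eta = phi eta,
    forall z, boundary Omega z -> w z <= phi z,
    forall x, w x <= quadratic A b c x &
    forall e : R, 0 < e -> exists M : R, forall x, M < enorm x ->
      quadratic A b c x - w x <= e].
Implicit Types (x z eta xi : 'rV[R]_n.+1) (w : 'rV[R]_n.+1 -> R).

Let n0 : (0 < n)%N. Proof. by case: n n3. Qed.
Let D : set 'rV[R]_n.+1 := ~` closure Omega.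
Let Q x := quadratic A b c x.

Lemma open_exterior : open D.
Proof. by rewrite openC; exact: closed_closure. Qed.

Lemma exterior_notin x : D x -> (~` Omega) x.
Proof. by move=> Dx Ox; apply: Dx; exact: subset_closure. Qed.

Lemma boundary_notin x : boundary Omega x -> (~` Omega) x.
Proof. by move=> /(boundaryE dom) []. Qed.

Lemma notin_cases x : (~` Omega) x -> D x \/ boundary Omega x.
Proof.
move=> nO; have [cx|ncx] := pselect (closure Omega x); last by left.
by right; apply/(boundaryE dom).
Qed.

Lemma quadraticE x : Q x = paraboloid c b A 0 x.
Proof.
by rewrite /paraboloid subr0 /Q /quadratic -[(x *m A *m x^T) 0 0]/(qf A x); ring.
Qed.

Lemma quadratic_continuous : continuous Q.
Proof. by rewrite (_ : Q = paraboloid c b A 0); [exact: paraboloid_continuous|apply/funext => x; exact: quadraticE]. Qed.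

(** The cap by the paraboloid makes the envelope finite and gives half of the
    behaviour at infinity. *)
Definition admissible w : Prop :=
  [/\ {within ~` Omega, continuous w}, forall x, D x -> germ w x,
    forall z, boundary Omega z -> w z <= phi z &
    forall x, (~` Omega) x -> w x <= Q x].

Lemma germ_continuous_within w : (forall x, germ w x) ->
  {within ~` Omega, continuous w}.
Proof. by move=> gw; apply: within_continuousW => x _; have [] := gw x. Qed.

Lemma family_admissible eta : boundary Omega eta ->
  exists w, [/\ admissible w, w eta = phi eta, forall x, germ w x &
    forall e : R, 0 < e -> exists M : R, forall x, M < enorm x -> Q x - w x <= e].
Proof.
move=> /family [w [gw we wb wq wa]]; exists w; split=> //; split=> //.
exact: germ_continuous_within.
Qed.

Lemma boundary_nonempty : boundary Omega !=set0.
Proof.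
have [B B0 HB] := closure_bound bdd.
have [|xi [bxi _ _]] := nearest_point n0 dom bdd sconv (x := const_mx (B + 1)).
  move=> /HB; rewrite leNgt => /negP; apply.
  have := le_coord_norm (const_mx (B + 1) : 'rV[R]_n.+1) 0; rewrite mxE => H.
  apply: lt_le_trans H; rewrite gtr0_norm ?ltrDl// addr_gt0//.
by exists xi.
Qed.

Let S : set ('rV[R]_n.+1 -> R) := [set w | admissible w].

Lemma S_nonempty : S !=set0.
Proof.
by have [xi bxi] := boundary_nonempty; have [w [Sw _ _ _]] := family_admissible bxi; exists w.
Qed.

Let u : 'rV[R]_n.+1 -> R := upper_envelope S.

Let Sgerm w : S w -> forall x, D x -> germ w x.
Proof. by move=> [_ + _ _]. Qed.

Let SQ w : S w -> forall x, D x -> w x <= Q x.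
Proof. by move=> [_ _ _ H] x Dx; apply: H; exact: exterior_notin. Qed.

Lemma perron_germ x : D x -> germ u x.
Proof.
by move=> Dx; apply: (envelope_germ open_exterior S_nonempty Sgerm SQ) => // z _;
  exact: quadratic_continuous.
Qed.

Lemma le_perron w x : S w -> (~` Omega) x -> w x <= u x.
Proof.
move=> Sw nO; apply: sup_upper_bound; last by exists w.
split; first by exists (w x), w.
by exists (Q x) => _ [v [_ _ _ Hv] <-]; exact: Hv.
Qed.

Lemma perron_le x (M : R) : (forall w, S w -> w x <= M) -> u x <= M.
Proof. exact: (envelope_le S_nonempty). Qed.

Lemma perron_le_quadratic x : (~` Omega) x -> u x <= Q x.
Proof. by move=> nO; apply: perron_le => w [_ _ _]; exact. Qed.

Lemma perron_boundary x : boundary Omega x -> u x = phi x.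
Proof.
move=> bx; apply/eqP; rewrite eq_le; apply/andP; split.
  by apply: perron_le => w [_ _ + _]; apply.
have [w [Sw <- _ _]] := family_admissible bx.
by apply: le_perron => //; exact: boundary_notin.
Qed.

(** Convexity alone provides the upper barrier: on the ray from the nearest
    boundary point through [x], a member of the family lies below the chord
    that ends on the paraboloid at unit distance. *)
Lemma perron_upper xi : boundary Omega xi -> exists s L : R, [/\ 0 < s, 0 < L &
  forall x, (~` Omega) x -> `|x - xi| < s -> u x <= phi xi + L * `|x - xi|].
Proof.
move=> bxi.
have [s [C [s0 C0 HL]]] := semi_convex_lipschitz bxi (sphi bxi).
have [B B0 HB] := phi_bounded dom bdd sphi.
have [CB CB0 HCB] := closure_bound bdd.
have [K K0 HK] : exists2 K : R, 0 <= K & forall y : 'rV[R]_n.+1, `|y| <= CB + 1 -> Q y <= K.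
  have c0 : [set y : 'rV[R]_n.+1 | `|y| <= CB + 1] !=set0.
    by exists 0; rewrite /= normr0 addr_ge0// ltW.
  have [y _ Hy] := EVT_max_rV c0 (closed_ball0_compact (r := CB + 1))
    (continuous_subspaceT quadratic_continuous).
  exists (Num.max 0 (Q y)); first by rewrite le_max lexx.
  by move=> z zB; rewrite le_max Hy ?orbT// inE.
pose N : R := n.+1%:R.
have N1 : 1 <= N by rewrite ler1n.
have N0 : 0 < N by apply: lt_le_trans N1.
pose L := C * (N + 1) + N * (K + B).
have NKB : 0 <= N * (K + B) by rewrite mulr_ge0 ?addr_ge0// ltW.
have L0 : 0 < L by rewrite ltr_pwDl// mulr_gt0// addr_gt0.
exists (Num.min (s / (N + 1)) N^-1), L; split=> //.
  by rewrite lt_min invr_gt0 N0 divr_gt0// addr_gt0.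
move=> x nO; rewrite lt_min => /andP[xs x1].
have xs' : `|x - xi| * (N + 1) < s by rewrite -ltr_pdivlMr// addr_gt0.
have xN : `|x - xi| * N < 1 by rewrite -ltr_pdivlMr// div1r.
have nx0 := normr_ge0 (x - xi).
have [Dx|bx] := notin_cases nO; last first.
  rewrite perron_boundary//.
  have xs2 : `|x - xi| < s.
    by apply: le_lt_trans xs'; rewrite ler_peMr// lerDr ltW.
  have := HL x bx xs2; rewrite ler_norml => /andP[_ H].
  have : C * `|x - xi| <= L * `|x - xi|.
    rewrite ler_wpM2r// /L; apply: (@le_trans _ _ (C * (N + 1))); last by rewrite lerDl.
    by rewrite ler_peMr ?(ltW C0)// lerDr ltW.
  by move: H; move: (C * _) (L * _) => *; lra.
have [eta [be out close]] := nearest_point n0 dom bdd sconv Dx.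
have d1 : `|x - eta| <= N * `|x - xi|.
  rewrite -(@ler_pXn2r _ 2)// ?nnegrE ?mulr_ge0 ?(ltW N0)//.
  apply: (le_trans (norm_sqr_le_dot _)); apply: (le_trans (close xi _)); first by case: bxi.
  apply: (le_trans (dot_le_norm_sqr _)); rewrite exprMn ler_wpM2r ?sqr_ge0//.
  by rewrite expr2 ler_peMr// ltW.
have etaxi : `|eta - xi| <= (N + 1) * `|x - xi|.
  rewrite (_ : eta - xi = (x - xi) - (x - eta)); last first.
    by apply/rowP => i; rewrite !mxE; ring.
  apply: (le_trans (ler_normB _ _)).
  by rewrite mulrDl mul1r addrC lerD2r.
have etas : `|eta - xi| < s by apply: le_lt_trans etaxi _; rewrite mulrC.
have := HL eta be etas; rewrite ler_norml => /andP[_ pe].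
have nd : x - eta != 0.
  rewrite subr_eq0; apply: contra_notN Dx => /eqP ->; by case: be.
pose t := `|x - eta|.
have t0 : 0 < t by rewrite normr_gt0.
have t1 : t < 1 by apply: le_lt_trans d1 _; rewrite mulrC.
pose y := eta + t^-1 *: (x - eta).
have yB : `|y| <= CB + 1.
  apply: (le_trans (ler_normD _ _)); apply: lerD; first by apply: HCB; case: be.
  by rewrite normrZ gtr0_norm ?invr_gt0// mulVf// gt_eqF.
have seg (a : R) : (1 - a) *: eta + a *: y = eta + (a / t) *: (x - eta).
  by rewrite lineE /y [eta + _ - eta]addrC addKr scalerA.
apply: perron_le => w Sw; have [cw gw wb wq] := Sw.
have := @segment_chord _ _ (~` Omega) w eta y cw _ _ t ltac:(by rewrite !ltW).
rewrite seg divff ?gt_eqF// scale1r addrC subrK => H.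
have {H} Hw : w x <= (1 - t) * w eta + t * w y.
  apply: H => a.
    move=> /andP[a0 a1]; rewrite seg; have [->|an] := eqVneq a 0.
      by rewrite mul0r scale0r addr0; exact: boundary_notin.
    apply: exterior_notin; apply: out; rewrite divr_gt0// lt_neqAle eq_sym an//.
  move=> /andP[a0 a1]; rewrite seg.
  by have [] := gw (eta + (a / t) *: (x - eta)) (out _ (divr_gt0 a0 t0)).
have yout : (~` Omega) y.
  by apply: exterior_notin; apply: out; rewrite invr_gt0.
have wy : w y <= K by rewrite (le_trans (wq y yout))// HK.
have weta := wb eta be.
have := HB eta be; rewrite ler_norml => /andP[pB _].
have k1 : t * w y <= t * K by rewrite ler_pM2l.
have k2 : (1 - t) * w eta <= phi eta - t * phi eta.
  have -> : phi eta - t * phi eta = (1 - t) * phi eta by ring.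
  by rewrite ler_wpM2l// subr_ge0 ltW.
have k3 : t * K - t * phi eta <= t * (K + B).
  have pB' : - phi eta <= B by rewrite lerNl.
  by rewrite -mulrBr ler_pM2l// lerD2l.
have k4 : t * (K + B) <= N * `|x - xi| * (K + B) by rewrite ler_wpM2r// addr_ge0// ltW.
have k5 : C * `|eta - xi| <= C * ((N + 1) * `|x - xi|) by rewrite ler_wpM2l// ltW.
have -> : L * `|x - xi| = C * ((N + 1) * `|x - xi|) + N * `|x - xi| * (K + B).
  by rewrite /L; ring.
exact: (perron_upper_arith k1 k2 k3 k4 k5 pe Hw).
Qed.

Lemma perron_continuous : {within ~` Omega, continuous u}.
Proof.
apply/subspace_continuousP => x nO; have [Dx|bx] := notin_cases nO.
  have [cu _ _] := perron_germ Dx.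
  exact: (cvg_trans (cvg_app _ (cvg_within _)) cu).
have [s [L [s0 L0 HL]]] := perron_upper bx.
have [w [Sw we gw _]] := family_admissible bx.
have [cw _ _] := gw x.
apply/cvgrPdist_le => e e0.
suff : \forall z \near x, (~` Omega) z -> `|u x - u z| <= e by [].
have Lw : \forall z \near x, `|w x - w z| <= e by move/cvgrPdist_le : cw; exact.
have Lx : \forall z \near x, `|z - x| < Num.min s (e / L).
  by apply: nbhs_rV_ball; rewrite lt_min s0 divr_gt0.
apply: (@filterS2 _ (nbhs x) _ _ _ _ _ Lw Lx) => z.
rewrite we lt_min => /[swap] /andP[zs ze].
rewrite ltr_pdivlMr// in ze.
rewrite perron_boundary// !ler_norml => /andP[w1 w2] nz.
have := HL z nz zs; have := le_perron Sw nz; rewrite mulrC in ze.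
move: (u z) (phi x) (w z) (L * _) w1 w2 ze => a1 a2 a3 a4 w1 w2 w3 w4 w5.
by apply/andP; split; lra.
Qed.

Lemma dist_continuous x : continuous (fun z => `|z - x|).
Proof.
move=> z; apply: (@continuous_comp _ _ _ (fun y : 'rV[R]_n.+1 => y - x) Num.norm z).
  exact: (@subr_continuous R 'rV[R]_n.+1 x z).
exact: norm_continuous.
Qed.

Lemma bump_arith (u0 p q g m r2 s uz d M : R) :
  u0 + p + 2^-1 * M <= uz -> m * s <= M -> r2 / 4 < s -> q = (1 - g) * M ->
  0 < g -> 0 < m -> d = g * m * r2 / 16 -> 0 < r2 -> u0 + d + p + 2^-1 * q < uz.
Proof.
move=> h1 h2 h3 -> g0 m0 -> r0.
have : m * (r2 / 4) < M by apply: lt_le_trans h2; rewrite ltr_pM2l.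
rewrite -(ltr_pM2l g0) => h4.
have : 0 < g * m * r2 by rewrite !mulr_gt0.
have e1 : g * (m * (r2 / 4)) = g * m * r2 / 4 by ring.
have e2 : (1 - g) * M = M - g * M by ring.
by rewrite e1 in h4; rewrite e2; move: (g * M) (g * m * r2) h4 => a1 a2 h4 h5; lra.
Qed.

(** Below the paraboloid at infinity there is room to lift the envelope by a
    strict subsolution; where it meets that paraboloid, comparison of
    determinants replaces the lifting. *)
Lemma perron_supersolution x : D x -> supersolution_at u x.
Proof.
move=> Dx p M pM T; rewrite leNgt; apply/negP => dM.
have oD := open_exterior.
have := perron_le_quadratic (exterior_notin Dx); rewrite le_eqVlt => /orP[/eqP ux|ux].
  have [] // := det_le_of_qf_le pM pA.1; last first.
    by rewrite dA => _ /(lt_le_trans dM); rewrite ltxx.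
  apply: (@qf_le_of_near _ _ p (b + (x - 0) *m A)).
  have Dh : \forall h \near (0 : 'rV[R]_n.+1), D (x + h).
    by apply: near0_add; exact: open_nbhs_nbhs.
  apply: (@filterS2 _ (nbhs (0 : 'rV[R]_n.+1)) _ _ _ _ _ T Dh) => h Th Dxh.
  have := perron_le_quadratic (exterior_notin Dxh).
  have -> : Q (x + h) = Q x + dot (b + (x - 0) *m A) h + 2^-1 * qf A h.
    by rewrite !quadraticE; apply: paraboloidD; exact: pA.1.
  move: Th; rewrite ux; move: (u _) (Q x) (dot _ _) (dot _ _) (qf _ _) (qf _ _).
  by move=> a1 a2 a3 a4 a5 a6; lra.
have [g [g0 g1 gM]] := bernoulli_gap n.+1 dM.
have pN : posdef ((1 - g) *: M) by apply: posdefZ => //; rewrite subr_gt0.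
have dN : 1 <= \det ((1 - g) *: M) by rewrite detZ ltW.
set N := (1 - g) *: M in pN dN.
have [m m0 Hm] := posdef_ge pM.
pose d0 := (Q x - u x) / 2.
have d00 : 0 < d0 by rewrite divr_gt0// subr_gt0.
have [r1 r10 H1] := near_ball_rV T.
have [r2 r20 H2] : exists2 r : R, 0 < r & forall z, `|z - x| < r ->
    D z /\ paraboloid (u x) p N x z + d0 <= Q z.
  apply: near_ball_rV.
  have cd : {for x, continuous (fun z => Q z - paraboloid (u x) p N x z)}.
    exact: (@cvgB _ _ _ (nbhs x) _ Q _ _ _ (@quadratic_continuous x)
      (@paraboloid_continuous R _ (u x) p N x x)).
  have k1 : \forall z \near x, d0 < Q z - paraboloid (u x) p N x z.
    apply: (cvgr_gt _ cd).
    rewrite /paraboloid subrr dot0r qf0 mulr0 !addr0 /d0 ltr_pdivrMr//.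
    by rewrite ltr_pMr ?subr_gt0// ltr1n.
  have k2 : \forall z \near x, D z by exact: open_nbhs_nbhs.
  apply: (@filterS2 _ (nbhs x) _ _ _ _ _ k1 k2) => z h1 h2; split=> //.
  by rewrite addrC -lerBrDr ltW.
pose r := Num.min r1 r2.
have r0 : 0 < r by rewrite lt_min r10.
pose d := Num.min d0 (g * m * r ^+ 2 / 16).
have gmr : 0 < g * m * r ^+ 2 / 16 by rewrite divr_gt0// !mulr_gt0// exprn_gt0.
have d1 : 0 < d by rewrite lt_min d00.
pose bump := paraboloid (u x + d) p N x.
have bumpE z : bump z = paraboloid (u x) p N x z + d by rewrite /bump /paraboloid; ring.
have annulus z : `|z - x| < r -> r / 2 < `|z - x| -> bump z < u z.
  move=> zr1 zr2; have zr : `|z - x| < r1.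
    by apply: lt_le_trans zr1 _; rewrite ge_min lexx.
  have := H1 (z - x); rewrite subr0 => /(_ zr); rewrite [x + _]addrC subrK => h1.
  apply: (@le_lt_trans _ _ (u x + g * m * r ^+ 2 / 16 + dot p (z - x) + 2^-1 * qf N (z - x))).
    by rewrite /bump /paraboloid !lerD2r lerD2l ge_min lexx orbT.
  apply: (bump_arith h1 (Hm (z - x)) (r2 := r ^+ 2) (g := g)) => //; last exact: exprn_gt0.
    rewrite (_ : _ / 4 = (r / 2) ^+ 2); last by field.
    by rewrite ltr_pXn2r// nnegrE ?divr_ge0 ?(ltW r0).
  by rewrite /N qfZM.
pose w z := if `|z - x| < r then Num.max (u z) (bump z) else u z.
have w_far z : r / 2 < `|z - x| -> \forall y \near z, u y = w y.
  move=> zr; have cn := @dist_continuous x z.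
  apply: filterS (cvgr_gt _ cn _ zr) => y yr; rewrite /w.
  by case: ifP => // yr'; rewrite max_l// ltW// annulus.
have w_cases z : (\forall y \near z, u y = w y) \/ `|z - x| < r.
  have [zr|zr] := ltP `|z - x| r; [by right|left; apply: w_far].
  by apply: lt_le_trans zr; rewrite ltr_pdivrMr// ltr_pMr// ltr1n.
have w_germ z : D z -> germ w z.
  move=> Dz; have [uw|zr] := w_cases z; first exact: germ_eq uw (perron_germ Dz).
  have : germ (fun z => Num.max (u z) (bump z)) z.
    by apply: germ_max; [exact: perron_germ|exact: paraboloid_germ].
  apply: germ_eq.
  have cn := @dist_continuous x z.
  by apply: filterS (cvgr_lt _ cn _ zr) => y yr; rewrite /w yr.
have w_ball z : `|z - x| < r -> D z /\ bump z <= Q z.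
  move=> zr; have [|Dz zQ] := H2 z; first by apply: lt_le_trans zr _; rewrite ge_min lexx orbT.
  split=> //; apply: le_trans zQ; rewrite bumpE lerD2l ge_min lexx//.
have w_boundary z : boundary Omega z -> \forall y \near z, u y = w y.
  move=> bz; have [//|/w_ball[Dz _]] := w_cases z.
  by case: Dz; case: bz.
have Sw : S w.
  split.
  - apply/subspace_continuousP => z nO; have [Dz|bz] := notin_cases nO.
      have [cw _ _] := w_germ z Dz.
      exact: (cvg_trans (cvg_app _ (cvg_within _)) cw).
    have uw := w_boundary z bz.
    have cu : u y @[y --> within (~` Omega) (nbhs z)] --> u z.
      by have := perron_continuous; rewrite subspace_continuousP => /(_ z nO).
    have : w y @[y --> within (~` Omega) (nbhs z)] --> u z.
      apply: cvg_trans cu; apply: near_eq_cvg.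
      suff : \forall y \near z, (~` Omega) y -> u y = w y by [].
      by apply: filterS uw => y ->.
    by rewrite (nbhs_singleton uw).
  - exact: w_germ.
  - by move=> z bz; rewrite -(nbhs_singleton (w_boundary z bz)) perron_boundary.
  - move=> z nO; rewrite /w; case: ifP => [/w_ball[_ zQ]|_]; last exact: perron_le_quadratic.
    by rewrite ge_max zQ perron_le_quadratic.
have := le_perron Sw (exterior_notin Dx).
rewrite /w subrr normr0 r0 ge_max => /andP[_].
by rewrite bumpE /paraboloid subrr dot0r qf0 mulr0 !addr0 gerDl leNgt d1.
Qed.

(** The squeeze between a member of the family and the paraboloid gives the
    behaviour at infinity. *)
Lemma perron_at_infinity :
  (u x - quadratic A b c x) @[x --> at_infinity] --> (0 : R).
Proof.
have [xi bxi] := boundary_nonempty.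
have [w [Sw _ _ Hw]] := family_admissible bxi.
have [CB CB0 HCB] := closure_bound bdd.
move=> V /nbhs_ballP [e /= e0 eV].
have e2 : 0 < e / 2 by rewrite divr_gt0.
have [M HM] := Hw _ e2.
exists (Num.max M (Num.sqrt (n.+1%:R * CB ^+ 2))) => // x /=; rewrite gt_max => /andP[xM xC].
apply: eV; rewrite -ball_normE /= sub0r normrN.
have nO : (~` Omega) x.
  move=> Ox; have xB : `|x| <= CB by apply: HCB; exact: subset_closure.
  move: xC; rewrite ltNge => /negP; apply.
  rewrite ler_wsqrtr//; apply: (le_trans (dot_le_norm_sqr _)); rewrite ler_wpM2l//.
  rewrite ler_pXn2r// ?nnegrE; first exact: normr_ge0.
  exact: ltW.
have h1 := perron_le_quadratic nO; have h2 := le_perron Sw nO; have h3 := HM x xM.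
rewrite ltr_norml; move: h1 h2 h3; rewrite -/(Q x).
move: (u x) (Q x) (w x) => a1 a2 a3 h1 h2 h3.
by apply/andP; split; lra.
Qed.

Lemma perron_solution : exists v, exterior_solution Omega phi A b c v.
Proof.
have oD := open_exterior.
exists u; split.
- exact: perron_continuous.
- split.
  + by apply: locally_convex_of_midconvex => // x /perron_germ [].
  + by apply: viscosity_subsolutionP => // x /perron_germ [].
  + by apply: viscosity_supersolutionP => //; exact: perron_supersolution.
- exact: perron_boundary.
- exact: perron_at_infinity.
Qed.

End perron.

(** * The equivalence *)

Theorem theorem1p6 (R : realType) (n : nat) (hn : (3 <= n.+1)%N)
    (Omega : set 'rV[R]_n.+1) (phi : 'rV[R]_n.+1 -> R)
    (hdomain : domain Omega) (hbounded : bounded_set Omega)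
    (hconvex : strictly_convex Omega) (hsmooth : Ck_boundary 3 Omega)
    (A : 'M[R]_n.+1) (hA : calA A) (b : 'rV[R]_n.+1) :
  (exists (c : R) (u : 'rV[R]_n.+1 -> R), exterior_solution Omega phi A b c u)
  <-> semi_convex_wrt Omega phi.
Proof.
have n0 : (0 < n)%N by case: n hn {Omega phi hdomain hbounded hconvex hsmooth A hA b}.
split=> [[c [u [cu [lu _ _] ub _]]]|sphi].
  exact: (semi_convex_of_solution n0 hdomain hconvex cu lu ub).
have [sA pA dA] := hA.
have pdA : posdef A by split.
have [c Hc] := subsolution_family hn hdomain hbounded hconvex sphi b pdA dA.
have [v Hv] := perron_solution hn hdomain hbounded hconvex sphi pdA dA Hc.
by exists c, v.
Qed.
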